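(* For all $\gamma>1$ and $n\in\{2,3\}$ there exist a non-trivial (i.e. not identically zero) function $u\in H^1(\mathbb{R}^n;\mathbb{C}^N)\cap C^\infty(\mathbb{R}^n\setminus\{0\};\mathbb{C}^N)$ and constants $C_1,C_2,C_3>0$ such that for all $x\in\mathbb{R}^n\setminus\{0\}$ $$|u(x)|\le C_1\exp\left[-\frac{C_2}{|x|^{2\gamma-2}}\right]$$ and $$|\mathcal{D}_nu(x)|\le\begin{cases}C_3|x|^{-\gamma}\,|u(x)|&\text{for }n=2,\\ C_3|x|^{-\gamma}\,\bigl|\log|x|\bigr|^3\,|u(x)|&\text{for }n=3.\end{cases}$$
   Context: For $n\ge2$, $N:=2^{\lfloor\frac{n+1}{2}\rfloor}$ (so $N=2$ for $n=2$ and $N=4$ for $n=3$), and $\alpha_1,\dots,\alpha_{n+1}\in\mathbb{C}^{N\times N}$ are fixed Hermitian matrices satisfying $\alpha_j\alpha_k+\alpha_k\alpha_j=2\delta_{j,k}\mathbb{I}_N$ for $1\le j,k\le n+1$ ($\delta_{j,k}$ the Kronecker delta, $\mathbb{I}_N$ the identity matrix). For $n=2$ one takes $\alpha_1=\begin{pmatrix}0&1\\1&0\end{pmatrix}$, $\alpha_2=\begin{pmatrix}0&-i\\i&0\end{pmatrix}$, $\alpha_3=\begin{pmatrix}1&0\\0&-1\end{pmatrix}$. The massless Dirac operator $\mathcal{D}_n$ acts on functions $\psi:\mathbb{R}^n\to\mathbb{C}^N$ by $\mathcal{D}_n\psi:=-i\sum_{j=1}^n\alpha_j\partial_j\psi$.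 $|\cdot|$ denotes the Euclidean norm. *)

(* Defs.v *)
From HB Require Import structures.
From mathcomp Require Import all_boot all_order all_algebra.
From mathcomp Require Import all_classical all_reals all_analysis.
From mathcomp Require Import complex.

Set Implicit Arguments.
Unset Strict Implicit.
Unset Printing Implicit Defensive.

Import Order.TTheory GRing.Theory Num.Theory.
Import numFieldNormedType.Exports.

Local Open Scope classical_set_scope.
Local Open Scope ring_scope.

(* R^n is ['rV[R]_n]. Its library norm is the sup norm (with the right topology
   and the right derivatives), so the Euclidean norm is introduced separately. *)
Definition enorm (R : realType) (n : nat) (x : 'rV[R]_n) : R :=
  Num.sqrt (\sum_(i < n) x ord0 i ^+ 2).

Definition cnorm (R : realType) (N : nat) (z : 'cV[R[i]]_N) : R :=
  Num.sqrt (\sum_(k < N) (complex.Re (z k ord0) ^+ 2 + complex.Im (z k ord0) ^+ 2)).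

(* The Borel sigma-algebra of R^n, as generated by the coordinates. *)
Section rv_measurable.
Context {R : realType} (n : nat).

Let coord : 'I_n -> 'rV[R]_n -> measurableTypeR R := fun i x => x ord0 i.

Let rv_set0 : g_sigma_preimage coord set0.
Proof. exact: sigma_algebra0. Qed.

Let rv_setC A : g_sigma_preimage coord A -> g_sigma_preimage coord (~` A).
Proof. exact: sigma_algebraC. Qed.

Let rv_bigcup (F : (set 'rV[R]_n)^nat) :
  (forall i, g_sigma_preimage coord (F i)) ->
  g_sigma_preimage coord (\bigcup_i (F i)).
Proof. exact: sigma_algebra_bigcup. Qed.

HB.instance Definition _ := @isMeasurable.Build default_measure_display
  'rV[R]_n (g_sigma_preimage coord) rv_set0 rv_setC rv_bigcup.

Lemma measurable_rv_coord (i : 'I_n) :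
  measurable_fun setT (fun x : 'rV[R]_n => x ord0 i : measurableTypeR R).
Proof.
move=> _ Y mY; rewrite setTI; apply: sub_sigma_algebra => /=.
rewrite -bigcup_seq/=; exists i => /=; first by rewrite mem_index_enum.
by exists Y => //; rewrite setTI.
Qed.

Lemma measurable_fun_rvP d (T : measurableType d) (f : T -> 'rV[R]_n) :
  measurable_fun setT f <->
  forall i, measurable_fun setT (fun t => f t ord0 i : measurableTypeR R).
Proof.
split=> [mf i|mf].
  exact: (measurableT_comp (@measurable_rv_coord i) mf).
have : g_sigma_preimage (fun i => coord i \o f) `<=` measurable.
  apply: smallest_sub; first exact: sigma_algebra_measurable.
  move=> A; rewrite -bigcup_seq => -[i _] [B mB <-].
  exact: mf.
rewrite g_sigma_preimage_comp => h _ A mA.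
by apply: h; exists A.
Qed.

End rv_measurable.

Section rv_cons.
Context {R : realType} (n : nat).

Definition rv_cons (p : measurableTypeR R * 'rV[R]_n) : 'rV[R]_n.+1 :=
  \row_j if unlift ord0 j is Some k then p.2 ord0 k else p.1.

Definition rv_uncons (x : 'rV[R]_n.+1) : measurableTypeR R * 'rV[R]_n :=
  (x ord0 ord0, \row_k x ord0 (lift ord0 k)).

Lemma rv_consK : cancel rv_cons rv_uncons.
Proof.
move=> [a v]; rewrite /rv_uncons mxE unlift_none; congr (_, _).
by apply/rowP => k; rewrite !mxE liftK.
Qed.

Lemma rv_unconsK : cancel rv_uncons rv_cons.
Proof.
by move=> x; apply/rowP => j; rewrite mxE; case: unliftP => [k|] -> //=; rewrite mxE.
Qed.

Lemma measurable_rv_cons : measurable_fun setT rv_cons.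
Proof.
apply/measurable_fun_rvP => i; rewrite /rv_cons.
under eq_fun do rewrite mxE.
case: (unlift ord0 i) => [k|]; last exact: measurable_fst.
exact: (measurableT_comp (@measurable_rv_coord R n k) measurable_snd).
Qed.

Lemma measurable_rv_uncons : measurable_fun setT rv_uncons.
Proof.
apply: measurable_fun_pair; first exact: measurable_rv_coord.
apply/measurable_fun_rvP => i.
under eq_fun do rewrite mxE.
exact: measurable_rv_coord.
Qed.

End rv_cons.

Section lebesgue_rv_succ.
Context {R : realType} (n : nat).
Variable mu : {sigma_finite_measure set 'rV[R]_n -> \bar R}.

Definition lebesgue_rv_succ : set 'rV[R]_n.+1 -> \bar R :=
  pushforward (lebesgue_measure \x mu)%E (@rv_cons R n).

Let measurable_preimage (A : set 'rV[R]_n.+1) :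
  measurable A -> measurable (@rv_cons R n @^-1` A).
Proof.
by move=> mA; rewrite -[X in measurable X]setTI; exact: measurable_rv_cons.
Qed.

Let succ0 : lebesgue_rv_succ set0 = 0%E.
Proof. by rewrite /lebesgue_rv_succ /pushforward preimage_set0 measure0. Qed.

Let succ_ge0 A : (0 <= lebesgue_rv_succ A)%E.
Proof. by rewrite /lebesgue_rv_succ /pushforward; exact: measure_ge0. Qed.

Let succ_sigma_additive : semi_sigma_additive lebesgue_rv_succ.
Proof.
move=> F mF tF mUF; rewrite /lebesgue_rv_succ /pushforward preimage_bigcup.
apply: measure_semi_sigma_additive.
- by move=> k; exact: measurable_preimage.
- apply/trivIsetP => /= i j _ _ ij; rewrite -preimage_setI.
  by move/trivIsetP : tF => /(_ _ _ _ _ ij) ->//; rewrite preimage_set0.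
- by rewrite -preimage_bigcup; exact: measurable_preimage.
Qed.

HB.instance Definition _ := isMeasure.Build _ _ _
  lebesgue_rv_succ succ0 succ_ge0 succ_sigma_additive.

Let succ_sigma_finite : sigma_finite setT lebesgue_rv_succ.
Proof.
have /sigma_finiteP[F [TF ndF Foo]] := sigma_finiteT (@lebesgue_measure R).
have /sigma_finiteP[G [TG ndG Goo]] := sigma_finiteT mu.
exists (fun k => @rv_uncons R n @^-1` (F k `*` G k)).
  rewrite -preimage_bigcup -(preimage_setT (@rv_uncons R n)); congr (_ @^-1` _).
  rewrite -setXTT TF TG predeqE => -[x y]; split.
    move=> [/= [i _ Fix] [k _ Gky]]; exists (maxn i k) => //; split.
    - by move: x Fix; exact/subsetPset/ndF/leq_maxl.
    - by move: y Gky; exact/subsetPset/ndG/leq_maxr.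
  by move=> [i _ []/= ? ?]; split; exists i.
move=> k; have [? ?] := Foo k; have [? ?] := Goo k; split.
  rewrite -[X in measurable X]setTI.
  by apply: measurable_rv_uncons => //; exact: measurableX.
rewrite /lebesgue_rv_succ /pushforward (_ : _ @^-1` _ = F k `*` G k).
  by rewrite product_measure1E// lte_mul_pinfty// ge0_fin_numE.
by rewrite -comp_preimage (_ : _ \o _ = id)//; exact/funext/rv_consK.
Qed.

HB.instance Definition _ := Measure_isSigmaFinite.Build _ _ _
  lebesgue_rv_succ succ_sigma_finite.

End lebesgue_rv_succ.

(* Lebesgue measure on the Borel sets of R^n, as the iterated product of the
   one-dimensional one. *)
Fixpoint lebesgue_rv (R : realType) (n : nat) :
    {sigma_finite_measure set 'rV[R]_n -> \bar R} :=
  if n is m.+1 then lebesgue_rv_succ (lebesgue_rv R m) else \d_(0 : 'rV[R]_0).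

(* The measure of a box is the product of the side lengths. *)
Lemma lebesgue_rv_box (R : realType) (n : nat) (A : 'I_n -> set (measurableTypeR R)) :
  (forall i, measurable (A i)) ->
  lebesgue_rv R n [set x | forall i, A i (x ord0 i)] =
  (\prod_(i < n) lebesgue_measure (A i))%E.
Proof.
elim: n A => [|n IHn] A mA.
  by rewrite big_ord0 /= diracE mem_set// => -[].
have mB : measurable [set x : 'rV[R]_n | forall i, A (lift ord0 i) (x ord0 i)].
  rewrite (_ : [set _ | _] =
    \big[setI/setT]_(i < n) [set x : 'rV[R]_n | A (lift ord0 i) (x ord0 i)]).
    apply: bigsetI_measurable => i _.
    by rewrite -[X in measurable X]setTI; exact: measurable_rv_coord.
  rewrite -bigcap_seq; apply/seteqP; split=> x /= xA i.
    by move=> _; exact: (xA i).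
  by apply: (xA i); rewrite /= mem_index_enum.
rewrite big_ord_recl -IHn// -product_measure1E//.
rewrite [LHS]/= /lebesgue_rv_succ /pushforward; congr (product_measure1 _ _ _).
apply/seteqP; split=> -[a v] /= avA.
  split=> [|i]; first by have := avA ord0; rewrite mxE unlift_none.
  by have := avA (lift ord0 i); rewrite mxE liftK.
by move: avA => [aA vA] i; rewrite mxE; case: unliftP => [k|] ->.
Qed.

Section smooth.
Context {R : realType} {n : nat}.
Implicit Types (f g v phi : 'rV[R]_n -> R) (A : set 'rV[R]_n).

Definition partial (j : 'I_n) f : 'rV[R]_n -> R := 'D_(delta_mx ord0 j) f.

Definition iter_partial (s : seq 'I_n) f : 'rV[R]_n -> R := foldr partial f s.

(* C^infty on A, meant for open A: all partial derivatives of all orders exist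
   and are continuous at the points of A. *)
Definition smooth_on A f : Prop :=
  forall (s : seq 'I_n) x, A x ->
    {for x, continuous (iter_partial s f)} /\
    forall j, derivable (iter_partial s f) x (delta_mx ord0 j).

Definition test_function phi : Prop :=
  smooth_on setT phi /\ compact (closure [set x | phi x != 0]).

(* For g, v in L^2 both integrands are integrable, so the (real-valued) integrals
   are the genuine ones. *)
Definition weak_partial (j : 'I_n) g v : Prop :=
  forall phi, test_function phi ->
    \int[lebesgue_rv R n]_x (g x * partial j phi x) =
    - \int[lebesgue_rv R n]_x (v x * phi x).

Definition sobolev_H1 g : Prop :=
  g \in Lfun (lebesgue_rv R n) 2%:E /\
  forall j, exists2 v, v \in Lfun (lebesgue_rv R n) 2%:E & weak_partial j g v.

End smooth.

Definition spinor_dim (n : nat) : nat := 2 ^ (n.+1)./2.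

(* [R[i]] carries no normed space structure over R in the library, so
   regularity and derivatives of C^N-valued functions are taken on the real and
   imaginary parts of the components. *)
Section spinors.
Context {R : realType} {n N : nat}.
Implicit Types u : 'rV[R]_n -> 'cV[R[i]]_N.

Definition re_part u (k : 'I_N) : 'rV[R]_n -> R :=
  fun x => complex.Re (u x k ord0).
Definition im_part u (k : 'I_N) : 'rV[R]_n -> R :=
  fun x => complex.Im (u x k ord0).

Definition spinor_H1 u : Prop :=
  forall k, sobolev_H1 (re_part u k) /\ sobolev_H1 (im_part u k).

Definition spinor_smooth_on (A : set 'rV[R]_n) u : Prop :=
  forall k, smooth_on A (re_part u k) /\ smooth_on A (im_part u k).

Definition spinor_partial (j : 'I_n) u : 'rV[R]_n -> 'cV[R[i]]_N :=
  fun x => \col_k Complex (partial j (re_part u k) x)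
                          (partial j (im_part u k) x).

(* The last matrix, alpha_(n+1), does not enter the massless operator. *)
Definition dirac_op (alpha : 'I_n.+1 -> 'M[R[i]]_N) u : 'rV[R]_n -> 'cV[R[i]]_N :=
  fun x => - Complex 0 1 *:
    \sum_(j < n) alpha (widen_ord (leqnSn n) j) *m spinor_partial j u x.

End spinors.

Definition mx2 (T : Type) (a b c d : T) : 'M[T]_2 :=
  \matrix_(i, j) if i == ord0 then (if j == ord0 then a else b)
                 else (if j == ord0 then c else d).

Definition pauli (R : realType) (k : 'I_3) : 'M[R[i]]_2 :=
  match val k with
  | 0 => mx2 0 1 1 0
  | 1 => mx2 0 (- Complex 0 1) (Complex 0 1) 0
  | _ => mx2 1 0 0 (- 1)
  end.

(* The fixed family alpha_1, ..., alpha_(n+1), indexed from 0; for n = 2 it is the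
   family of Pauli matrices ([spinor_dim 2] computes to 2). *)
Definition dirac_matrices (R : realType) (n : nat)
    (alpha : 'I_n.+1 -> 'M[R[i]]_(spinor_dim n)) : Prop :=
  [/\ forall j, alpha j \is hermsymmx,
      forall j k, alpha j *m alpha k + alpha k *m alpha j =
                  (2 * (j == k)%:R)%:M
    & match n return ('I_n.+1 -> 'M[R[i]]_(spinor_dim n)) -> Prop with
      | 2 => fun alpha => alpha =1 pauli R
      | _ => fun=> True
      end alpha].

(* Main.v *)
(* Put [beta = (gamma - 1) / 2]. Near 0 the components of [u] are sums over [j] of
   modes [c_j chi_j zeta ^ (j ^ 2)], where [zeta = x_p + i x_q] for one parity of [j] and
   [zeta = x_p - i x_q] for the other, [rho = |zeta| ^ 2], and [chi_j] cuts off to the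
   region where [t = rho ^ (- beta)] is within distance 1 of [j]. The constant [c_j] makes
   [c_j |zeta| ^ (j ^ 2)] tangent at [t = j] to the envelope
   [exp (- rho ^ (- 2 beta) / (4 beta))], and on the support of [chi_j] the two stay
   comparable. A Cauchy-Riemann operator annihilates [zeta ^ (j ^ 2)], so the Dirac
   operator only sees the derivatives of the cutoffs, which are [O(|zeta| ^ (- gamma))];
   and while one parity is being cut off, the other one has full size in a different
   component. In dimension 3 and a Weyl basis, one pair of components carries modes in
   [(x_1, x_2)] away from the x_3-axis, the other one modes in [(x_3, x_2)] away from the
   x_1-axis, and in every direction one of the two has full size.

   Away from 0 the modes are switched off, and [u] becomes the massless solution
   [zeta ^ 2 / |x| ^ 4] in dimension 2, [(x_3, x_1 + i x_2) / |x| ^ 3] in dimension 3, which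
   has been switched on before and decays fast enough for H^1. No logarithm is lost:
   [|log |x|| ^ 3] is bounded below on the support of the modes. *)

Require Import Defs.
From mathcomp Require Import all_boot all_order all_algebra.
From mathcomp Require Import all_classical all_reals all_analysis.
From mathcomp Require Import measurable_realfun.
From mathcomp Require Import complex.
From mathcomp Require Import ring lra zify.

Set Implicit Arguments.
Unset Strict Implicit.
Unset Printing Implicit Defensive.

Import Order.TTheory GRing.Theory Num.Theory.
Import numFieldNormedType.Exports.

Local Open Scope classical_set_scope.
Local Open Scope ring_scope.

(** The exponent j ^ 2 and the unit windows in t are forced. In terms of t the logarithm of |zeta| ^
    m is - m ln t / (2 beta) and that of the envelope is - t ^ 2 / (4 beta). Equal slopes at t = j
    give m = j ^ 2, and near t = j the second derivative of the difference stays bounded, so a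
    window of fixed width costs only a constant factor. The gradient of t has size |zeta| ^ (- 2
    beta - 1) and 2 beta + 1 = gamma, which is the price of a cutoff. The powers of zeta themselves
    have gradients of order |zeta| ^ (1 - 2 gamma), too large for the differential inequality. There
    the Cauchy-Riemann cancellation is indispensable, while for H^1 the envelope absorbs any
    negative power of |zeta|. The other obstacle is cancellation between the modes and the outer
    solution. The first index [j0] is taken so large that one parity is off before the outer
    solution is switched on, which leaves a component free for it. In dimension 3 the outer solution
    also meets the other parity, and the sizes of its two components have to be compared. *)

(** * Smooth functions *)

Section directional.
Context {R : realType} {n : nat}.
Implicit Types (f g : 'rV[R]_n -> R) (A : set 'rV[R]_n) (x : 'rV[R]_n).

Local Notation e j := (delta_mx ord0 j : 'rV[R]_n).

Lemma is_derive_continuous (g : R -> R) (t d : R) :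
  is_derive t 1 g d -> {for t, continuous g}.
Proof. by move=> [/derivable1_diffP/differentiable_continuous]. Qed.

(** Only derivability of [f] along [v] is available, not differentiability, so the chain rule is
    applied to the restriction of [f] to the line through [x]. *)
Lemma is_derive_comp1 (g : R -> R) f x (v : 'rV[R]_n) (df dg : R) :
  is_derive x v f df -> is_derive (f x) 1 g dg ->
  is_derive x v (g \o f) (dg * df).
Proof.
move=> [fx fd] [gx gd].
have dh : derivable (fun h : R => f (h *: v + x)) 0 1
    by move/derivable1P : fx.
have e0 : f (0 *: v + x) = f x by rewrite scale0r add0r.
have E (F : 'rV[R]_n -> R) : 'D_v F x = (fun h : R => F (h *: v + x))^`()%classic 0.
  rewrite derive1E /derive; set g1 := fun h => h^-1 *: _.
  set g2 := fun h => h^-1 *: _; suff -> : g1 = g2 by [].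
  by apply/funext => h; rewrite /g1 /g2/= addr0 scale0r add0r [_%:A]mulr1.
apply: DeriveDef.
  apply/derivable1P; apply/derivable1_diffP.
  move: dh gx => /derivable1_diffP dh /derivable1_diffP gx.
  rewrite -e0 in gx.
  exact: (differentiable_comp dh gx).
have dgx : derivable g (f (0 *: v + x)) 1 by rewrite e0.
rewrite E; have := derive1_comp dh dgx; rewrite /comp => ->.
by rewrite -E fd e0 derive1E gd.
Qed.

Lemma is_derive_coord x (j i : 'I_n) :
  is_derive x (e j) (fun y : 'rV[R]_n => y ord0 i) (i == j)%:R.
Proof.
have H (h : R) : h != 0 ->
    h^-1 *: ((h *: e j + x) ord0 i - x ord0 i) = (i == j)%:R.
  by move=> h0; rewrite !mxE/= addrK [_ *: _]mulrA mulVf// mul1r.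
have C : (fun h : R => h^-1 *: (((fun y : 'rV[R]_n => y ord0 i) \o shift x)
    (h *: e j) - x ord0 i)) @ 0^' --> ((i == j)%:R : R).
  apply: cvg_near_cst; near=> t; apply: H.
  by near: t; exact: nbhs_dnbhs_neq.
by apply: DeriveDef; [apply/cvg_ex; eexists; exact: C|exact: cvg_lim C].
Unshelve. all: by end_near. Qed.

Lemma partialE j f x d : is_derive x (e j) f d -> partial j f x = d.
Proof. by case. Qed.

End directional.

Section smooth_calculus.
Context {R : realType} {n : nat}.
Implicit Types (f g : 'rV[R]_n -> R) (A : set 'rV[R]_n) (x : 'rV[R]_n).

Local Notation e j := (delta_mx ord0 j : 'rV[R]_n).

Definition smooth_at0 f x : Prop :=
  {for x, continuous f} /\ forall j, derivable f x (e j).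

Lemma eq_smooth_at0 f g x : (\near x, f x = g x) ->
  smooth_at0 f x -> smooth_at0 g x.
Proof.
move=> fg [c d]; split; last by move=> j; apply: near_eq_derivable (d j).
rewrite /prop_for /continuous_at -(nbhs_singleton fg).
exact: cvg_trans (near_eq_cvg fg) c.
Qed.

Lemma smooth_at0D f g x : smooth_at0 f x -> smooth_at0 g x ->
  smooth_at0 (fun x => f x + g x) x.
Proof.
by move=> [c d] [c' d']; split; [exact: continuousD|move=> j; exact: derivableD].
Qed.

Lemma smooth_at0M f g x : smooth_at0 f x -> smooth_at0 g x ->
  smooth_at0 (fun x => f x * g x) x.
Proof.
by move=> [c d] [c' d']; split; [exact: continuousM|move=> j; exact: derivableM].
Qed.

Lemma smooth_at0_comp f (g : R -> R) (d : R) x : smooth_at0 f x ->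
  is_derive (f x) 1 g d -> smooth_at0 (g \o f) x.
Proof.
move=> [c df] dg; split.
  by apply: continuous_comp => //; exact: is_derive_continuous dg.
by move=> j; have [] := is_derive_comp1 (derivableP (df j)) dg.
Qed.

(** The recursion is on the derivative taken first, which is the last entry of the list in
    [iter_partial]. In this form the product and chain rules go through by induction on the
    order. *)
Fixpoint smooth_upto m A f : Prop :=
  (forall x, A x -> smooth_at0 f x) /\
  if m is m'.+1 then forall j, smooth_upto m' A (partial j f) else True.

Lemma smooth_onP A f : smooth_on A f <-> forall m, smooth_upto m A f.
Proof.
have ipE s j (g : 'rV[R]_n -> R) :
    iter_partial s (partial j g) = iter_partial (rcons s j) g.
  by rewrite /iter_partial foldr_rcons.
split=> [sf m|sf s].
  elim: m f sf => [|m IH] f sf; split=> //; try by move=> x; exact: (sf [::]).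
  by move=> j; apply: IH => s x Ax; rewrite ipE; exact: sf.
suff H : forall m g, (forall m, smooth_upto m A g) -> forall s, size s = m ->
    forall x, A x -> smooth_at0 (iter_partial s g) x.
  by move=> x Ax; exact: (H _ f sf s erefl x Ax).
elim=> [|m IH] g sg {}s; first by move=> /size0nil -> x Ax; exact: (sg 0%N).1.
elim/last_ind: s => // s j _; rewrite size_rcons => -[sm] x Ax.
rewrite -ipE; apply: IH => // k; exact: (sg k.+1).2.
Qed.

Lemma eq_smooth_upto m A f g : open A -> (forall x, A x -> f x = g x) ->
  smooth_upto m A f -> smooth_upto m A g.
Proof.
move=> oA; elim: m f g => [|m IH] f g fg [cf df].
all: have near_fg x : A x -> \near x, f x = g x
  by move=> Ax; near=> y; apply: fg; near: y; exact: open_nbhs_nbhs.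
all: split; first by move=> x Ax; apply: eq_smooth_at0 (near_fg _ Ax) (cf _ Ax).
  by [].
move=> j; apply: IH (df j) => x Ax; rewrite /partial.
by apply: near_eq_derive; exact: near_fg.
Unshelve. all: by end_near. Qed.

Lemma smooth_upto_cst m A (k : R) : open A -> smooth_upto m A (fun=> k).
Proof.
move=> oA; elim: m k => [|m IH] k; split=> //.
1,2: by move=> x _; split; [exact: cst_continuous|move=> j; exact: derivable_cst].
move=> j; apply: (@eq_smooth_upto _ _ (fun=> 0)) => // x _.
by rewrite /partial derive_cst.
Qed.

Lemma smooth_uptoW m A f : smooth_upto m.+1 A f -> smooth_upto m A f.
Proof.
by elim: m f => [|m IH] f [cf df]; split=> // j; apply: IH; exact: df.
Qed.

Lemma smooth_uptoD m A f g : open A ->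
  smooth_upto m A f -> smooth_upto m A g ->
  smooth_upto m A (fun x => f x + g x).
Proof.
move=> oA; elim: m f g => [|m IH] f g [cf df] [cg dg].
all: split; first by move=> x Ax; exact: smooth_at0D (cf _ Ax) (cg _ Ax).
  by [].
move: df dg; rewrite -/smooth_upto => df dg.
move=> j; apply: (@eq_smooth_upto _ _ (fun x => partial j f x + partial j g x)) => //.
  move=> x Ax; rewrite /partial deriveD//; [exact: (cf _ Ax).2|exact: (cg _ Ax).2].
exact: IH.
Qed.

Lemma smooth_uptoM m A f g : open A ->
  smooth_upto m A f -> smooth_upto m A g ->
  smooth_upto m A (fun x => f x * g x).
Proof.
move=> oA; elim: m f g => [|m IH] f g sf sg; have [cf df] := sf; have [cg dg] := sg.
all: split; first by move=> x Ax; exact: smooth_at0M (cf _ Ax) (cg _ Ax).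
  by [].
move: df dg; rewrite -/smooth_upto => df dg.
move=> j; apply: (@eq_smooth_upto _ _
    (fun x => f x * partial j g x + g x * partial j f x)) => //.
  move=> x Ax; rewrite /partial deriveM//; [exact: (cf _ Ax).2|exact: (cg _ Ax).2].
apply: (smooth_uptoD oA).
  exact: (IH _ _ (smooth_uptoW sf) (dg j)).
exact: (IH _ _ (smooth_uptoW sg) (df j)).
Qed.

(** The whole sequence of derivatives is the witness, so that explicit families such as
    [flat_derivn] can be supplied and the chain rule can shift the sequence by one. *)
Definition smooth1 (O : set R) (g : R -> R) : Prop :=
  exists G : nat -> R -> R, G 0%N = g /\
    forall k t, O t -> is_derive t 1 (G k) (G k.+1 t).

Lemma smooth_upto_comp m A O (g : R -> R) f : open A ->
  smooth1 O g -> (forall x, A x -> O (f x)) ->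
  smooth_upto m A f -> smooth_upto m A (g \o f).
Proof.
(* The derivative of [G k \o f] involves [G k.+1 \o f], so the induction on the order runs for all
   [k] at once. *)
move=> oA [G [<- dG]] AO; suff: forall k, smooth_upto m A f -> smooth_upto m A (G k \o f) by exact.
move=> k; elim: m k f AO => [|m IH] k f AO sf; have [cf df] := sf.
all: split; first by move=> x Ax; exact: smooth_at0_comp (cf _ Ax) (dG k _ (AO _ Ax)).
  by [].
move=> j; apply: (@eq_smooth_upto _ _
    (fun x => (G k.+1 \o f) x * partial j f x)) => //.
  move=> x Ax; have dGk := dG k _ (AO _ Ax).
  by rewrite [RHS](partialE (is_derive_comp1 (derivableP ((cf _ Ax).2 j)) dGk)).
apply: (@smooth_uptoM m A (G k.+1 \o f) (partial j f) oA _ (df j)).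
exact: (IH k.+1 f AO (smooth_uptoW sf)).
Qed.

Lemma smooth_onS A B f : A `<=` B -> smooth_on B f -> smooth_on A f.
Proof. by move=> AB sB s x /AB; exact: sB. Qed.

(** Derivatives are those of functions on the whole space, so smoothness is a condition at each
    point and [B] need not be open. *)
Lemma smooth_on_local A f :
  (forall x, A x -> exists B, B x /\ smooth_on B f) -> smooth_on A f.
Proof. by move=> H s x /H[B [Bx sf]]; exact: sf. Qed.

Lemma smooth_on_is_derive A f x j : smooth_on A f -> A x ->
  is_derive x (e j) f (partial j f x).
Proof. by move=> sf Ax; apply: derivableP; exact: (sf [::] x Ax).2. Qed.

Lemma smooth_on_continuous A f x : smooth_on A f -> A x -> {for x, continuous f}.
Proof. by move=> sf Ax; exact: (sf [::] x Ax).1. Qed.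

Opaque smooth_on.

Lemma eq_smooth_on A f g : open A -> (forall x, A x -> f x = g x) ->
  smooth_on A f -> smooth_on A g.
Proof.
move=> oA fg /smooth_onP sf; apply/smooth_onP => m.
exact: eq_smooth_upto (sf m).
Qed.

Lemma smooth_on_cst A (k : R) : open A -> smooth_on A (fun=> k).
Proof. by move=> oA; apply/smooth_onP => m; exact: smooth_upto_cst. Qed.

Lemma smooth_onD A f g : open A -> smooth_on A f -> smooth_on A g ->
  smooth_on A (fun x => f x + g x).
Proof.
move=> oA /smooth_onP sf /smooth_onP sg; apply/smooth_onP => m.
exact: smooth_uptoD.
Qed.

Lemma smooth_onM A f g : open A -> smooth_on A f -> smooth_on A g ->
  smooth_on A (fun x => f x * g x).
Proof.
move=> oA /smooth_onP sf /smooth_onP sg; apply/smooth_onP => m.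
exact: smooth_uptoM.
Qed.

Lemma smooth_onB A f g : open A -> smooth_on A f -> smooth_on A g ->
  smooth_on A (fun x => f x - g x).
Proof.
move=> oA sf sg.
have sh := smooth_onD oA sf (smooth_onM oA (smooth_on_cst (-1) oA) sg).
by apply: (eq_smooth_on oA _ sh) => x _; rewrite mulN1r.
Qed.

Lemma smooth_on_comp A O (g : R -> R) f : open A ->
  smooth1 O g -> (forall x, A x -> O (f x)) ->
  smooth_on A f -> smooth_on A (fun x => g (f x)).
Proof.
move=> oA sg AO /smooth_onP sf; apply/smooth_onP => m.
exact: smooth_upto_comp sg _ _.
Qed.

Lemma smooth_on_coord A (i : 'I_n) : open A ->
  smooth_on A (fun x => x ord0 i).
Proof.
move=> oA; apply/smooth_onP => m.
have H : forall x, A x -> smooth_at0 (fun x : 'rV[R]_n => x ord0 i) x.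
  move=> x _; split; first exact: coord_continuous.
  by move=> j; have [] := is_derive_coord x j i.
case: m => [|m]; split=> // j.
apply: (@eq_smooth_upto _ _ (fun=> (i == j)%:R)) => //; last exact: smooth_upto_cst.
by move=> x _; rewrite (partialE (is_derive_coord x j i)).
Qed.

Lemma smooth_onX A f k : open A -> smooth_on A f ->
  smooth_on A (fun x => f x ^+ k).
Proof.
move=> oA sf; elim: k => [|k IH].
  exact: (eq_smooth_on oA _ (smooth_on_cst 1 oA)).
by apply: (eq_smooth_on oA _ (smooth_onM oA sf IH)) => x _; rewrite exprS.
Qed.

Lemma smooth_on_sum A (I : Type) (r : seq I) (F : I -> 'rV[R]_n -> R) :
  open A -> (forall i, smooth_on A (F i)) ->
  smooth_on A (fun x => \sum_(i <- r) F i x).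
Proof.
move=> oA sF; elim: r => [|i r IH].
  by apply: (eq_smooth_on oA _ (smooth_on_cst 0 oA)) => x _; rewrite big_nil.
by apply: (eq_smooth_on oA _ (smooth_onD oA (sF i) IH)) => x _; rewrite big_cons.
Qed.

Lemma smooth_on_partial A f j : smooth_on A f -> smooth_on A (partial j f).
Proof.
by move=> /smooth_onP sf; apply/smooth_onP => m; have [_] := sf m.+1; exact.
Qed.

End smooth_calculus.

(** * Flat functions of one variable *)

Section flat.
Context {R : realType}.
Implicit Types (t y : R) (p : {poly R}).

(** Difference quotients are bounded by C |h|. Used at the junction point of [flat] and at the
    origin of R^n, where no formula for the derivative is at hand. *)
Lemma is_derive_quad (V : normedModType R) (f : V -> R) (a v : V) (C r : R) :
  0 < r -> (forall h : R, `|h| < r -> `|f (h *: v + a) - f a| <= C * h ^+ 2) ->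
  is_derive a v f 0.
Proof.
move=> r0 fC.
have cv : (fun h : R => h^-1 *: ((f \o shift a) (h *: v) - f a)) @ 0^' --> (0 : R).
  apply/cvgr0Pnorm_le => eps eps0; near=> h.
  have h0 : h != 0 by near: h; exact: nbhs_dnbhs_neq.
  have hr : `|h| < r by near: h; exact: dnbhs0_lt.
  have hC : `|h| < eps / (`|C| + 1) by near: h; apply: dnbhs0_lt; rewrite divr_gt0.
  rewrite [_ *: _]/(_ * _) normrM normfV ler_pdivrMl ?normr_gt0//.
  apply: le_trans (fC _ hr) _; rewrite -real_normK ?num_real// expr2 mulrCA.
  apply: ler_wpM2l => //; rewrite mulrC.
  move: hC; rewrite ltr_pdivlMr ?ltr_wpDl// => /ltW; apply: le_trans.
  rewrite [leRHS]mulrC mulrC; apply: ler_wpM2r => //.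
  by rewrite (le_trans (ler_norm C))// lerDl.
by apply: DeriveDef; [apply/cvg_ex; eexists; exact: cv|exact: cvg_lim cv].
Unshelve. all: by end_near. Qed.

Lemma expRN_le (m : nat) y : 0 <= y -> y ^+ m * expR (- y) <= m`!%:R.
Proof.
move=> y0; rewrite expRN ler_pdivrMr ?expR_gt0//.
case: m => [|m]; first by rewrite expr0 fact0 mul1r -expR0 ler_expR.
have := expR_ge1Dxn m y0; rewrite -ler_pdivrMl ?ltr0n ?fact_gt0//.
by rewrite mulrC; apply: le_trans; rewrite lerDr.
Qed.

(** In the variable s = 1 / t the operator d/dt is - s ^ 2 d/ds; the recursion is the effect of this
    operator on P(s) exp(- s). *)
Fixpoint flat_poly (k : nat) : {poly R} :=
  if k is k'.+1 then 'X^2 * (flat_poly k' - (flat_poly k')^`()) else 1.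

Lemma horner_flat_polyS k y :
  (flat_poly k.+1).[y] = y ^+ 2 * ((flat_poly k).[y] - (flat_poly k)^`().[y]).
Proof. by rewrite -[flat_poly _.+1]/(_ * _) hornerM hornerXn hornerD hornerN. Qed.

Definition flat_derivn (k : nat) t : R :=
  if 0 < t then (flat_poly k).[t^-1] * expR (- t^-1) else 0.

Definition flat t : R := if 0 < t then expR (- t^-1) else 0.

Definition dflat t : R := if 0 < t then t^-1 ^+ 2 * expR (- t^-1) else 0.

Lemma poly_le_monomial p : exists C : R, forall y, 1 <= y ->
  `|p.[y]| <= C * y ^+ size p.
Proof.
exists (\sum_(i < size p) `|p`_i|) => y y1.
rewrite horner_coef (le_trans (ler_norm_sum _ _ _))// mulr_suml.
apply: ler_sum => i _; rewrite normrM ler_wpM2l// normrX ger0_norm ?(le_trans _ y1)//.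
by apply: ler_weXn2l => //; exact: ltnW.
Qed.

Lemma is_derive_flat_derivn k t :
  is_derive t 1 (flat_derivn k) (flat_derivn k.+1 t).
Proof.
have [t0|t0|t0] := ltrgt0P t; last rewrite {}t0.
- have tn0 : t != 0 by rewrite gt_eqF.
  suff : is_derive t 1 (fun s : R => (flat_poly k).[s^-1] * expR (- s^-1))
      (flat_derivn k.+1 t).
    apply: near_eq_is_derive; near=> s; rewrite /flat_derivn ifT//.
    by near: s; exact: lt_nbhsr.
  have dV : is_derive t 1 (fun s : R => s^-1) (- t ^- 2).
    apply: DeriveDef; first exact: derivableV.
    by rewrite (@deriveV _ _ id)// derive_id [_ *: _]mulr1.
  have dP : is_derive t 1 (fun s : R => (flat_poly k).[s^-1])
      ((flat_poly k)^`().[t^-1] * - t ^- 2).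
    exact: (@is_derive1_comp _ (horner (flat_poly k)) (fun s : R => s^-1)).
  have dE : is_derive t 1 (fun s : R => expR (- s^-1)) (expR (- t^-1) * t ^- 2).
    have dN : is_derive t 1 (fun s : R => - s^-1) (t ^- 2).
      by rewrite -[X in is_derive _ _ _ X]opprK; exact: is_deriveN.
    exact: (@is_derive1_comp _ expR (fun s : R => - s^-1)).
  apply: is_derive_eq (is_deriveM dP dE) _.
  rewrite /flat_derivn t0 horner_flat_polyS; set e := expR _.
  set a := (flat_poly k).[_]; set b := (_^`()).[_].
  by rewrite /GRing.scale/=; field.
- rewrite [X in is_derive _ _ _ X]/flat_derivn ltNge (ltW t0)/=.
  apply: near_eq_is_derive (is_derive_cst (0 : R) t 1).
  near=> s; rewrite /flat_derivn/= ifF//; apply/negbTE; rewrite -leNgt.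
  by apply: ltW; near: s; exact: lt_nbhsl.
- have [C hC] := poly_le_monomial (flat_poly k).
  (* Two powers of [h^-1] beyond the size of the polynomial: by [expRN_le] the exponential beats
     them, which leaves the factor [h ^+ 2] that [is_derive_quad] asks for. *)
  pose m := (size (flat_poly k)).+2.
  have C0 : 0 <= C.
    by have := hC 1 (lexx _); rewrite expr1n mulr1; apply: le_trans.
  rewrite [X in is_derive _ _ _ X]/flat_derivn ltxx.
  apply: (@is_derive_quad R _ _ _ (C * m`!%:R) 1) => // h h1.
  rewrite {2}/flat_derivn ltxx subr0 [_ *: _]mulr1 addr0 /flat_derivn.
  case: ifPn => [h0|_]; last by rewrite normr0 mulr_ge0 ?sqr_ge0// mulr_ge0.
  have i1 : 1 <= h^-1.
    by rewrite -invr1 lef_pV2 ?posrE// (le_trans (ler_norm _))// ltW.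
  have i0 : 0 <= h^-1 by rewrite (le_trans _ i1).
  rewrite normrM (ger0_norm (expR_ge0 _)).
  apply: (@le_trans _ _ (C * h^-1 ^+ size (flat_poly k) * expR (- h^-1))).
    by rewrite ler_wpM2r ?expR_ge0 ?hC.
  have H := ler_wpM2r (sqr_ge0 h) (ler_wpM2l C0 (expRN_le m i0)).
  apply: le_trans H; rewrite le_eqVlt; apply/orP; left; apply/eqP.
  have hn : h != 0 by rewrite gt_eqF.
  rewrite /m 2!exprS; set u := h^-1 ^+ _; set v := expR _.
  by field.
Unshelve. all: by end_near. Qed.

Lemma flatE : flat = flat_derivn 0.
Proof. by apply/funext => t; rewrite /flat /flat_derivn hornerC mul1r. Qed.

Lemma dflatE : dflat = flat_derivn 1.
Proof.
by apply/funext => t; rewrite /dflat /flat_derivn/= derivC subr0 mulr1 hornerXn.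
Qed.

Lemma is_derive_flat t : is_derive t 1 flat (dflat t).
Proof. by rewrite flatE dflatE; exact: is_derive_flat_derivn. Qed.

Lemma smooth1_flat : smooth1 setT flat.
Proof.
exists flat_derivn; split; first by rewrite flatE.
by move=> k t _; exact: is_derive_flat_derivn.
Qed.

Lemma flat_ge0 t : 0 <= flat t.
Proof. by rewrite /flat; case: ifP => // _; exact: expR_ge0. Qed.

Lemma flat_le1 t : flat t <= 1.
Proof.
by rewrite /flat; case: ifP => // t0; rewrite expR_le1 oppr_le0 invr_ge0 ltW.
Qed.

Lemma flat_gt0 t : 0 < t -> 0 < flat t.
Proof. by move=> t0; rewrite /flat t0 expR_gt0. Qed.

Lemma flat0 t : t <= 0 -> flat t = 0.
Proof. by rewrite /flat leNgt => /negbTE ->. Qed.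

Lemma dflat0 t : t <= 0 -> dflat t = 0.
Proof. by rewrite /dflat leNgt => /negbTE ->. Qed.

Lemma le_flat : {homo flat : s t / s <= t}.
Proof.
move=> s t st; rewrite /flat; case: ifP => s0; last by rewrite -/(flat t) flat_ge0.
by rewrite (lt_le_trans s0 st) ler_expR lerN2 lef_pV2 ?posrE// (lt_le_trans s0).
Qed.

Lemma norm_dflat t : `|dflat t| <= 2.
Proof.
rewrite /dflat; case: ifP => [t0|_]; last by rewrite normr0.
have i0 : 0 <= t^-1 by rewrite invr_ge0 ltW.
rewrite ger0_norm; first by have := expRN_le 2 i0.
by apply: mulr_ge0; [exact: sqr_ge0|exact: expR_ge0].
Qed.

Lemma smooth1_powR (p : R) : smooth1 [set t | 0 < t] (@powR R ^~ p).
Proof.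
exists (fun k t => (\prod_(i < k) (p - i%:R)) * t `^ (p - k%:R)); split.
  by apply/funext => t; rewrite big_ord0 mul1r subr0.
move=> k t /= t0; set c := \prod_(i < k) _.
have dp : is_derive t 1 (fun s : R => s `^ (p - k%:R))
    ((p - k%:R) * t `^ (p - k%:R - 1)) := is_derive1_powR (p - k%:R) t0.
apply: is_derive_eq (is_deriveZ c dp) _.
by rewrite big_ord_recr/= -/c [_ *: _]mulrA -addrA -opprD -natr1.
Qed.

(** A smooth cutoff made from [flat] alone, without division: constant for t <= 0, zero for t >= 1.
    The plateau stays at the value [step0] instead of being normalised to 1. *)
Definition step t : R := flat (flat 1 - flat t).

Definition step0 : R := flat (flat 1).

Lemma step0_gt0 : 0 < step0.
Proof. by apply: flat_gt0; exact: flat_gt0. Qed.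

Lemma step_le0 t : t <= 0 -> step t = step0.
Proof. by move=> t0; rewrite /step (flat0 t0) subr0. Qed.

Lemma step_ge1 t : 1 <= t -> step t = 0.
Proof. by move=> t1; rewrite /step flat0// subr_le0 le_flat. Qed.

Lemma step_ge0 t : 0 <= step t. Proof. exact: flat_ge0. Qed.
Lemma step_le1 t : step t <= 1. Proof. exact: flat_le1. Qed.

Definition dstep t : R := - (dflat (flat 1 - flat t) * dflat t).

Lemma is_derive_step t : is_derive t 1 step (dstep t).
Proof.
have d1 : is_derive t 1 (fun s : R => flat 1 - flat s) (- dflat t).
  have df := is_derive_flat t.
  by apply: is_derive_eq (is_deriveB (is_derive_cst (flat 1) t 1) df) _; rewrite sub0r.
have d2 := is_derive_flat (flat 1 - flat t).
apply: is_derive_eq (@is_derive1_comp _ flat (fun s : R => flat 1 - flat s) _ _ _ d2 d1) _.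
by rewrite /dstep mulrN.
Qed.

Lemma dstep_le0 t : t <= 0 -> dstep t = 0.
Proof. by move=> t0; rewrite /dstep (dflat0 t0) mulr0 oppr0. Qed.

Lemma dstep_ge1 t : 1 <= t -> dstep t = 0.
Proof.
by move=> t1; rewrite /dstep dflat0 ?mul0r ?oppr0// subr_le0 le_flat.
Qed.

Lemma norm_dstep t : `|dstep t| <= 4.
Proof.
rewrite normrN normrM (_ : 4 = 2 * 2); last by ring.
by apply: ler_pM; rewrite ?norm_dflat.
Qed.

End flat.

(** * Integration on R^n *)

Section borel.
Context {R : realType}.

Local Notation RV n := ('rV[R]_n).
Local Notation mu n := (lebesgue_rv R n).

Definition grid n (m : nat) (x : RV n) : RV n :=
  \row_i ((Num.floor (m.+1%:R * x ord0 i))%:~R / m.+1%:R).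

Lemma grid_cvg n (x : RV n) : (fun m => grid m x) @ \oo --> x.
Proof.
apply/cvgrPdist_le => /= eps eps0.
have invn : (fun m => m.+1%:R^-1 : R) @ \oo --> (0 : R) := @cvg_harmonic R.
have /cvgr0Pnorm_le/(_ _ eps0) invn' := invn.
near=> m; have : `|m.+1%:R^-1 : R| <= eps by near: m.
rewrite ger0_norm// => minv.
rewrite [leLHS]/Num.Def.normr/= mx_normrE.
apply: bigmax_le => [|[i j] _]; first exact: ltW.
rewrite ord1 !mxE/=; set t := x _ _.
have m0 : (0 : R) < m.+1%:R by [].
have /andP[fl1 fl2] := floor_itv (m.+1%:R * t).
have -> : t - (Num.floor (m.+1%:R * t))%:~R / m.+1%:R =
    (m.+1%:R * t - (Num.floor (m.+1%:R * t))%:~R) / m.+1%:R.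
  by rewrite mulrBl mulrAC mulfV ?mul1r ?gt_eqF.
apply: le_trans minv.
rewrite ger0_norm; last by rewrite mulr_ge0 ?subr_ge0// invr_ge0.
rewrite -[leRHS]mul1r ler_wpM2r ?invr_ge0//.
by move: fl2; rewrite intrD; lra.
Unshelve. all: by end_near. Qed.

Lemma measurable_rv_floor n m (z : {ffun 'I_n -> int}) :
  measurable [set x : RV n | forall i, Num.floor (m.+1%:R * x ord0 i) = z i].
Proof.
rewrite (_ : [set _ | _] =
    \big[setI/setT]_(i < n) [set x : RV n | Num.floor (m.+1%:R * x ord0 i) = z i]).
  apply: bigsetI_measurable => i _.
  rewrite (_ : [set _ | _] = [set: RV n] `&` (fun x : RV n => x ord0 i) @^-1`
     `[(z i)%:~R / m.+1%:R, (z i + 1)%:~R / m.+1%:R[).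
    by apply: measurable_rv_coord => //; exact: measurable_itv.
  apply/seteqP; split=> x /=; rewrite in_itv/=.
    move=> <-; split=> //; have := floor_itv (m.+1%:R * x ord0 i).
    by rewrite ler_pdivrMr// ltr_pdivlMr// ![_ * m.+1%:R]mulrC.
  move=> [_]; rewrite ler_pdivrMr// ltr_pdivlMr// ![_ * m.+1%:R]mulrC => h.
  exact: floor_def.
rewrite -bigcap_seq; apply/seteqP; split=> x /= xA i.
  by move=> _; exact: xA.
by apply: (xA i); rewrite /= mem_index_enum.
Qed.

(** The sigma-algebra is generated by the coordinates, not by the open sets. A continuous function
    is the pointwise limit of its composites with [grid m], and these take countably many values,
    each on a measurable union of cells. *)
Lemma continuous_rv_measurable n (f : RV n -> R) :
  continuous f -> measurable_fun setT (f : RV n -> measurableTypeR R).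
Proof.
move=> cf.
apply: (@measurable_fun_cvg _ _ _ setT (fun m x => f (grid m x))); last first.
  move=> x _; apply: continuous_cvg; first exact: cf.
  exact: grid_cvg.
move=> m _ Y mY; rewrite setTI.
pose P (z : {ffun 'I_n -> int}) : RV n := \row_i ((z i)%:~R / m.+1%:R).
rewrite (_ : _ @^-1` _ = \bigcup_(z : {ffun 'I_n -> int})
  (if `[< Y (f (P z)) >] then
   [set x : RV n | forall i, Num.floor (m.+1%:R * x ord0 i) = z i] else set0)).
  apply: countable_bigcupT_measurable => [|z]; first exact: countableP.
  by case: ifP => _ //; exact: measurable_rv_floor.
apply/seteqP; split=> x /=.
  move=> Yx; exists [ffun i => Num.floor (m.+1%:R * x ord0 i)] => //.
  have E : P [ffun i => Num.floor (m.+1%:R * x ord0 i)] = grid m x.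
    by apply/rowP => i; rewrite !mxE ffunE.
  by rewrite E; case: asboolP => // _ i; rewrite ffunE.
move=> [z _]; case: asboolP => // Yz /= xz.
rewrite (_ : grid m x = P z)//.
by apply/rowP => i; rewrite !mxE xz.
Qed.

Lemma integral_rvS_ge0 n (f : RV n.+1 -> \bar R) : measurable_fun setT f ->
  (forall x, 0 <= f x)%E ->
  (\int[mu n.+1]_x f x =
   \int[@lebesgue_measure R]_a \int[mu n]_v f (rv_cons (a, v)))%E.
Proof.
move=> mf f0.
rewrite [LHS](_ : _ = \int[pushforward
  (@lebesgue_measure R \x mu n)%E (@rv_cons R n)]_x f x)%E//.
rewrite ge0_integral_pushforward//; last exact: measurable_rv_cons.
rewrite preimage_setT fubini_tonelli1//=.
by apply: measurableT_comp => //; exact: measurable_rv_cons.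
Qed.

Lemma integrable_rvS n (f : RV n.+1 -> \bar R) :
  (mu n.+1).-integrable setT f ->
  (@lebesgue_measure R \x mu n)%E.-integrable setT (f \o @rv_cons R n).
Proof.
move=> /integrableP[mf foo]; apply/integrableP; split.
  by apply: measurableT_comp => //; exact: measurable_rv_cons.
apply: le_lt_trans foo; rewrite -[X in (X <= _)%E]/(
  \int[(@lebesgue_measure R \x mu n)]_x ((abse \o f) \o @rv_cons R n) x)%E.
rewrite -[in leLHS](preimage_setT (@rv_cons R n)) -ge0_integral_pushforward//.
- exact: measurable_rv_cons.
- exact: measurableT_comp.
- by move=> x _; exact: abse_ge0.
Qed.

Lemma integral_rvS n (f : RV n.+1 -> \bar R) :
  (mu n.+1).-integrable setT f ->
  (\int[mu n.+1]_x f x =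
   \int[(@lebesgue_measure R \x mu n)]_z f (rv_cons z))%E.
Proof.
move=> intf; have [mf _] := integrableP _ _ _ intf.
rewrite [LHS](_ : _ = \int[pushforward
  (@lebesgue_measure R \x mu n)%E (@rv_cons R n)]_x f x)%E//.
rewrite integral_pushforward//; first exact: measurable_rv_cons.
by rewrite preimage_setT; exact: integrable_rvS.
Qed.

End borel.

(** * An integrable product weight on R^n *)

Section weight.
Context {R : realType}.

(** The exponent 4 / 3 exceeds 1, so the weight is integrable on the line, and three factors
    multiply up to the power 4, the decay rate of the square of a function bounded by (1 + |x|) ^
    -2. *)
Definition weight1 (t : R) : R := (1 + `|t|) `^ (- (4 / 3)).

Lemma weight1_ge0 t : 0 <= weight1 t. Proof. exact: powR_ge0. Qed.

Lemma continuous_powR (p t : R) : 0 < t -> {for t, continuous (@powR R ^~ p)}.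
Proof. by move=> t0; apply: is_derive_continuous (is_derive1_powR p t0). Qed.

Lemma continuous_weight1 : continuous weight1.
Proof.
move=> t; have c1 : {for t, continuous (fun t : R => 1 + `|t|)}.
  by apply: continuousD; [exact: cst_continuous|exact: norm_continuous].
have c2 : {for 1 + `|t|, continuous (@powR R ^~ (- (4 / 3)))}.
  by apply: continuous_powR; rewrite ltr_pwDl.
exact: continuous_comp c1 c2.
Qed.

Lemma weight1_integral_lty :
  (\int[@lebesgue_measure R]_t (weight1 t)%:E < +oo)%E.
Proof.
rewrite ge0_symfun_integralT; last 3 first.
- exact: weight1_ge0.
- exact: continuous_weight1.
- by move=> t; rewrite /weight1 /= normrN.
pose F (t : R) := - 3 * (1 + t) `^ (- (1 / 3)).
have F1 (t : R) : 0 <= t -> is_derive t 1 F (weight1 t).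
  move=> t0; have t1 : 0 < 1 + t by rewrite ltr_pwDl.
  have d1 : is_derive t 1 (fun s : R => 1 + s) 1.
    by apply: is_derive_eq (is_deriveD (is_derive_cst (1 : R) t 1)
      (is_derive_id t (1 : R))) _; rewrite add0r.
  have d2 := @is_derive1_comp _ (@powR R ^~ (- (1 / 3))) (fun s : R => 1 + s) _ _ _
    (is_derive1_powR _ t1) d1.
  apply: is_derive_eq (is_deriveZ (- 3) d2) _.
  rewrite /weight1 (ger0_norm t0) [_ *: _]mulrA mulr1 mulrA.
  have -> : - 3 * - (1 / 3) = 1 :> R by field.
  have -> : - (1 / 3) - 1 = - (4 / 3) :> R by field.
  by rewrite mul1r.
rewrite -set_itvcy (@ge0_continuous_FTC2y R weight1 F 0 0).
- by rewrite -EFinB -EFinM ltry.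
- by move=> t _; exact: weight1_ge0.
- by apply: continuous_subspaceT; exact: continuous_weight1.
- apply/cvgr0Pnorm_le => eps eps0; near=> t.
  have t0 : 0 <= t by near: t; exact: nbhs_pinfty_ge.
  have t1 : 0 < 1 + t by rewrite ltr_pwDl.
  rewrite /F mulNr normrN ger0_norm; last by rewrite mulr_ge0 ?powR_ge0.
  have e3 : 0 < eps / 3 by rewrite divr_gt0.
  suff : (1 + t) `^ (- (1 / 3)) <= eps / 3 by rewrite ler_pdivlMr// mulrC.
  have : (eps / 3)^-1 ^+ 3 <= t.
    by near: t; apply: nbhs_pinfty_ge; exact: num_real.
  move=> et; rewrite powRN -[leRHS]invrK lef_pV2 ?posrE ?invr_gt0 ?powR_gt0//.
  have i0 : 0 <= (eps / 3)^-1 by rewrite invr_ge0 ltW.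
  have -> : (eps / 3)^-1 = ((eps / 3)^-1 ^+ 3) `^ (1 / 3).
    rewrite -powR_mulrn// -powRrM (_ : 3%:R * (1 / 3) = 1) ?powRr1//; by field.
  apply: ge0_ler_powR; rewrite ?nnegrE ?exprn_ge0//; first exact: ltW.
  by apply: le_trans et _; lra.
- by move=> t t0; have [] := F1 _ (ltW t0).
- apply: cvg_at_right_filter; apply: is_derive_continuous.
  exact: (F1 0 (lexx _)).
- move=> t; rewrite in_itv/= andbT => t0.
  by rewrite derive1E; have [_ ->] := F1 _ (ltW t0).
Unshelve. all: by end_near. Qed.

Definition weight n (x : 'rV[R]_n) : R := \prod_(i < n) weight1 (x ord0 i).

Lemma weight_ge0 n (x : 'rV[R]_n) : 0 <= weight x.
Proof. by apply: prodr_ge0 => i _; exact: weight1_ge0. Qed.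

Lemma weight_cons n (a : R) (v : 'rV[R]_n) :
  weight (rv_cons (a, v)) = weight1 a * weight v.
Proof.
rewrite /weight big_ord_recl mxE unlift_none/=; congr (_ * _).
by apply: eq_bigr => i _; rewrite mxE liftK.
Qed.

Lemma measurable_weight n :
  measurable_fun setT (@weight n : 'rV[R]_n -> measurableTypeR R).
Proof.
apply: measurable_prod => i _.
have := continuous_measurable_fun continuous_weight1.
move=> /measurableT_comp; apply; exact: measurable_rv_coord.
Qed.

Lemma integrable_weight n :
  (lebesgue_rv R n).-integrable setT (EFin \o @weight n).
Proof.
have mw k : measurable_fun setT (EFin \o @weight k).
  by apply/measurable_EFinP; exact: measurable_weight.
apply/integrableP; split; first exact: mw.
under eq_integral => x _ do rewrite gee0_abs ?lee_fin ?weight_ge0//.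
elim: n => [|n IH].
  rewrite [X in (X < _)%E](_ : _ = (\int[\d_(0%R : 'rV[R]_0)]_x (weight x)%:E)%E)//.
  rewrite integral_dirac//; last exact: mw.
  by rewrite diracE mem_set// mul1e ltry.
rewrite integral_rvS_ge0//; last by move=> x; rewrite lee_fin weight_ge0.
have mw0 := mw n.
under eq_integral => a _.
  under eq_integral => v _ do rewrite /= weight_cons EFinM.
  rewrite ge0_integralZl//; last 2 first.
  - by move=> v _; rewrite lee_fin weight_ge0.
  - by rewrite lee_fin weight1_ge0.
  over.
rewrite ge0_integralZr//; last 3 first.
- by apply/measurable_EFinP; exact: (continuous_measurable_fun continuous_weight1).
- by move=> a _; rewrite lee_fin weight1_ge0.
- by apply: integral_ge0 => v _; rewrite lee_fin weight_ge0.
rewrite lte_mul_pinfty//.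
- by apply: integral_ge0 => a _; rewrite lee_fin weight1_ge0.
- rewrite ge0_fin_numE ?weight1_integral_lty//.
  by apply: integral_ge0 => a _; rewrite lee_fin weight1_ge0.
Qed.

Lemma weight_ge n (x : 'rV[R]_n) : (n <= 3)%N -> (1 + `|x|) ^- 4 <= weight x.
Proof.
move=> n3; have x1 : 1 <= 1 + `|x| by rewrite lerDl.
have x0 : 0 < 1 + `|x| by exact: lt_le_trans x1.
apply: (@le_trans _ _ (\prod_(i < n) (1 + `|x|) `^ (- (4 / 3)))); last first.
  apply: ler_prod => i _; rewrite powR_ge0/= /weight1 !powRN lef_pV2 ?posrE ?powR_gt0//.
    have h43 : 0 <= 4 / 3 :> R by lra.
    apply: (ge0_ler_powR h43); rewrite ?nnegrE ?addr_ge0//.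
    rewrite lerD2l [leRHS]/Num.Def.normr/= mx_normrE.
    exact: (le_bigmax _ _ (ord0, i)).
rewrite prodr_const card_ord -powR_mulrn ?powR_ge0// -powRrM.
rewrite -powR_invn ?(ltW x0)//; apply: ler_powR => //.
have : (n%:R : R) <= 3 by rewrite (ler_nat _ n 3).
by lra.
Qed.

End weight.

(** * Functions in H^1 *)

Section row_norm.
Context {R : realType}.
Local Notation RV n := ('rV[R]_n).

Lemma rv_norm_le n (x : RV n) (B : R) :
  0 <= B -> (`|x| <= B) <-> (forall i, `|x ord0 i| <= B).
Proof.
move=> B0; split=> [xB i|xB]; rewrite /Num.Def.normr/= mx_normrE in xB *.
  by apply: le_trans xB; exact: (le_bigmax _ _ (ord0, i)).
by apply: bigmax_le => // -[i j] _; rewrite ord1; exact: xB.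
Qed.

Lemma ler_rv_norm n (x : RV n) i : `|x ord0 i| <= `|x|.
Proof. by have [+ _] := rv_norm_le x (normr_ge0 x); apply. Qed.

Lemma norm_delta n (j : 'I_n) (h : R) :
  `|h *: (delta_mx ord0 j : RV n)| <= `|h|.
Proof.
apply/rv_norm_le => // i; rewrite !mxE eqxx/=.
by case: (i == j); rewrite ?mulr1// mulr0 normr0.
Qed.

Lemma norm_rv_cons n (a : R) (v : RV n) : `|v| <= `|rv_cons (a, v)| /\
  `|a| <= `|rv_cons (a, v)|.
Proof.
split.
  apply/rv_norm_le => // i.
  have := ler_rv_norm (rv_cons (a, v)) (lift ord0 i).
  by rewrite mxE liftK.
by have := ler_rv_norm (rv_cons (a, v)) ord0; rewrite mxE unlift_none.
Qed.

Lemma rv_cons_deltaS n (a h : R) (v : RV n) k :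
  rv_cons (a, h *: delta_mx ord0 k + v) =
  h *: delta_mx ord0 (lift ord0 k) + rv_cons (a, v).
Proof.
apply/rowP => i; rewrite !mxE eqxx/=; case: unliftP => [l ->|->].
  by rewrite !mxE eqxx (inj_eq lift_inj).
by rewrite (negbTE (neq_lift _ _)) mulr0 add0r.
Qed.

Lemma rv_cons_delta0 n (a h : R) (v : RV n) :
  rv_cons (h + a, v) = h *: delta_mx ord0 ord0 + rv_cons (a, v).
Proof.
apply/rowP => i; rewrite !mxE eqxx/=; case: unliftP => [l ->|->].
  by rewrite eq_sym (negbTE (neq_lift _ _)) mulr0 add0r.
by rewrite eqxx mulr1.
Qed.

Lemma cvg_rv n (V : normedModType R) (g : RV n -> V) (v : RV n) (l : V) :
  (forall eps, 0 < eps -> exists2 d : R, 0 < d &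
    forall w, `|v - w| < d -> `|l - g w| <= eps) -> g @ v --> l.
Proof.
move=> H; apply: (@cvgrPdist_le _ _ _ (nbhs v) (nbhs_filter v) g l).2.
move=> eps eps0; have [d d0 dH] := H _ eps0.
by apply/nbhs_ballP; exists d => // w; rewrite -ball_normE; exact: dH.
Qed.

Lemma continuous_rv_consr n (a : R) : continuous (fun v : RV n => rv_cons (a, v)).
Proof.
move=> v; apply: cvg_rv => eps eps0; exists eps => // w vw.
apply/rv_norm_le => [|i]; first exact: ltW.
rewrite !mxE; case: unliftP => [k _|_]; last by rewrite subrr normr0 ltW.
by apply: le_trans (ltW vw); have := ler_rv_norm (v - w) k; rewrite !mxE.
Qed.

Lemma continuous_rv_consl n (v : RV n) : continuous (fun a : R => rv_cons (a, v)).
Proof.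
move=> a; apply/cvgrPdist_le => eps eps0; near=> b.
have ab : `|a - b| <= eps by near: b; exact: cvgr_dist_le.
apply/rv_norm_le => [|i]; first exact: ltW.
by rewrite !mxE; case: unliftP => [k _|_] //; rewrite subrr normr0 ltW.
Unshelve. all: by end_near. Qed.

Lemma continuous_bounded n (F : RV n -> R) (M : R) : continuous F ->
  exists2 B, 0 <= B & forall x, `|x| <= M -> `|F x| <= B.
Proof.
move=> cF; have [M0|M0] := ltP M 0.
  by exists 0 => // x /le_lt_trans/(_ M0); rewrite ltNge normr_ge0.
pose A := [set v : RV n | forall i, `[- M, M]%classic (v ord0 i)].
have cA : compact A by apply: (@rV_compact _ _ (fun=> `[-M, M]%classic)) => _; exact: segment_compact.
have A0 : A !=set0.
  by exists 0 => i; rewrite /= mxE in_itv/= M0 oppr_le0 M0.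
have cnF : {within A, continuous (fun x => `|F x|)}.
  apply: continuous_subspaceT => x; apply: continuous_comp (cF x) _.
  exact: norm_continuous.
have [c _ maxc] := EVT_max_rV A0 cA cnF.
exists `|F c| => // x xM; apply: maxc; rewrite inE => i /=.
rewrite in_itv/= -ler_norml.
exact: le_trans (ler_rv_norm x i) xM.
Qed.

End row_norm.

(** * Integrals of derivatives of compactly supported functions *)

Section integration_by_parts.
Context {R : realType}.
Local Notation RV n := ('rV[R]_n).
Local Notation mu n := (lebesgue_rv R n).
Local Notation e j := (delta_mx ord0 j).

Lemma decay_integrable n (F : RV n -> R) (K : R) : (n <= 3)%N -> 0 <= K ->
  continuous F -> (forall x, `|F x| <= K * (1 + `|x|) ^- 4) ->
  (mu n).-integrable setT (EFin \o F).
Proof.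
move=> n3 K0 cF FK.
have intW : (mu n).-integrable setT (fun x => (K%:E * (EFin \o @weight R n) x)%E).
  by apply: integrableZl => //; exact: integrable_weight.
apply: le_integrable intW => //.
  by apply/measurable_EFinP; exact: continuous_rv_measurable.
move=> x _ /=; rewrite lee_fin (le_trans (FK x))//.
rewrite (le_trans _ (ler_norm _))// ler_wpM2l//.
exact: weight_ge.
Qed.

Lemma compact_supp_integrable n (F : RV n -> R) (M : R) : (n <= 3)%N ->
  continuous F -> (forall x, M < `|x| -> F x = 0) ->
  (mu n).-integrable setT (EFin \o F).
Proof.
move=> n3 cF FM; have [B B0 FB] := continuous_bounded M cF.
apply: (@decay_integrable n F (B * (1 + `|M|) ^+ 4)) => //.
  by rewrite mulr_ge0// exprn_ge0// addr_ge0.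
move=> x; have x1 : 0 < 1 + `|x| by rewrite ltr_pwDl.
have [xM|xM] := ltP M `|x|.
  rewrite FM// normr0; apply: mulr_ge0; last by rewrite invr_ge0 exprn_ge0// ltW.
  by rewrite mulr_ge0// exprn_ge0// addr_ge0.
rewrite ler_pdivlMr ?exprn_gt0// ler_pM ?FB ?exprn_ge0 ?(ltW x1)//.
rewrite lerXn2r ?nnegrE ?addr_ge0// lerD2l (le_trans xM)//.
exact: ler_norm.
Qed.

Lemma integral_derive1_0 (f df : R -> R) (M : R) :
  (forall t : R, is_derive t 1 f (df t)) -> continuous df ->
  (forall t, M < `|t| -> f t = 0) ->
  (\int[@lebesgue_measure R]_t (df t)%:E = 0)%E.
Proof.
move=> dfE cdf fM; pose N := `|M| + 1.
have MN : M < N by rewrite (le_lt_trans (ler_norm M))// ltrDl.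
have N0 : 0 < N by rewrite ltr_wpDl.
have df0 t : M < `|t| -> df t = 0.
  move=> Mt; have [_ <-] := dfE t.
  rewrite -[RHS](@derive_cst _ R R 0 t 1); apply: near_eq_derive.
  near=> s; apply: fM; near: s.
  by apply: (@cvgr_gt _ _ _ _ (@Num.norm R R) `|t|) => //; exact: norm_continuous.
rewrite (_ : (fun t => (df t)%:E) = ((fun t => (df t)%:E) \_ `[- N, N])); last first.
  apply/funext => t; rewrite patchE; case: ifPn => // /negP tN.
  rewrite df0//; apply: lt_le_trans MN _; rewrite leNgt; apply/negP => tN'.
  by apply: tN; rewrite inE/= in_itv/= -ler_norml ltW.
rewrite -integral_mkcond (@continuous_FTC2 _ df f).
- rewrite !fM ?subee// ?normrN ger0_norm// ltW//.
- by rewrite -subr_gt0 opprK addr_gt0.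
- exact: continuous_subspaceT.
- split.
  + by move=> t _; have [] := dfE t.
  + by apply: cvg_at_right_filter; apply: is_derive_continuous (dfE _).
  + by apply: cvg_at_left_filter; apply: is_derive_continuous (dfE _).
- by move=> t _; rewrite derive1E; have [_ ->] := dfE t.
Unshelve. all: by end_near. Qed.

Lemma partial_rv_consS n (F : RV n.+1 -> R) (a : R) (v : RV n) k :
  derivable F (rv_cons (a, v)) (e (lift ord0 k)) ->
  is_derive v (e k) (fun v => F (rv_cons (a, v)))
    (partial (lift ord0 k) F (rv_cons (a, v))).
Proof.
move=> dF; have E : (fun h : R => h^-1 *: (((fun v => F (rv_cons (a, v))) \o shift v)
    (h *: e k) - F (rv_cons (a, v)))) =
    (fun h => h^-1 *: ((F \o shift (rv_cons (a, v)))
    (h *: e (lift ord0 k)) - F (rv_cons (a, v)))).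
  by apply/funext => h /=; rewrite rv_cons_deltaS.
by apply: DeriveDef; rewrite /derivable /partial /derive E.
Qed.

Lemma partial_rv_cons0 n (F : RV n.+1 -> R) (a : R) (v : RV n) :
  derivable F (rv_cons (a, v)) (e ord0) ->
  is_derive a 1 (fun a : R => F (rv_cons (a, v)))
    (partial ord0 F (rv_cons (a, v))).
Proof.
move=> dF; have E : (fun h : R => h^-1 *: (((fun a => F (rv_cons (a, v))) \o shift a)
    (h *: 1) - F (rv_cons (a, v)))) =
    (fun h => h^-1 *: ((F \o shift (rv_cons (a, v)))
    (h *: e ord0) - F (rv_cons (a, v)))).
  by apply/funext => h /=; rewrite [_%:A]mulr1 rv_cons_delta0.
by apply: DeriveDef; rewrite /derivable /partial /derive E.
Qed.

(** Induction on the dimension through Fubini. A derivative in a later coordinate is covered by the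
    induction hypothesis on slices with fixed first coordinate; for the first coordinate the order
    of integration is exchanged, so that the inner integral is one-dimensional. *)
Lemma integral_partial_0 n (F : RV n -> R) (j : 'I_n) (M : R) : (n <= 3)%N ->
  continuous F -> (forall x, derivable F x (e j)) -> continuous (partial j F) ->
  (forall x, M < `|x| -> F x = 0) ->
  (\int[mu n]_x (partial j F x)%:E = 0)%E.
Proof.
elim: n F j => [F []//|n IH] F j n3 cF dF cpF FM.
have pFM x : M < `|x| -> partial j F x = 0.
  move=> Mx; rewrite /partial -[RHS](@derive_cst _ (RV n.+1) R 0 x (e j)).
  apply: near_eq_derive; near=> y; apply: FM; near: y.
  by apply: (@cvgr_gt _ _ _ _ (@Num.norm R (RV n.+1)) `|x|) => //; exact: norm_continuous.
have int := compact_supp_integrable n3 cpF pFM.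
rewrite integral_rvS//.
have intS := integrable_rvS int.
case: (unliftP ord0 j) => [k jk|j0].
  rewrite -(integral12_prod_meas1 intS)//; apply: integral0_eq => a _.
  rewrite /fubini_F /=.
  have IHa := IH (fun v => F (rv_cons (a, v))) k (ltnW n3).
  rewrite -[RHS]IHa.
  - apply: eq_integral => v _; congr (_%:E).
    by have := dF (rv_cons (a, v)); rewrite jk => /partial_rv_consS/partialE ->.
  - by move=> v; exact: (continuous_comp (@continuous_rv_consr R n a v) (cF _)).
  - by move=> v; have := dF (rv_cons (a, v)); rewrite jk => /partial_rv_consS[].
  - have -> : partial k (fun v => F (rv_cons (a, v))) =
        (fun v => partial j F (rv_cons (a, v))).
      apply/funext => v; rewrite jk; apply: partialE; apply: partial_rv_consS.
      by rewrite -jk.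
    by move=> v; exact: (continuous_comp (@continuous_rv_consr R n a v) (cpF _)).
  - move=> v Mv; apply: FM; apply: lt_le_trans Mv _.
    by have [] := norm_rv_cons a v.
rewrite -(integral21_prod_meas1 intS)//; apply: integral0_eq => v _.
rewrite /fubini_G /= j0.
apply: (@integral_derive1_0 (fun a => F (rv_cons (a, v))) _ M).
- by move=> a; apply: partial_rv_cons0; rewrite -j0.
- by rewrite -j0 => a; exact: (continuous_comp (@continuous_rv_consl R n v a) (cpF _)).
- move=> a Ma; apply: FM; apply: lt_le_trans Ma _.
  by have [] := norm_rv_cons a v.
Unshelve. all: by end_near. Qed.

End integration_by_parts.

(** * Membership in H^1 from bounds at the origin and at infinity *)

Section tame.
Context {R : realType} {n : nat}.
Implicit Types (f g : 'rV[R]_n -> R).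
Local Notation mu := (lebesgue_rv R n).
Local Notation e j := (delta_mx ord0 j : 'rV[R]_n).

(* The weights make [f] a C^1 function on the whole of R^n, square integrable
   together with its gradient when n <= 3. *)
Definition tame f : Prop :=
  smooth_on [set x | x != 0] f /\
  exists K : R, [/\ 0 <= K,
    forall x, `|f x| <= K * `|x| ^+ 2 / (1 + `|x|) ^+ 4 &
    forall j x, x != 0 -> `|partial j f x| <= K * `|x| / (1 + `|x|) ^+ 3].

Lemma open_preimage_gt (g : 'rV[R]_n -> R) (a : R) :
  continuous g -> open [set x : 'rV[R]_n | a < g x].
Proof.
move=> cg; rewrite -[X in open X]/(g @^-1` [set t | a < t]).
apply: open_comp; last exact: open_gt.
by move=> x _; exact: cg.
Qed.

Lemma open_punctured : open [set x : 'rV[R]_n | x != 0].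
Proof.
have := @open_preimage_gt (fun x => `|x|) 0 (@norm_continuous _ _).
by congr open; apply/seteqP; split=> x /=; rewrite normr_gt0.
Qed.

Lemma tameD f g : tame f -> tame g -> tame (fun x => f x + g x).
Proof.
move=> [sf [K [K0 fK dfK]]] [sg [L [L0 gL dgL]]]; split.
  exact: (smooth_onD open_punctured sf sg).
exists (K + L); split; first exact: addr_ge0.
  move=> x; rewrite !mulrDl (le_trans (ler_normD _ _))//.
  by apply: lerD; [exact: fK|exact: gL].
move=> j x x0; have df := smooth_on_is_derive j sf x0.
have dg := smooth_on_is_derive j sg x0.
rewrite (partialE (is_deriveD df dg)) !mulrDl (le_trans (ler_normD _ _))//.
by apply: lerD; [exact: dfK|exact: dgL].
Qed.

Lemma tameZ (k : R) f : tame f -> tame (fun x => k * f x).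
Proof.
move=> [sf [K [K0 fK dfK]]]; split.
  exact: (smooth_onM open_punctured (smooth_on_cst k open_punctured) sf).
exists (`|k| * K); split; first exact: mulr_ge0.
  move=> x; rewrite normrM -!mulrA ler_wpM2l//.
  by have := fK x; rewrite -!mulrA.
move=> j x x0; have df := smooth_on_is_derive j sf x0.
rewrite (partialE (is_deriveZ k df)) [_ *: _]/(_ * _) normrM -!mulrA ler_wpM2l//.
by rewrite mulrA; exact: dfK.
Qed.

Lemma decay_le (t K : R) (m : nat) : 0 <= t -> 0 <= K -> (m <= 2)%N ->
  K * t ^+ m / (1 + t) ^+ m.+2 <= K * (1 + t) ^- 2.
Proof.
move=> t0 K0 m2; have t1 : 0 < 1 + t by rewrite ltr_pwDl.
rewrite -mulrA ler_wpM2l// ler_pdivrMr ?exprn_gt0// -[m.+2]addn2 exprD.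
rewrite mulrCA mulVf ?mulr1; last by rewrite gt_eqF// exprn_gt0.
by rewrite lerXn2r ?nnegrE// ?(ltW t1)// lerDr.
Qed.

Lemma tame_L2 f (K : R) : (n <= 3)%N -> continuous f -> 0 <= K ->
  (forall x, `|f x| <= K * (1 + `|x|) ^- 2) -> f \in Lfun mu 2%:E.
Proof.
move=> n3 cf K0 fK.
have mf := continuous_rv_measurable cf.
have int2 : mu.-integrable setT (EFin \o (fun x => f x ^+ 2)).
  apply: (@decay_integrable _ _ _ (K ^+ 2)) => //; first exact: sqr_ge0.
    by move=> x; rewrite (_ : (fun x => _) = (fun x => f x * f x));
      [apply: continuousM; exact: cf|exact/funext].
  move=> x; rewrite normrX.
  have -> : K ^+ 2 * (1 + `|x|) ^- 4 = (K * (1 + `|x|) ^- 2) ^+ 2.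
    by rewrite exprMn -exprVn -exprVn -exprM.
  rewrite lerXn2r ?nnegrE//.
  by rewrite (le_trans (normr_ge0 _) (fK x)).
rewrite inE; apply/andP; split; rewrite inE/=; first exact: mf.
rewrite /finite_norm unlock poweR_lty//.
have /integrableP[_] := int2; apply: le_lt_trans.
rewrite le_eqVlt; apply/orP; left; apply/eqP; apply: eq_integral => x _ /=.
by rewrite powR_mulrn// normrX.
Qed.

(** At the origin the quadratic bound on [f] makes the partial derivatives vanish, and the linear
    bound on the gradient makes them continuous. *)
Lemma tame_C1 f : tame f -> [/\ continuous f, forall x j, derivable f x (e j) &
  forall j, continuous (partial j f)].
Proof.
move=> [sf [K [K0 fK dfK]]].
have f00 : f 0 = 0.
  by apply/normr0_eq0/le_anti; rewrite normr_ge0 (le_trans (fK 0))// normr0 expr0n/= mulr0 mul0r.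
have fK' x : `|f x| <= K * `|x| ^+ 2.
  apply: le_trans (fK x) _; rewrite ler_pdivrMr ?exprn_gt0 ?ltr_pwDl//.
  by rewrite ler_peMr ?mulr_ge0 ?sqr_ge0// exprn_ege1// lerDl.
have df0 j : is_derive 0 (e j) f 0.
  apply: (@is_derive_quad R _ _ _ _ K 1) => // h _.
  rewrite addr0 f00 subr0 (le_trans (fK' _))// ler_wpM2l//.
  rewrite -[h ^+ 2]real_normK ?num_real// lerXn2r ?nnegrE//; exact: norm_delta.
have cvg0 (g : 'rV[R]_n -> R) : g 0 = 0 ->
    (forall x, x != 0 -> `|g x| <= K * `|x|) -> {for 0, continuous g}.
  move=> g0 gK; rewrite /prop_for /continuous_at g0.
  apply: cvg_rv => eps eps0; exists (eps / (K + 1)).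
    by rewrite divr_gt0// ltr_wpDl.
  move=> x; rewrite !sub0r !normrN => xd.
  have [->|x0] := eqVneq x 0; first by rewrite g0 normr0 ltW.
  apply: le_trans (gK _ x0) _.
  move: xd; rewrite ltr_pdivlMr ?ltr_wpDl// mulrC => /ltW; apply: le_trans.
  by rewrite ler_wpM2r// lerDl.
split.
- move=> x; have [->|x0] := eqVneq x 0; last exact: smooth_on_continuous sf x0.
  apply: cvg0 => // y y0; apply: le_trans (fK y) _; rewrite -!mulrA ler_wpM2l//.
  rewrite ler_piMr// ler_pdivrMr ?exprn_gt0 ?ltr_pwDl// mul1r.
  rewrite (@le_trans _ _ (1 + `|y|))// ?lerDr// exprS ler_peMr ?addr_ge0//.
  by rewrite exprn_ege1// lerDl.
- move=> x j; have [->|x0] := eqVneq x 0; first by have [] := df0 j.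
  by have [] := smooth_on_is_derive j sf x0.
- move=> j x; have [->|x0] := eqVneq x 0.
    apply: cvg0; first exact: partialE (df0 j).
    move=> y y0; apply: le_trans (dfK j y y0) _.
    rewrite ler_pdivrMr ?exprn_gt0 ?ltr_pwDl//.
    by rewrite ler_peMr ?mulr_ge0// exprn_ege1// lerDl.
  exact: (smooth_on_continuous (smooth_on_partial j sf) x0).
Qed.

Lemma test_function_supp phi : @test_function R n phi ->
  exists M : R, forall x, M < `|x| -> phi x = 0.
Proof.
move=> [_ /compact_bounded[M [_ Mb]]]; exists (M + 1) => x Mx.
apply/eqP; apply: contraTT Mx => phix0; rewrite -leNgt.
apply: (Mb (M + 1)); first by rewrite ltrDl.
exact: subset_closure.
Qed.

(** Since [f] is C^1 on the whole space by [tame_C1], no ball around the origin has to be removed: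
    the partial derivative of f phi is continuous with compact support and has integral zero. *)
Lemma tame_weak_partial f j : (n <= 3)%N -> tame f -> weak_partial j f (partial j f).
Proof.
move=> n3 tf phi tphi; have [cf df cpf] := tame_C1 tf.
have [M phiM] := test_function_supp tphi; have [sphi _] := tphi.
have cphi x : {for x, continuous phi} by exact: (smooth_on_continuous sphi).
have dphi x : is_derive x (e j) phi (partial j phi x).
  exact: (smooth_on_is_derive j sphi).
have cpphi x : {for x, continuous (partial j phi)}.
  exact: (smooth_on_continuous (smooth_on_partial j sphi)).
have dphi0 x : M < `|x| -> partial j phi x = 0.
  move=> Mx; rewrite /partial -[RHS](@derive_cst _ 'rV[R]_n R 0 x (e j)).
  apply: near_eq_derive; near=> y; apply: phiM; near: y.
  by apply: (@cvgr_gt _ _ _ _ (@Num.norm R 'rV[R]_n) `|x|) => //; exact: norm_continuous.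
have pE x : partial j (fun x => f x * phi x) x =
    f x * partial j phi x + partial j f x * phi x.
  rewrite (partialE (is_deriveM (derivableP (df x j)) (dphi x))).
  by rewrite [_ *: _]/(_ * _) [X in _ + X]mulrC.
have c1 : continuous (fun x => f x * partial j phi x).
  by move=> x; apply: continuousM; [exact: cf|exact: cpphi].
have c2 : continuous (fun x => partial j f x * phi x).
  by move=> x; apply: continuousM; [exact: cpf|exact: cphi].
have i1 : mu.-integrable setT (EFin \o (fun x => f x * partial j phi x)).
  by apply: (compact_supp_integrable (M := M)) => // x Mx; rewrite dphi0// mulr0.
have i2 : mu.-integrable setT (EFin \o (fun x => partial j f x * phi x)).
  by apply: (compact_supp_integrable (M := M)) => // x Mx; rewrite phiM// mulr0.
apply/eqP; rewrite -addr_eq0 -RintegralD//; apply/eqP.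
rewrite /Rintegral -[RHS]/(fine 0%:E); congr fine.
rewrite -[RHS](@integral_partial_0 R n (fun x => f x * phi x) j M)//.
- by apply: eq_integral => x _; rewrite pE.
- by move=> x; apply: continuousM; [exact: cf|exact: cphi].
- by move=> x; have [] := is_deriveM (derivableP (df x j)) (dphi x).
- rewrite (_ : partial j _ = fun x => f x * partial j phi x + partial j f x * phi x).
    by move=> x; exact: (continuousD (c1 x) (c2 x)).
  exact/funext.
- by move=> x Mx; rewrite phiM// mulr0.
Unshelve. all: by end_near. Qed.

Lemma tame_sobolev f : (n <= 3)%N -> tame f -> sobolev_H1 f.
Proof.
move=> n3 tf; have [cf df cpf] := tame_C1 tf; have [sf [K [K0 fK dfK]]] := tf.
split=> [|j].
  apply: (@tame_L2 _ K) => // x; apply: le_trans (fK x) _.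
  exact: decay_le.
exists (partial j f); last exact: tame_weak_partial.
(* The gradient bound in [tame] is for x <> 0; the extra term in the constant covers the origin
   itself. *)
apply: (@tame_L2 _ (K + `|partial j f 0|)) => //; first exact: addr_ge0.
move=> x; have [->|x0] := eqVneq x 0.
  by rewrite normr0 addr0 expr1n invr1 mulr1 lerDr.
apply: le_trans (dfK j x x0) _; apply: (@le_trans _ _ (K * (1 + `|x|) ^- 2)).
  by have := @decay_le `|x| K 1 (normr_ge0 _) K0 isT; rewrite expr1.
by rewrite ler_wpM2r ?lerDl// invr_ge0 exprn_ge0// addr_ge0.
Qed.

End tame.

(** * Complex-valued functions *)

Notation nrmc := ComplexField.Normc.normc.

Section complex_calculus.
Context {R : realType} {n : nat}.
Implicit Types (F G : 'rV[R]_n -> R[i]) (A : set 'rV[R]_n) (x : 'rV[R]_n).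

Local Notation e j := (delta_mx ord0 j : 'rV[R]_n).

Lemma nrmcM (z w : R[i]) : nrmc (z * w) = nrmc z * nrmc w.
Proof. exact: ComplexField.Normc.normcM. Qed.

Lemma nrmcX (z : R[i]) k : nrmc (z ^+ k) = nrmc z ^+ k.
Proof.
elim: k => [|k IH]; first by rewrite !expr0; exact: ComplexField.Normc.normc1.
by rewrite !exprS nrmcM IH.
Qed.

Lemma nrmcD (z w : R[i]) : nrmc (z + w) <= nrmc z + nrmc w.
Proof. exact: le_normcD. Qed.

Lemma nrmcE (z : R[i]) : nrmc z = Num.sqrt (complex.Re z ^+ 2 + complex.Im z ^+ 2).
Proof. by case: z. Qed.

Lemma nrmc_ge0 (z : R[i]) : 0 <= nrmc z.
Proof. by rewrite nrmcE sqrtr_ge0. Qed.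

Lemma nrmc0 : nrmc (0 : R[i]) = 0.
Proof. exact: ComplexField.Normc.normc0. Qed.

Lemma nrmcN (z : R[i]) : nrmc (- z) = nrmc z.
Proof. exact: (@normcN R z). Qed.

Lemma nrmc_real (a : R) : nrmc (a%:C)%C = `|a|.
Proof. by rewrite nrmcE/= expr0n addr0 sqrtr_sqr. Qed.

Lemma nrmc_nat (m : nat) : nrmc (m%:R : R[i]) = m%:R.
Proof. by rewrite -(rmorph_nat (real_complex R)) nrmc_real ger0_norm. Qed.

Lemma Re_le_nrmc (z : R[i]) : `|complex.Re z| <= nrmc z.
Proof.
rewrite nrmcE -(@ler_pXn2r _ 2)// ?nnegrE ?sqrtr_ge0//.
by rewrite sqr_sqrtr ?addr_ge0 ?sqr_ge0// real_normK ?num_real// lerDl sqr_ge0.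
Qed.

Lemma Im_le_nrmc (z : R[i]) : `|complex.Im z| <= nrmc z.
Proof.
rewrite nrmcE -(@ler_pXn2r _ 2)// ?nnegrE ?sqrtr_ge0//.
by rewrite sqr_sqrtr ?addr_ge0 ?sqr_ge0// real_normK ?num_real// lerDr sqr_ge0.
Qed.

Lemma nrmc_le_ReIm (z : R[i]) : nrmc z <= `|complex.Re z| + `|complex.Im z|.
Proof.
rewrite nrmcE -(@ler_pXn2r _ 2)// ?nnegrE ?sqrtr_ge0 ?addr_ge0//.
rewrite sqr_sqrtr ?addr_ge0 ?sqr_ge0// sqrrD !real_normK ?num_real//.
rewrite -addrA lerD2l lerDr mulrn_wge0// mulr_ge0.
Qed.

Definition is_cderive (j : 'I_n) F x (D : R[i]) : Prop :=
  is_derive x (e j) (fun y => complex.Re (F y)) (complex.Re D) /\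
  is_derive x (e j) (fun y => complex.Im (F y)) (complex.Im D).

Lemma is_cderive_eq j F x D E : is_cderive j F x D -> D = E -> is_cderive j F x E.
Proof. by move=> ? <-. Qed.

Lemma is_cderiveD j F G x D E : is_cderive j F x D -> is_cderive j G x E ->
  is_cderive j (fun y => F y + G y) x (D + E).
Proof.
move=> [F1 F2] [G1 G2]; split; rewrite raddfD.
  by rewrite (_ : (fun y => _) = (fun y => complex.Re (F y)) \+ (fun y => complex.Re (G y)));
    [exact: is_deriveD|apply/funext => y /=; rewrite raddfD].
by rewrite (_ : (fun y => _) = (fun y => complex.Im (F y)) \+ (fun y => complex.Im (G y)));
  [exact: is_deriveD|apply/funext => y /=; rewrite raddfD].
Qed.

Lemma ReM (z w : R[i]) : complex.Re (z * w) =
  complex.Re z * complex.Re w - complex.Im z * complex.Im w.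
Proof. by case: z w => [a b] [c d]. Qed.

Lemma ImM (z w : R[i]) : complex.Im (z * w) =
  complex.Re z * complex.Im w + complex.Im z * complex.Re w.
Proof. by case: z w => [a b] [c d]. Qed.

Lemma is_cderiveM j F G x D E : is_cderive j F x D -> is_cderive j G x E ->
  is_cderive j (fun y => F y * G y) x (D * G x + F x * E).
Proof.
move=> [F1 F2] [G1 G2]; split.
  rewrite (_ : (fun y => _) = (fun y => complex.Re (F y)) * (fun y => complex.Re (G y)) -
     (fun y => complex.Im (F y)) * (fun y => complex.Im (G y))).
    have dd := is_deriveB (is_deriveM F1 G1) (is_deriveM F2 G2).
    apply: is_derive_eq dd _.
    by rewrite [RHS]raddfD /= !ReM /GRing.scale/=; ring.
  by apply/funext => y /=; rewrite ReM.
rewrite (_ : (fun y => _) = (fun y => complex.Re (F y)) * (fun y => complex.Im (G y)) +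
   (fun y => complex.Im (F y)) * (fun y => complex.Re (G y))).
  have dd := is_deriveD (is_deriveM F1 G2) (is_deriveM F2 G1).
  apply: is_derive_eq dd _.
  by rewrite [RHS]raddfD /= !ImM /GRing.scale/=; ring.
by apply/funext => y /=; rewrite ImM.
Qed.

Lemma is_cderive_cst j (z : R[i]) x : is_cderive j (fun=> z) x 0.
Proof. by split; exact: is_derive_cst. Qed.

Lemma is_cderiveX j F x D k : is_cderive j F x D ->
  is_cderive j (fun y => F y ^+ k) x (k%:R * F x ^+ k.-1 * D).
Proof.
move=> dF; elim: k => [|k IH].
  by rewrite !mul0r; exact: (is_cderive_cst j 1 x).
rewrite (_ : (fun y => _) = (fun y => F y * F y ^+ k)); last first.
  by apply/funext => y; rewrite exprS.
apply: is_cderive_eq (is_cderiveM dF IH) _.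
case: k IH => [|k] _; first by rewrite !expr0; ring.
by rewrite /= -[k.+2%:R]natr1 exprS; ring.
Qed.

Lemma is_cderive_real j (f : 'rV[R]_n -> R) x d : is_derive x (e j) f d ->
  is_cderive j (fun y => ((f y)%:C)%C) x (d%:C)%C.
Proof. by move=> df; split=> //=; exact: is_derive_cst. Qed.

Lemma is_cderive_sum j (I : Type) (r : seq I) (F : I -> 'rV[R]_n -> R[i])
    (D : I -> R[i]) x : (forall i, is_cderive j (F i) x (D i)) ->
  is_cderive j (fun y => \sum_(i <- r) F i y) x (\sum_(i <- r) D i).
Proof.
move=> dF; elim: r => [|i r IH].
  rewrite big_nil (_ : (fun y => _) = fun=> 0); first exact: is_cderive_cst.
  by apply/funext => y; rewrite big_nil.
rewrite big_cons (_ : (fun y => _) = fun y => F i y + \sum_(i <- r) F i y).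
  exact: is_cderiveD.
by apply/funext => y; rewrite big_cons.
Qed.

Lemma near_is_cderive j F G x D : (\near x, F x = G x) ->
  is_cderive j F x D -> is_cderive j G x D.
Proof.
move=> FG [F1 F2]; split; [apply: near_eq_is_derive F1|apply: near_eq_is_derive F2].
  by apply: filterS FG => y ->.
by apply: filterS FG => y ->.
Qed.

Definition cpartial (j : 'I_n) F x : R[i] :=
  Complex (partial j (fun y => complex.Re (F y)) x)
          (partial j (fun y => complex.Im (F y)) x).

Lemma cpartialE j F x D : is_cderive j F x D -> cpartial j F x = D.
Proof. by case: D => a b [/partialE H1 /partialE H2]; rewrite /cpartial H1 H2. Qed.

Definition csmooth A F : Prop :=
  smooth_on A (fun y => complex.Re (F y)) /\ smooth_on A (fun y => complex.Im (F y)).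

Lemma csmooth_is_cderive A F x j : csmooth A F -> A x ->
  is_cderive j F x (cpartial j F x).
Proof. by move=> [s1 s2] Ax; split; exact: smooth_on_is_derive Ax. Qed.

Lemma eq_csmooth A F G : open A -> (forall x, A x -> F x = G x) ->
  csmooth A F -> csmooth A G.
Proof.
move=> oA FG [s1 s2]; split; [apply: eq_smooth_on s1|apply: eq_smooth_on s2] => //.
  by move=> x /FG ->.
by move=> x /FG ->.
Qed.

Lemma csmooth_cst A (z : R[i]) : open A -> csmooth A (fun=> z).
Proof.
by move=> oA; split; [exact: (smooth_on_cst (complex.Re z) oA)|
  exact: (smooth_on_cst (complex.Im z) oA)].
Qed.

Lemma csmoothD A F G : open A -> csmooth A F -> csmooth A G ->
  csmooth A (fun x => F x + G x).
Proof.
move=> oA [F1 F2] [G1 G2]; split.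
  by apply: (eq_smooth_on oA _ (smooth_onD oA F1 G1)) => x _; rewrite raddfD.
by apply: (eq_smooth_on oA _ (smooth_onD oA F2 G2)) => x _; rewrite raddfD.
Qed.

Lemma csmoothM A F G : open A -> csmooth A F -> csmooth A G ->
  csmooth A (fun x => F x * G x).
Proof.
move=> oA [F1 F2] [G1 G2]; split.
  have H := smooth_onB oA (smooth_onM oA F1 G1) (smooth_onM oA F2 G2).
  by apply: (eq_smooth_on oA _ H) => x _; rewrite ReM.
have H := smooth_onD oA (smooth_onM oA F1 G2) (smooth_onM oA F2 G1).
by apply: (eq_smooth_on oA _ H) => x _; rewrite ImM.
Qed.

Lemma csmooth_real A (f : 'rV[R]_n -> R) : open A -> smooth_on A f ->
  csmooth A (fun x => ((f x)%:C)%C).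
Proof. by move=> oA sf; split=> //; exact: (smooth_on_cst 0 oA). Qed.

Lemma csmoothX A F k : open A -> csmooth A F -> csmooth A (fun x => F x ^+ k).
Proof.
move=> oA sF; elim: k => [|k IH].
  exact: (eq_csmooth oA _ (csmooth_cst 1 oA)).
by apply: (eq_csmooth oA _ (csmoothM oA sF IH)) => x _; rewrite exprS.
Qed.

Lemma csmooth_sum A (I : Type) (r : seq I) (F : I -> 'rV[R]_n -> R[i]) :
  open A -> (forall i, csmooth A (F i)) -> csmooth A (fun x => \sum_(i <- r) F i x).
Proof.
move=> oA sF; elim: r => [|i r IH].
  by apply: (eq_csmooth oA _ (csmooth_cst 0 oA)) => x _; rewrite big_nil.
by apply: (eq_csmooth oA _ (csmoothD oA (sF i) IH)) => x _; rewrite big_cons.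
Qed.

Lemma csmooth_local A F :
  (forall x, A x -> exists B, B x /\ csmooth B F) -> csmooth A F.
Proof.
by move=> H; split; apply: smooth_on_local => x /H[B [Bx [s1 s2]]]; exists B.
Qed.

Lemma csmoothS A B F : A `<=` B -> csmooth B F -> csmooth A F.
Proof. by move=> AB [s1 s2]; split; [exact: smooth_onS AB s1|exact: smooth_onS AB s2]. Qed.

End complex_calculus.


(** * Modes and their envelope *)

Section cutoff_definitions.
Context {R : realType} (j0 : nat).
Implicit Types (t : R) (j : nat) (par : bool).

(** The factor towards small [t], that is, towards large |zeta|, is dropped for the first mode,
    which stays on there until a cutoff in x stops it. *)
Definition cut j t : R :=
  flat (1 + j%:R - t) * (if j == j0 then 1 else flat (1 - j%:R + t)).

Definition dcut j t : R :=
  - dflat (1 + j%:R - t) * (if j == j0 then 1 else flat (1 - j%:R + t)) +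
  flat (1 + j%:R - t) * (if j == j0 then 0 else dflat (1 - j%:R + t)).

(** For the indices j0 + par + 2 i the open intervals (j - 1, j + 1) are disjoint, so at most one
    mode of each parity is on at [t], and this is its index. For small [t] the truncation at zero
    returns the first index. *)
Definition mode_index par t : nat :=
  j0 + par + 2 * Num.truncn ((t + 1 - (j0 + par)%:R) / 2).

Definition active j t : Prop := t < j%:R + 1 /\ (j = j0 \/ j%:R - 1 < t).

End cutoff_definitions.

Section modes.
Context {R : realType} (beta : R) (j0 : nat).
Implicit Types (t rho : R) (j i : nat) (par : bool).

Definition tau rho : R := rho `^ (- beta).

Definition env rho : R := expR (- (rho `^ (- (2 * beta)) / (4 * beta))).

(* The factor that makes [|z| ^ (j ^ 2)] tangent to the envelope at [tau = j]. *)
Definition coef j : R :=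
  expR ((j%:R ^+ 2 * ln j%:R - j%:R ^+ 2 / 2) / (2 * beta)).

(** The exponent is the bound of [log_amp_le] divided by 2 beta; its size is dictated by the first
    mode, which is not cut off on the whole of [1, j0 + 1). *)
Definition kamp : R :=
  expR ((j0.+1%:R ^+ 2 * (2 * j0%:R + 1)) / (2 * beta)).

Hypothesis beta0 : 0 < beta.
Hypothesis j02 : (2 <= j0)%N.

Lemma env_gt0 rho : 0 < env rho. Proof. exact: expR_gt0. Qed.

Lemma env_ge0 rho : 0 <= env rho. Proof. exact: expR_ge0. Qed.

Lemma env_le1 rho : env rho <= 1.
Proof. by rewrite expR_le1 oppr_le0 divr_ge0 ?powR_ge0// mulr_ge0// ltW. Qed.

Lemma le_powRN (p r s : R) : 0 <= p -> 0 < r -> r <= s -> s `^ (- p) <= r `^ (- p).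
Proof.
move=> p0 r0 rs; have s0 : 0 < s by exact: lt_le_trans rs.
rewrite !powRN lef_pV2 ?posrE ?powR_gt0//.
by apply: ge0_ler_powR => //; rewrite nnegrE ltW.
Qed.

Lemma le_env r s : 0 < r -> r <= s -> env r <= env s.
Proof.
move=> r0 rs; rewrite ler_expR lerN2 ler_pM2r ?invr_gt0 ?mulr_gt0//.
by apply: le_powRN => //; rewrite mulr_ge0// ltW.
Qed.

Lemma tau_ge1 rho : 0 < rho -> rho <= 1 -> 1 <= tau rho.
Proof.
move=> r0 r1; have := le_powRN (ltW beta0) r0 r1.
by rewrite -[X in X <= _]/(1 `^ _) powR1.
Qed.

(** The expression is 2 beta times the logarithm of amplitude over envelope (see [amp_expR] and
    [env_tau]). Bounding ln (t / j) by t / j - 1 leaves (j - t) ^ 2 / 2, the tangency at t = j. *)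
Lemma log_amp_ge0 (j : nat) t : 0 < t -> (0 < j)%N ->
  0 <= j%:R ^+ 2 * (ln j%:R - ln t) - j%:R ^+ 2 / 2 + t ^+ 2 / 2.
Proof.
move=> t0 j1; have jp : 0 < j%:R :> R by rewrite ltr0n.
have H : ln t - ln j%:R <= t / j%:R - 1.
  rewrite -ln_div ?posrE// -[X in ln X](subrK 1) addrC.
  by apply: le_ln1Dx; rewrite ltrBrDr addNr divr_gt0.
have := ler_wpM2l (sqr_ge0 (j%:R : R)) H.
rewrite mulrBr [X in _ <= X]mulrBr mulr1 (_ : j%:R ^+ 2 * (t / j%:R) = j%:R * t).
  by have := sqr_ge0 (j%:R - t); rewrite sqrrB mulrBr; lra.
by rewrite mulrCA [RHS]mulrC; congr (_ * _); field; rewrite gt_eqF.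
Qed.

(** Here ln (j / t) is bounded by j / t - 1, and the result factors as (j - t) ^ 2 (2 j + t) / (2
    t): a double zero at t = j times a quotient that is bounded while [t] is within distance 1 of
    [j]. The first mode is treated apart, with 1 <= t < j0 + 1. *)
Lemma log_amp_le (j : nat) t : 1 <= t -> (j0 <= j)%N -> active j0 j t ->
  j%:R ^+ 2 * (ln j%:R - ln t) - j%:R ^+ 2 / 2 + t ^+ 2 / 2 <=
  j0.+1%:R ^+ 2 * (2 * j0%:R + 1).
Proof.
move=> t1 jj0 [tj act]; have t0 : 0 < t by lra.
have jp : 0 < j%:R :> R by rewrite ltr0n (leq_trans _ jj0)// (leq_trans _ j02).
have H : ln j%:R - ln t <= j%:R / t - 1.
  rewrite -ln_div ?posrE// -[X in ln X](subrK 1) addrC.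
  by apply: le_ln1Dx; rewrite ltrBrDr addNr divr_gt0.
have := ler_wpM2l (sqr_ge0 (j%:R : R)) H; set L := _ * (_ - _) => H'.
have j02R : 2 <= j0%:R :> R by rewrite (ler_nat _ 2).
apply: (@le_trans _ _ ((j%:R - t) ^+ 2 * (2 * j%:R + t) / (2 * t))).
  rewrite (_ : (j%:R - t) ^+ 2 * (2 * j%:R + t) / (2 * t) =
    j%:R ^+ 2 * (j%:R / t - 1) - j%:R ^+ 2 / 2 + t ^+ 2 / 2); first by lra.
  by field; rewrite gt_eqF.
rewrite -[j0.+1%:R]natr1; set a : R := j0%:R in j02R *; set b : R := j%:R in tj jp *.
rewrite ler_pdivrMr; last by lra.
case: act => [jE|act].
  have -> : b = a by rewrite /b jE.
  have ba : b = a by rewrite /b jE.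
  apply: (@le_trans _ _ ((a + 1) ^+ 2 * (2 * a + t))).
    apply: ler_wpM2r; first by lra.
    rewrite -[X in X <= _]real_normK ?num_real// lerXn2r ?nnegrE//; first lra.
    by rewrite ler_norml; lra.
  rewrite -[leRHS]mulrA ler_wpM2l ?sqr_ge0//.
  by nra.
have bt : (b - t) ^+ 2 <= 1.
  by rewrite -[X in X <= _]real_normK ?num_real// expr_le1// ler_norml; lra.
apply: (@le_trans _ _ (2 * b + t)).
  by rewrite ler_piMl//; lra.
apply: (@le_trans _ _ (5 * t)); first by lra.
rewrite mulrA; apply: ler_wpM2r; first by lra.
by rewrite expr2; nra.
Qed.

Lemma amp_expR rho j : 0 < rho ->
  coef j * Num.sqrt rho ^+ (j ^ 2)%N =
  expR ((j%:R ^+ 2 * (ln j%:R - ln (tau rho)) - j%:R ^+ 2 / 2) / (2 * beta)).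
Proof.
move=> r0; have b0 : beta != 0 by rewrite gt_eqF.
rewrite /coef -powR12_sqrt ?(ltW r0)// -[(_ `^ _) ^+ _]powR_mulrn ?powR_ge0// -powRrM.
rewrite [_ `^ _]/powR gt_eqF// -expRD; congr expR.
rewrite /tau ln_powR natrX.
by set l := ln rho; set m := ln _; field.
Qed.

Lemma env_tau rho : 0 < rho -> env rho = expR (- (tau rho ^+ 2 / 2) / (2 * beta)).
Proof.
move=> r0; have b0 : beta != 0 by rewrite gt_eqF.
rewrite /env /tau -powR_mulrn ?powR_ge0// -powRrM (_ : - beta * 2 = - (2 * beta)).
  by congr expR; set p := _ `^ _; field.
by ring.
Qed.

Lemma env_le_amp rho j : 0 < rho -> (0 < j)%N ->
  env rho <= coef j * Num.sqrt rho ^+ (j ^ 2)%N.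
Proof.
move=> r0 j1; rewrite amp_expR// env_tau// ler_expR.
apply: ler_wpM2r; first by rewrite invr_ge0 mulr_ge0// ltW.
have := log_amp_ge0 (powR_gt0 (- beta) r0) j1; rewrite -/(tau rho); lra.
Qed.

Lemma amp_le_env rho j : 0 < rho -> rho <= 1 -> (j0 <= j)%N -> active j0 j (tau rho) ->
  coef j * Num.sqrt rho ^+ (j ^ 2)%N <= kamp * env rho.
Proof.
move=> r0 r1 jj0 act; rewrite amp_expR// env_tau// /kamp -expRD ler_expR -mulrDl.
apply: ler_wpM2r; first by rewrite invr_ge0 mulr_ge0// ltW.
have := log_amp_le (tau_ge1 r0 r1) jj0 act; lra.
Qed.

Lemma kamp_ge0 : 0 <= kamp. Proof. exact: expR_ge0. Qed.

End modes.

(** * Which modes are on, and how large their cutoffs are *)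

Section cutoffs.
Context {R : realType} (j0 : nat).
Implicit Types (t : R) (j i : nat) (par : bool).

Lemma is_derive_cut j t : is_derive t 1 (cut j0 j) (dcut j0 j t).
Proof.
have d1 : is_derive t 1 (fun s : R => 1 + j%:R - s) (-1).
  by apply: is_derive_eq (is_deriveB (is_derive_cst (1 + j%:R : R) t 1)
    (is_derive_id t (1 : R))) _; rewrite sub0r.
have d2 : is_derive t 1 (fun s : R => 1 - j%:R + s) 1.
  by apply: is_derive_eq (is_deriveD (is_derive_cst (1 - j%:R : R) t 1)
    (is_derive_id t (1 : R))) _; rewrite add0r.
have e1 := @is_derive1_comp _ flat (fun s : R => 1 + j%:R - s) _ _ _
  (is_derive_flat (1 + j%:R - t)) d1.
have e2 := @is_derive1_comp _ flat (fun s : R => 1 - j%:R + s) _ _ _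
  (is_derive_flat (1 - j%:R + t)) d2.
rewrite /cut /dcut; case: (j == j0).
  have dd := is_deriveM e1 (is_derive_cst (1 : R) t 1).
  by apply: is_derive_eq dd _; rewrite /GRing.scale/=; ring.
have dd := is_deriveM e1 e2.
by apply: is_derive_eq dd _; rewrite /GRing.scale/=; ring.
Qed.

Lemma cut_ge0 j t : 0 <= cut j0 j t.
Proof. by rewrite /cut mulr_ge0 ?flat_ge0//; case: ifP => _ //; exact: flat_ge0. Qed.

Lemma cut_le1 j t : cut j0 j t <= 1.
Proof.
rewrite /cut mulr_ile1 ?flat_ge0 ?flat_le1//; case: ifP => _ //.
  exact: flat_ge0.
exact: flat_le1.
Qed.

Lemma norm_dcut j t : `|dcut j0 j t| <= 4.
Proof.
have f1 s : `|flat s| <= 1 :> R by rewrite ger0_norm ?flat_ge0 ?flat_le1.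
rewrite (_ : 4 = 2 * 1 + 1 * 2); last by ring.
rewrite (le_trans (ler_normD _ _))// !normrM normrN lerD//; apply: ler_pM => //;
  rewrite ?norm_dflat//; case: ifP => _; rewrite ?normr1 ?normr0//; exact: norm_dflat.
Qed.

Lemma cut_inactive j t : ~ active j0 j t -> cut j0 j t = 0 /\ dcut j0 j t = 0.
Proof.
move=> nact; rewrite /cut /dcut.
have [tj|tj] := ltP t (j%:R + 1); last first.
  have tj' : 1 + j%:R - t <= 0 by lra.
  by rewrite (flat0 tj') (dflat0 tj') oppr0 !mul0r addr0.
have [jE|jn] := eqVneq j j0; first by case: nact; split=> //; left.
have tj' : 1 - j%:R + t <= 0.
  rewrite leNgt; apply/negP => H; apply: nact; split=> //; right; lra.
by rewrite (flat0 tj') (dflat0 tj') !mulr0 addr0.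
Qed.

Lemma active_index par i t :
  active j0 (j0 + par + 2 * i) t -> Num.truncn ((t + 1 - (j0 + par)%:R) / 2) = i.
Proof.
move=> [t1 act].
have t1' : t < (j0 + par)%:R + 2 * i%:R + 1.
  by move: t1; rewrite natrD natrM.
case: act => [E|act].
  have i0 : i = 0%N by move: E; lia.
  rewrite i0 mulr0 addr0 in t1' *; apply/eqP.
  by rewrite -leqn0 leqNgt truncn_gt0 -ltNge; lra.
have act' : (j0 + par)%:R + 2 * i%:R - 1 < t by move: act; rewrite natrD natrM.
apply: truncn_def; rewrite -[i.+1%:R]natr1; apply/andP; split; lra.
Qed.

Lemma cut_other par i t : i != Num.truncn ((t + 1 - (j0 + par)%:R) / 2) ->
  cut j0 (j0 + par + 2 * i) t = 0 /\ dcut j0 (j0 + par + 2 * i) t = 0.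
Proof.
by move=> it; apply: cut_inactive => /active_index E; rewrite E eqxx in it.
Qed.

Lemma mode_index_ge par t : (j0 <= mode_index j0 par t)%N.
Proof. by rewrite /mode_index -addnA leq_addr. Qed.

(** Take the integer nearest to [t], or [j0] if that is larger: the arguments of [flat] that occur
    are then at least 1 / 2, and the parity of the distance from [j0] is the [par] asked for. *)
Lemma cut_lower t : 0 <= t ->
  exists par, flat (1 / 2) ^+ 2 <= cut j0 (mode_index j0 par t) t /\
    active j0 (mode_index j0 par t) t.
Proof.
move=> t0; have f1 := @flat_le1 R (1 / 2); have f0 := @flat_ge0 R (1 / 2).
have key j : (j0 <= j)%N -> t <= j%:R + 1 / 2 -> (j = j0 \/ j%:R - 1 / 2 <= t) ->
    exists par, flat (1 / 2) ^+ 2 <= cut j0 (mode_index j0 par t) t /\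
    active j0 (mode_index j0 par t) t.
  move=> jj0 tj act; have actj : active j0 j t.
    by split; [lra|case: act => [->|?]; [left|right; lra]].
  pose par := odd (j - j0); pose i := (j - j0)./2.
  have jE : j = (j0 + par + 2 * i)%N.
    by have := odd_double_half (j - j0); rewrite -/par -/i mul2n; lia.
  exists par; have -> : mode_index j0 par t = j.
    by rewrite /mode_index (@active_index par i) -?jE.
  split=> //; rewrite /cut expr2; apply: ler_pM => //.
    by apply: le_flat; lra.
  by case: eqP => // jn; apply: le_flat; case: act => //; lra.
have [tj|tj] := leP t (j0%:R + 1 / 2); first by apply: (key j0) => //; left.
pose m := Num.truncn (t + 1 / 2).
have t2 : 0 <= t + 1 / 2 by lra.
have /andP[m1 m2] := truncn_itv t2; rewrite -/m -[m.+1%:R]natr1 in m1 m2.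
apply: (key m); [|lra|right; lra].
by rewrite -ltnS -(ltr_nat R) -[m.+1%:R]natr1; lra.
Qed.

Lemma cut_index0_le t : t <= j0%:R -> cut j0 (mode_index j0 true t) t = 0.
Proof.
move=> tj; have -> : mode_index j0 true t = j0.+1.
  rewrite /mode_index (_ : Num.truncn _ = 0%N) ?muln0 ?addn0 ?addn1//.
  by apply/eqP; rewrite -leqn0 leqNgt truncn_gt0 -ltNge -?[j0.+1%:R]natr1; lra.
have [] := @cut_inactive j0.+1 t => //; case=> _ [|]; first by lia.
by rewrite -natr1; lra.
Qed.


End cutoffs.

(** * The modes of one parity in a coordinate plane *)

Section block.
Context {R : realType} {n : nat} (beta : R) (j0 : nat) (p q : 'I_n).
Implicit Types (x : 'rV[R]_n) (l : 'I_n) (par : bool) (j : nat).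

Local Notation e l := (delta_mx ord0 l : 'rV[R]_n).

Definition sqn x : R := \sum_(i < n) x ord0 i ^+ 2.

Definition rho x : R := x ord0 p ^+ 2 + x ord0 q ^+ 2.

Definition drho l x : R := 2 * (x ord0 p * (p == l)%:R + x ord0 q * (q == l)%:R).

Definition sgn par : R := (-1) ^+ par.

Definition zeta par x : R[i] := Complex (x ord0 p) (sgn par * x ord0 q).

Definition dzeta par l : R[i] := Complex (p == l)%:R (sgn par * (q == l)%:R).

Definition mode par j x : R[i] :=
  ((cut j0 j (tau beta (rho x)) * coef beta j)%:C)%C * zeta par x ^+ (j ^ 2)%N.

Definition dtau l x : R := - beta * rho x `^ (- beta - 1) * drho l x.

(** The derivative of a mode is split into the part that falls on the cutoff and, in [dmode_ang],
    the part that falls on the power of zeta. A Cauchy-Riemann operator kills the latter. *)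
Definition dmode_rad par j l x : R[i] :=
  ((dcut j0 j (tau beta (rho x)) * coef beta j * dtau l x)%:C)%C *
  zeta par x ^+ (j ^ 2)%N.

Definition dmode_ang par j x : R[i] :=
  ((cut j0 j (tau beta (rho x)) * coef beta j)%:C)%C *
  ((j ^ 2)%N%:R * zeta par x ^+ (j ^ 2).-1).

Definition mode_at par x : nat := mode_index j0 par (tau beta (rho x)).

(** The sum of all modes of one parity, written as its only possibly nonzero term. Bounds can be
    read off directly, and [block_local] recovers a finite sum to differentiate. *)
Definition block par x : R[i] := mode par (mode_at par x) x.

Hypothesis pq : p != q.
Hypothesis beta0 : 0 < beta.
Hypothesis j02 : (2 <= j0)%N.

Lemma rho_ge0 x : 0 <= rho x. Proof. by rewrite addr_ge0 ?sqr_ge0. Qed.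

Lemma sqn_ge0 x : 0 <= sqn x. Proof. by apply: sumr_ge0 => i _; exact: sqr_ge0. Qed.

Lemma rho_le_sqn x : rho x <= sqn x.
Proof.
rewrite /rho /sqn (bigD1 p)//= (bigD1 q) 1?eq_sym//= addrA lerDl.
by apply: sumr_ge0 => i _; exact: sqr_ge0.
Qed.

Lemma norm_sq_le_sqn x : `|x| ^+ 2 <= sqn x.
Proof.
have [xi|[k ->]] : `|x| = 0 \/ exists i, `|x| = `|x ord0 i|.
  have [|x0] := eqVneq `|x| 0; first by left.
  right; rewrite /Num.Def.normr/= in x0 *.
  by have [[i j] ->] := mx_norm_neq0 x0; exists j; rewrite ord1.
  by rewrite xi expr0n sqn_ge0.
rewrite real_normK ?num_real// /sqn (bigD1 k)//= lerDl.
by apply: sumr_ge0 => i _; exact: sqr_ge0.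
Qed.

Lemma sqn_le_norm_sq x : sqn x <= n%:R * `|x| ^+ 2.
Proof.
rewrite /sqn (le_trans (ler_sum _ (G := fun=> `|x| ^+ 2) _))//.
  move=> i _; rewrite -[leLHS]real_normK ?num_real// lerXn2r ?nnegrE//.
  exact: ler_rv_norm.
by rewrite sumr_const card_ord mulr_natl.
Qed.

Lemma sqn_gt0 x : x != 0 -> 0 < sqn x.
Proof.
by move=> x0; rewrite (lt_le_trans _ (norm_sq_le_sqn x))// exprn_gt0// normr_gt0.
Qed.

Lemma sqn_coord x i : x ord0 i ^+ 2 <= sqn x.
Proof.
rewrite /sqn (bigD1 i)//= lerDl.
by apply: sumr_ge0 => k _; exact: sqr_ge0.
Qed.

Lemma is_derive_sq_coord i l x :
  is_derive x (e l) (fun y => y ord0 i ^+ 2) (2 * (x ord0 i * (i == l)%:R)).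
Proof.
have d := is_derive_coord x l i.
rewrite (_ : (fun y => _) = (fun y : 'rV[R]_n => y ord0 i) * (fun y => y ord0 i)).
  have dd := is_deriveM d d.
  by apply: is_derive_eq dd _; rewrite /GRing.scale/=; ring.
by apply/funext => y /=; rewrite expr2.
Qed.

Lemma is_derive_rho l x : is_derive x (e l) rho (drho l x).
Proof.
have dd := is_deriveD (is_derive_sq_coord p l x) (is_derive_sq_coord q l x).
by apply: is_derive_eq dd _; rewrite -mulrDr.
Qed.

Lemma smooth_on_rho A : open A -> smooth_on A rho.
Proof.
move=> oA; exact: (smooth_onD oA (smooth_onX 2 oA (smooth_on_coord p oA))
  (smooth_onX 2 oA (smooth_on_coord q oA))).
Qed.

Lemma continuous_rho : continuous rho.
Proof. by move=> x; exact: (smooth_on_continuous (smooth_on_rho openT)). Qed.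

Lemma open_rho (c : R) : open [set x | c < rho x].
Proof. exact: (open_preimage_gt (a := c) continuous_rho). Qed.

Lemma is_derive_tau l x : 0 < rho x ->
  is_derive x (e l) (fun y => tau beta (rho y)) (dtau l x).
Proof.
move=> r0; exact: (is_derive_comp1 (is_derive_rho l x) (is_derive1_powR (- beta) r0)).
Qed.

Lemma is_cderive_zeta par l x : is_cderive l (zeta par) x (dzeta par l).
Proof.
split; first exact: is_derive_coord.
exact: (is_deriveZ (sgn par) (is_derive_coord x l q)).
Qed.

Lemma sgn_norm par : `|sgn par| = 1. Proof. by rewrite normrX normrN1 expr1n. Qed.

Lemma sgn_sq par : sgn par ^+ 2 = 1. Proof. by rewrite -exprM mulnC exprM sqrrN !expr1n. Qed.

Lemma nrmc_zeta par x : nrmc (zeta par x) = Num.sqrt (rho x).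
Proof. by rewrite nrmcE/= exprMn sgn_sq mul1r. Qed.

Lemma is_cderive_mode par j l x : 0 < rho x ->
  is_cderive l (mode par j) x (dmode_rad par j l x + dmode_ang par j x * dzeta par l).
Proof.
move=> r0; have dc := is_derive_comp1 (is_derive_tau l r0) (is_derive_cut j0 j _).
have dc' := is_deriveM dc (is_derive_cst (coef beta j) x (e l)).
have dd := is_cderiveM (is_cderive_real dc') (is_cderiveX (j ^ 2)%N (is_cderive_zeta par l x)).
apply: is_cderive_eq dd _; rewrite /dmode_rad /dmode_ang; congr (_ + _).
  congr (_ * _); congr (_%:C)%C; rewrite /GRing.scale/=; ring.
by rewrite -!mulrA.
Qed.

Lemma smooth_on_cut_tau j (c : R) : 0 < c ->
  smooth_on [set x | c < rho x] (fun x => cut j0 j (tau beta (rho x))).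
Proof.
move=> c0; have oU := @open_rho c.
have sr := smooth_on_rho oU.
have st : smooth_on [set x | c < rho x] (fun x => tau beta (rho x)).
  apply: (smooth_on_comp oU (smooth1_powR (- beta)) _ sr) => x /=.
  exact: lt_trans.
have s1 := smooth_on_comp oU smooth1_flat (fun _ _ => I)
  (smooth_onB oU (smooth_on_cst (1 + j%:R) oU) st).
have s2 := smooth_on_comp oU smooth1_flat (fun _ _ => I)
  (smooth_onD oU (smooth_on_cst (1 - j%:R) oU) st).
have [jj|jj] := eqVneq j j0.
  apply: (eq_smooth_on oU _ s1) => x _.
  by rewrite /cut jj eqxx mulr1.
apply: (eq_smooth_on oU _ (smooth_onM oU s1 s2)) => x _.
by rewrite /cut (negbTE jj).
Qed.

Lemma csmooth_zeta par A : open A -> csmooth A (zeta par).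
Proof.
move=> oA; split; first exact: (smooth_on_coord p oA).
exact: (smooth_onM oA (smooth_on_cst (sgn par) oA) (smooth_on_coord q oA)).
Qed.

Lemma csmooth_mode par j (c : R) : 0 < c -> csmooth [set x | c < rho x] (mode par j).
Proof.
move=> c0; have oU := @open_rho c.
have s1 := csmooth_real oU (smooth_onM oU (smooth_on_cut_tau j c0)
  (smooth_on_cst (coef beta j) oU)).
exact: (csmoothM oU s1 (csmoothX (j ^ 2)%N oU (csmooth_zeta par oU))).
Qed.

(** Where rho > c the variable [tau] is at most [tau beta c], so one finite set of modes serves all
    these points. *)
Lemma block_local par (c : R) : 0 < c -> exists N : nat, forall x, c < rho x ->
  (Num.truncn ((tau beta (rho x) + 1 - (j0 + par)%:R) / 2) < N)%N /\
  block par x = \sum_(i < N) mode par (j0 + par + 2 * i) x.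
Proof.
move=> c0; exists (Num.truncn (tau beta c)).+1 => x cx.
have tle : tau beta (rho x) <= tau beta c by exact: le_powRN (ltW beta0) c0 (ltW cx).
have iN : (Num.truncn ((tau beta (rho x) + 1 - (j0 + par)%:R) / 2) <
    (Num.truncn (tau beta c)).+1)%N.
  rewrite ltnS; apply: le_truncn.
  have t0 : 0 <= tau beta (rho x) := powR_ge0 _ _.
  have : 2 <= (j0 + par)%:R :> R by rewrite (ler_nat _ 2) (leq_trans j02)// leq_addr.
  lra.
split=> //; rewrite (bigD1 (Ordinal iN))//= big1 ?addr0// => i iN'.
have [c1 _] := @cut_other R j0 par i (tau beta (rho x)) iN'.
by rewrite /mode c1 mul0r mul0r.
Qed.

Lemma csmooth_block par (c : R) : 0 < c -> csmooth [set x | c < rho x] (block par).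
Proof.
move=> c0; have [N blockE] := block_local par c0.
apply: (eq_csmooth (@open_rho c) (F := fun x => \sum_(i < N) mode par (j0 + par + 2 * i) x)).
  by move=> x cx; have [_ ->] := blockE x cx.
by apply: csmooth_sum (@open_rho c) _ => i; exact: csmooth_mode.
Qed.

Lemma is_cderive_block par l x : 0 < rho x ->
  is_cderive l (block par) x (dmode_rad par (mode_at par x) l x +
    dmode_ang par (mode_at par x) x * dzeta par l).
Proof.
move=> r0; have c0 : 0 < rho x / 2 by rewrite divr_gt0.
have cx : rho x / 2 < rho x by lra.
have [N blockE] := block_local par c0; have [iN _] := blockE x cx.
apply: (near_is_cderive (F := fun x => \sum_(i < N) mode par (j0 + par + 2 * i) x)).
  apply: filterS (open_nbhs_nbhs (conj (@open_rho (rho x / 2)) cx)) => y cy.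
  by have [_ ->] := blockE y cy.
apply: (is_cderive_eq (is_cderive_sum _
  (fun i : 'I_N => is_cderive_mode par (j0 + par + 2 * i) l r0))).
rewrite (bigD1 (Ordinal iN))//= big1 ?addr0// => i iN'.
have [c1 c2] := @cut_other R j0 par i (tau beta (rho x)) iN'.
by rewrite /dmode_rad /dmode_ang c1 c2 !mul0r addr0.
Qed.

Lemma block0 par x : zeta par x = 0 -> block par x = 0.
Proof.
move=> z0; rewrite /block /mode z0 expr0n expn_eq0 andbT.
rewrite (_ : mode_at par x == 0%N = false) ?mulr0//.
apply/negbTE; rewrite -lt0n (leq_trans _ (mode_index_ge _ _ _))//.
exact: leq_trans j02.
Qed.

Lemma amp_mode par j x : 0 < rho x ->
  nrmc ((coef beta j)%:C%C * zeta par x ^+ (j ^ 2)%N) =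
  coef beta j * Num.sqrt (rho x) ^+ (j ^ 2)%N.
Proof.
by move=> r0; rewrite nrmcM nrmc_real nrmcX nrmc_zeta ger0_norm// expR_ge0.
Qed.

(** The factor [a] in place of the cutoff is arbitrary, so that the estimate serves for [cut] and
    for the derivative of the cutoff alike. *)
Lemma nrmc_mode_le par j (a x0 : R) x : 0 < rho x -> rho x <= 1 -> (j0 <= j)%N ->
  (~ active j0 j (tau beta (rho x)) -> a = 0) -> `|a| <= x0 ->
  nrmc ((a * coef beta j)%:C%C * zeta par x ^+ (j ^ 2)%N) <=
  x0 * (kamp beta j0 * env beta (rho x)).
Proof.
move=> r0 r1 jj0 a0 ax0; rewrite rmorphM -mulrA nrmcM amp_mode// nrmc_real.
have [act|nact] := pselect (active j0 j (tau beta (rho x))).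
  apply: ler_pM => //; last exact: amp_le_env.
  by rewrite mulr_ge0 ?exprn_ge0 ?sqrtr_ge0// expR_ge0.
rewrite a0// normr0 mul0r; apply: mulr_ge0; first exact: le_trans ax0.
by apply: mulr_ge0; [exact: kamp_ge0|exact: env_ge0].
Qed.

Lemma nrmc_block_le par x : 0 < rho x -> rho x <= 1 ->
  nrmc (block par x) <= kamp beta j0 * env beta (rho x).
Proof.
move=> r0 r1; rewrite -[leRHS]mul1r; apply: nrmc_mode_le => //.
- exact: mode_index_ge.
- by move=> /cut_inactive[].
- by rewrite ger0_norm ?cut_ge0 ?cut_le1.
Qed.

(** With beta = (gamma - 1) / 2 the power is |zeta| ^ (- gamma): this is how windows of unit width
    in [tau] produce the exponent gamma. *)
Lemma norm_dtau l x : 0 < rho x ->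
  `|dtau l x| <= 4 * beta * rho x `^ (- beta - 1 / 2).
Proof.
move=> r0; rewrite /dtau !normrM normrN (gtr0_norm beta0) (ger0_norm (powR_ge0 _ _)).
have -> : - beta - 1 / 2 = (- beta - 1) + 1 / 2 :> R by field.
rewrite [in leRHS]powRD; last by rewrite (gt_eqF r0) implybT.
rewrite (_ : 4 * beta * _ = beta * rho x `^ (- beta - 1) * (4 * rho x `^ (1 / 2)));
  last by ring.
rewrite ler_wpM2l ?mulr_ge0 ?powR_ge0 ?(ltW beta0)//.
rewrite mul1r (powR12_sqrt (ltW r0)).
have xs i : i = p \/ i = q -> `|x ord0 i| <= Num.sqrt (rho x).
  move=> ipq; rewrite -sqrtr_sqr ler_sqrt ?rho_ge0//.
  by case: ipq => ->; rewrite ?lerDl ?lerDr sqr_ge0.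
have xs' i (b : bool) : i = p \/ i = q -> `|x ord0 i * b%:R| <= Num.sqrt (rho x).
  by move=> /xs; case: b; rewrite ?mulr1// mulr0 normr0 sqrtr_ge0.
rewrite ger0_norm// (_ : 4 = 2 * 2); last by ring.
rewrite -mulrA ler_wpM2l// (le_trans (ler_normD _ _))// mulr_natl mulr2n.
by apply: lerD; apply: xs'; [left|right].
Qed.

Lemma nrmc_dmode_rad par l x : 0 < rho x -> rho x <= 1 ->
  nrmc (dmode_rad par (mode_at par x) l x) <=
  16 * beta * kamp beta j0 * (rho x `^ (- beta - 1 / 2) * env beta (rho x)).
Proof.
move=> r0 r1; rewrite /dmode_rad mulrAC.
apply: le_trans (@nrmc_mode_le par _ _ (4 * (4 * beta * rho x `^ (- beta - 1 / 2)))
  x r0 r1 _ _ _) _.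
- exact: mode_index_ge.
- by move=> /cut_inactive[_ ->]; rewrite mul0r.
- by rewrite normrM ler_pM ?norm_dcut ?norm_dtau.
- by rewrite le_eqVlt; apply/orP; left; apply/eqP; ring.
Qed.

(** The power contributes j ^ 2 / |zeta|, which on the support is at most of order tau ^ 2 / |zeta|,
    beyond the allowed |zeta| ^ (- gamma). The bound serves for membership in H^1, where [env]
    absorbs every negative power of rho. *)
Lemma nrmc_dmode_ang par x : 0 < rho x -> rho x <= 1 ->
  nrmc (dmode_ang par (mode_at par x) x) <=
  (j0.+1%:R ^+ 2 * kamp beta j0) * (rho x `^ (- (2 * beta) - 1 / 2) * env beta (rho x)).
Proof.
move=> r0 r1; set j := mode_at par x; set t := tau beta (rho x).
have jj0 : (j0 <= j)%N by exact: mode_index_ge.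
have j1 : (0 < j)%N by rewrite (leq_trans _ jj0)// (leq_trans _ j02).
have s0 : 0 < Num.sqrt (rho x) by rewrite sqrtr_gt0.
have t1 : 1 <= t by exact: tau_ge1.
have [act|nact] := pselect (active j0 j t); last first.
  rewrite /dmode_ang; have [-> _] := cut_inactive nact.
  rewrite mul0r mul0r nrmc0; apply: mulr_ge0; apply: mulr_ge0.
  - exact: exprn_ge0.
  - exact: kamp_ge0.
  - exact: powR_ge0.
  - exact: env_ge0.
(* This turns j ^ 2 into tau ^ 2 = rho ^ (- 2 beta). For j = j0 it relies on t >= 1, since [t] may
   be far below [j0]. *)
have jt : (j%:R : R) <= j0.+1%:R * t.
  have tj : t <= j0.+1%:R * t by rewrite ler_peMl ?(le_trans _ t1)// ler1n.
  rewrite -[j0.+1%:R]natr1 mulrDl mul1r; case: act => _ [->|].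
    by rewrite ler_wpDr ?(le_trans _ t1)// ler_peMr.
  have : 1 <= j0%:R * t.
    by rewrite mulr_ege1// ler1n (leq_trans _ j02).
  lra.
have HM := @nrmc_mode_le par j (cut j0 j t) 1 x r0 r1 jj0 _ _.
have {HM} : nrmc ((cut j0 j t * coef beta j)%:C%C * zeta par x ^+ (j ^ 2)%N) <=
    kamp beta j0 * env beta (rho x).
  rewrite -[leRHS]mul1r; apply: HM; first by move=> /(_ act).
  by rewrite ger0_norm ?cut_ge0 ?cut_le1.
have jS : (j ^ 2)%N = (j ^ 2).-1.+1 by rewrite prednK// expn_gt0 j1.
rewrite [in X in X -> _]jS exprS /dmode_ang -/t !nrmcM nrmc_zeta nrmc_nat.
set a := nrmc _; set b := nrmc _ => H.
rewrite powRD; last by rewrite (gt_eqF r0) implybT.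
rewrite powRN [X in _ * (_ * X * _)](_ : _ = (Num.sqrt (rho x))^-1); last first.
  by rewrite powRN mul1r powR12_sqrt ?(ltW r0).
have a0 : 0 <= a by exact: nrmc_ge0.
have b0 : 0 <= b by exact: nrmc_ge0.
have ab : a * b <= kamp beta j0 * env beta (rho x) / Num.sqrt (rho x).
  by rewrite ler_pdivlMr// -mulrA [b * _]mulrC.
have j2 : (j ^ 2)%:R <= j0.+1%:R ^+ 2 * t ^+ 2 :> R.
  by rewrite natrX -exprMn lerXn2r ?nnegrE// mulr_ge0// (le_trans _ t1).
have -> : (rho x `^ (2 * beta))^-1 = t ^+ 2.
  rewrite -powRN /t /tau -powR_mulrn ?powR_ge0// -powRrM; congr (_ `^ _); ring.
rewrite mulrCA (le_trans (ler_pM _ _ j2 ab))// ?mulr_ge0//.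
by rewrite le_eqVlt; apply/orP; left; apply/eqP; ring.
Qed.

Lemma absorb (a : R) : exists2 K, 0 <= K &
  forall r, 0 < r -> r <= 1 -> r `^ (- a) * env beta r <= K.
Proof.
(* Chosen with a <= 2 beta m, so that for r <= 1 the power r ^ (- a) is at most the m-th power of r
   ^ (- 2 beta), to which [expRN_le] applies. *)
pose m := (Num.truncn (a / (2 * beta))).+1.
have b2 : 0 < 2 * beta by rewrite mulr_gt0.
have am : a <= 2 * beta * m%:R.
  by rewrite -ler_pdivrMl// mulrC ltW// truncnS_gt.
exists ((4 * beta) ^+ m * m`!%:R) => [|r r0 r1].
  by rewrite mulr_ge0// exprn_ge0// mulr_ge0// ltW.
have b4 : 0 < 4 * beta by rewrite mulr_gt0.
pose y := r `^ (- (2 * beta)) / (4 * beta).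
have y0 : 0 <= y by rewrite divr_ge0 ?powR_ge0 ?(ltW b4).
apply: (@le_trans _ _ ((4 * beta * y) ^+ m * env beta r)); last first.
  rewrite exprMn -mulrA ler_wpM2l ?exprn_ge0 ?(ltW b4)//; exact: expRN_le.
apply: ler_wpM2r; first exact: env_ge0.
rewrite /y mulrCA mulfV ?gt_eqF// mulr1 -powR_mulrn ?powR_ge0// -powRrM.
by apply: ger_powR; [rewrite r0 r1|lra].
Qed.

Lemma block_lower x : 0 < rho x -> rho x <= 1 -> exists par,
  flat (1 / 2) ^+ 2 * env beta (rho x) <= nrmc (block par x).
Proof.
move=> r0 r1; have t0 : 0 <= tau beta (rho x) by exact: powR_ge0.
have [par [c1 act]] := @cut_lower R j0 (tau beta (rho x)) t0; exists par.
have -> : block par x = (cut j0 (mode_at par x) (tau beta (rho x)))%:C%C *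
    ((coef beta (mode_at par x))%:C%C * zeta par x ^+ (mode_at par x ^ 2)%N).
  by rewrite /block /mode rmorphM mulrA.
rewrite nrmcM amp_mode// nrmc_real.
rewrite (ger0_norm (cut_ge0 _ _ _)); apply: ler_pM => //.
- by rewrite sqr_ge0.
- exact: env_ge0.
- apply: env_le_amp => //; apply: leq_trans (mode_index_ge _ _ _).
  exact: leq_trans j02.
Qed.

Lemma block_true0 x : tau beta (rho x) <= j0%:R -> block true x = 0.
Proof.
move=> tj; rewrite /block /mode.
have -> := cut_index0_le tj.
by rewrite mul0r mul0r.
Qed.

End block.

(** * Modes confined to a cone and a ball *)

Section cut_block.
Context {R : realType} {n : nat} (beta : R) (j0 : nat) (p q : 'I_n).
Implicit Types (x : 'rV[R]_n) (l : 'I_n) (par : bool) (psi : 'rV[R]_n -> R).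

Local Notation e l := (delta_mx ord0 l : 'rV[R]_n).
Local Notation rho := (rho p q).

Lemma smooth_on_sqn (A : set 'rV[R]_n) : open A -> smooth_on A (@sqn R n).
Proof.
by move=> oA; apply: (smooth_on_sum _ oA) => i; exact: (smooth_onX 2 oA (smooth_on_coord i oA)).
Qed.

Lemma continuous_sqn : continuous (@sqn R n).
Proof. by move=> x; exact: (smooth_on_continuous (smooth_on_sqn openT)). Qed.

Lemma is_derive_sqn l x : is_derive x (e l) (@sqn R n) (2 * x ord0 l).
Proof.
have dd := is_derive_sum (fun i : 'I_n => is_derive_sq_coord i l x).
have E : (fun y : 'rV[R]_n => \sum_(i < n) y ord0 i ^+ 2) =
    \sum_(i < n) (fun y : 'rV[R]_n => y ord0 i ^+ 2).
  by apply/funext => y; rewrite fct_sumE.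
rewrite /sqn E; apply: is_derive_eq dd _.
rewrite (bigD1 l)//= eqxx mulr1 big1 ?addr0// => i /negbTE ->.
by rewrite !mulr0.
Qed.

(** The support lies in the cone |x| ^ 2 <= 4 rho, where rho and |x| ^ 2 are comparable and the axis
    zeta = 0 is met only at the origin. A gradient of order 1 / |x| is harmless, being dominated by
    |x| ^ (- gamma) for |x| <= 1. *)
Definition radial_cutoff psi : Prop :=
  [/\ smooth_on [set x | x != 0] psi,
      forall x, 0 <= psi x <= 1,
      forall x, 4 * rho x < sqn x -> psi x = 0,
      forall x, 1 / 2 <= sqn x -> psi x = 0 &
      exists2 K, 0 <= K & forall l x, x != 0 ->
        `|partial l psi x| <= K * sqn x `^ (- (1 / 2))].

Definition cblock psi par x : R[i] := (psi x)%:C%C * block beta j0 p q par x.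

Context (psi : 'rV[R]_n -> R).
Hypothesis pq : p != q.
Hypothesis beta0 : 0 < beta.
Hypothesis j02 : (2 <= j0)%N.
Hypothesis hpsi : radial_cutoff psi.

Let inner := [set x : 'rV[R]_n | 4 * rho x < sqn x].

Lemma open_inner : open inner.
Proof.
have := @open_preimage_gt R n (fun x => sqn x - 4 * rho x) 0.
rewrite /inner (_ : [set x | 0 < _] = [set x | 4 * rho x < sqn x]).
  apply; move=> x; apply: continuousB; first exact: continuous_sqn.
  by apply: continuousM; [exact: cst_continuous|exact: continuous_rho].
by apply/seteqP; split=> x /=; rewrite subr_gt0.
Qed.

Lemma open_outer : open [set x : 'rV[R]_n | 1 / 2 < sqn x].
Proof. exact: (open_preimage_gt (a := 1 / 2) continuous_sqn). Qed.

Lemma cblock_eq0 par x : psi x = 0 -> cblock psi par x = 0.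
Proof. by move=> p0; rewrite /cblock p0 mul0r. Qed.

(** Off the axis the block is smooth, and a point x <> 0 of the axis has a neighbourhood on which
    [psi] vanishes. *)
Lemma csmooth_cblock par : csmooth [set x | x != 0] (cblock psi par).
Proof.
have [spsi _ psi_in _ _] := hpsi.
apply: csmooth_local => x x0.
have [r0|r0] := ltP 0 (rho x).
  have c0 : 0 < rho x / 2 by rewrite divr_gt0.
  have oB := openI (@open_punctured R n) (@open_rho R n p q (rho x / 2)).
  exists ([set x | x != 0] `&` [set y | rho x / 2 < rho y]); split.
    by split=> //=; lra.
  apply: (csmoothM oB).
    by apply: (csmooth_real oB); apply: smooth_onS spsi => y [].
  by apply: (csmoothS _ (@csmooth_block R n beta j0 p q beta0 j02 par _ c0)) => y [].
exists inner; split.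
  by rewrite /inner/=; have := sqn_gt0 x0; lra.
apply: (eq_csmooth open_inner (F := fun=> 0)); last exact: csmooth_cst open_inner.
by move=> y yin; rewrite cblock_eq0// psi_in.
Qed.

Lemma cpartial_cblock0 par l x : inner x \/ 1 / 2 < sqn x ->
  cpartial l (cblock psi par) x = 0.
Proof.
have [_ _ psi_in psi_out _] := hpsi => xin; apply: cpartialE.
apply: (near_is_cderive (F := fun=> 0)); last exact: is_cderive_cst.
case: xin => xin.
  apply: filterS (open_nbhs_nbhs (conj open_inner xin)) => y yin.
  by rewrite cblock_eq0// psi_in.
apply: filterS (open_nbhs_nbhs (conj open_outer xin)) => y yin.
by rewrite cblock_eq0// psi_out// ltW.
Qed.

Definition cblock_rad par l x : R[i] :=
  (partial l psi x)%:C%C * block beta j0 p q par x +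
  (psi x)%:C%C * dmode_rad beta j0 p q par (mode_at beta j0 p q par x) l x.

Definition cblock_ang par x : R[i] :=
  (psi x)%:C%C * dmode_ang beta j0 p q par (mode_at beta j0 p q par x) x.

Lemma cpartial_cblock par l x : x != 0 -> 0 < rho x ->
  cpartial l (cblock psi par) x =
  cblock_rad par l x + cblock_ang par x * (dzeta p q par l : R[i]).
Proof.
move=> x0 r0; have [spsi _ _ _ _] := hpsi; apply: cpartialE.
have dp := is_cderive_real (smooth_on_is_derive l spsi x0).
apply: is_cderive_eq (is_cderiveM dp (is_cderive_block beta0 j02 par l r0)) _.
by rewrite /cblock_rad /cblock_ang mulrDr addrA mulrA.
Qed.

Lemma sqn_le_rho x (a : R) : 0 <= a -> 0 < sqn x -> sqn x <= 4 * rho x ->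
  rho x `^ (- a) <= 4 `^ a * sqn x `^ (- a).
Proof.
move=> a0 s0 sr; have r0 : 0 < rho x by lra.
apply: (@le_trans _ _ ((sqn x / 4) `^ (- a))).
  by apply: le_powRN => //; lra.
rewrite powRM ?invr_ge0 ?(ltW s0)// mulrC ler_wpM2r ?powR_ge0//.
by rewrite -powR_inv1// -powRrM mulN1r opprK.
Qed.

Lemma cblock_rad_le : exists2 K, 0 <= K & forall par l x, x != 0 ->
  sqn x <= 4 * rho x -> sqn x <= 1 ->
  nrmc (cblock_rad par l x) <= K * (sqn x `^ (- beta - 1 / 2) * env beta (rho x)).
Proof.
have [spsi psi01 psi_in psi_out [K K0 dpsi]] := hpsi.
exists (K * kamp beta j0 + 16 * beta * kamp beta j0 * 4 `^ (beta + 1 / 2)).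
  have k0 := kamp_ge0 beta j0.
  by rewrite addr_ge0 ?mulr_ge0 ?powR_ge0// ltW.
move=> par l x x0 sr s1; have s0 := sqn_gt0 x0.
have r0 : 0 < rho x by lra.
have r1 : rho x <= 1 by exact: le_trans (rho_le_sqn pq x) s1.
rewrite /cblock_rad (le_trans (nrmcD _ _))// mulrDl.
rewrite (nrmcM _ (block _ _ _ _ _ _)) (nrmcM _ (dmode_rad _ _ _ _ _ _ _ _)) !nrmc_real.
have pE : - beta - 1 / 2 = - (beta + 1 / 2) by ring.
apply: lerD.
  rewrite -mulrA (mulrCA (kamp _ _)) [leRHS]mulrA.
  apply: ler_pM => //; first exact: nrmc_ge0; last by apply: nrmc_block_le.
  apply: le_trans (dpsi l x x0) _; apply: ler_wpM2l => //.
  by apply: ger_powR; [rewrite s0 s1|have := beta0; lra].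
have /andP[p0 p1] := psi01 x; rewrite (ger0_norm p0) -[leRHS]mul1r.
apply: ler_pM => //; first exact: nrmc_ge0.
apply: le_trans (nrmc_dmode_rad beta0 j02 par l r0 r1) _.
rewrite -[leRHS]mulrA; apply: ler_wpM2l.
  by rewrite !mulr_ge0 ?kamp_ge0// ltW.
rewrite mulrA; apply: ler_wpM2r; first exact: env_ge0.
by rewrite pE; apply: sqn_le_rho => //; have := beta0; lra.
Qed.

Lemma cblock_ang_le : exists2 K, 0 <= K & forall par x, x != 0 ->
  sqn x <= 4 * rho x -> sqn x <= 1 ->
  nrmc (cblock_ang par x) <= K * (sqn x `^ (- (2 * beta) - 1 / 2) * env beta (rho x)).
Proof.
have [spsi psi01 psi_in psi_out [K K0 dpsi]] := hpsi.
exists (j0.+1%:R ^+ 2 * kamp beta j0 * 4 `^ (2 * beta + 1 / 2)).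
  by rewrite !mulr_ge0 ?exprn_ge0 ?kamp_ge0 ?powR_ge0.
move=> par x x0 sr s1; have s0 := sqn_gt0 x0.
have r0 : 0 < rho x by lra.
have r1 : rho x <= 1 by exact: le_trans (rho_le_sqn pq x) s1.
have pE : - (2 * beta) - 1 / 2 = - (2 * beta + 1 / 2) by ring.
rewrite /cblock_ang (nrmcM _ (dmode_ang _ _ _ _ _ _ _)) nrmc_real.
have /andP[p0 p1] := psi01 x; rewrite (ger0_norm p0) -[leRHS]mul1r.
apply: ler_pM => //; first exact: nrmc_ge0.
apply: le_trans (nrmc_dmode_ang beta0 j02 par r0 r1) _.
rewrite -[leRHS]mulrA; apply: ler_wpM2l.
  by rewrite mulr_ge0 ?exprn_ge0 ?kamp_ge0.
rewrite mulrA; apply: ler_wpM2r; first exact: env_ge0.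
by rewrite pE; apply: sqn_le_rho => //; have := beta0; lra.
Qed.

Lemma nrmc_dzeta par l : nrmc (dzeta p q par l : R[i]) <= 2.
Proof.
rewrite (le_trans (nrmc_le_ReIm _))//= normrM sgn_norm mul1r.
by rewrite (_ : 2 = 1 + 1)// lerD//; case: (_ == _); rewrite ?normr1 ?normr0.
Qed.

Lemma nrmc_cblock par x : nrmc (cblock psi par x) <= kamp beta j0 * env beta (sqn x).
Proof.
have [spsi psi01 psi_in psi_out _] := hpsi.
have [p0|p0] := eqVneq (psi x) 0.
  by rewrite (cblock_eq0 par p0) nrmc0; apply: mulr_ge0; [exact: kamp_ge0|exact: env_ge0].
have [->|x0] := eqVneq x 0.
  have z0 : zeta p q par (0 : 'rV[R]_n) = 0 by rewrite /zeta !mxE mulr0.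
  rewrite /cblock (block0 _ j02 z0) mulr0 nrmc0.
  by apply: mulr_ge0; [exact: kamp_ge0|exact: env_ge0].
have s1 : sqn x < 1 / 2 by rewrite ltNge; apply: contra p0 => /psi_out ->.
have sr : sqn x <= 4 * rho x by rewrite leNgt; apply: contra p0 => /psi_in ->.
have s0 := sqn_gt0 x0; have r0 : 0 < rho x by lra.
have rs := rho_le_sqn pq x.
rewrite /cblock (nrmcM _ (block _ _ _ _ _ _)) nrmc_real; have /andP[p0' p1] := psi01 x.
rewrite ger0_norm// -[leRHS]mul1r; apply: ler_pM => //; first exact: nrmc_ge0.
apply: le_trans (nrmc_block_le beta0 j02 par r0 _) _; first by lra.
by apply: ler_wpM2l; [exact: kamp_ge0|exact: le_env].
Qed.

(** Without cancellation: every single partial derivative is bounded, with the larger power that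
    comes from [cblock_ang_le]. This is what [cblock_tame] needs. *)
Lemma cblock_grad_le : exists2 K, 0 <= K & forall par l x, x != 0 ->
  nrmc (cpartial l (cblock psi par) x) <=
  K * (sqn x `^ (- (2 * beta) - 1 / 2) * env beta (sqn x)).
Proof.
have [K K0 HK] := cblock_rad_le; have [L L0 HL] := cblock_ang_le.
exists (K + L * 2); first by rewrite addr_ge0// mulr_ge0.
move=> par l x x0; have s0 := sqn_gt0 x0.
have rhs0 : 0 <= (K + L * 2) * (sqn x `^ (- (2 * beta) - 1 / 2) * env beta (sqn x)).
  by apply: mulr_ge0; [rewrite addr_ge0// mulr_ge0|
    apply: mulr_ge0; [exact: powR_ge0|exact: env_ge0]].
have [xin|sr] := ltP (4 * rho x) (sqn x).
  by rewrite cpartial_cblock0 ?nrmc0//; left.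
have [xout|s1] := ltP (1 / 2) (sqn x).
  by rewrite cpartial_cblock0 ?nrmc0//; right.
have r0 : 0 < rho x by lra.
have s1' : sqn x <= 1 by lra.
have ers : env beta (rho x) <= env beta (sqn x) by apply: le_env => //; exact: rho_le_sqn.
rewrite cpartial_cblock// (le_trans (nrmcD _ _))// mulrDl; apply: lerD.
  apply: le_trans (HK par l x x0 sr s1') _; apply: (ler_wpM2l K0).
  apply: ler_pM; [exact: powR_ge0|exact: env_ge0| |exact: ers].
  have s01 : 0 < sqn x <= 1 by rewrite s0 s1'.
  by apply: (ger_powR s01); have := beta0; lra.
rewrite (nrmcM (cblock_ang par x)) mulrAC; apply: ler_pM; [exact: nrmc_ge0|exact: nrmc_ge0| |exact: nrmc_dzeta].
apply: le_trans (HL par x x0 sr s1') _; apply: (ler_wpM2l L0).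
apply: ler_wpM2l ers; exact: powR_ge0.
Qed.

(* [zeta ^ k] is annihilated by d_p + i d_q, its conjugate by d_p - i d_q. *)
Lemma cblock_dbar_le : exists2 K, 0 <= K & forall par x, x != 0 -> sqn x <= 1 / 2 ->
  nrmc (cpartial p (cblock psi par) x +
        Complex 0 (sgn par) * cpartial q (cblock psi par) x) <=
    K * (sqn x `^ (- beta - 1 / 2) * env beta (rho x)) /\
  forall l, l != p -> l != q ->
  nrmc (cpartial l (cblock psi par) x) <=
    K * (sqn x `^ (- beta - 1 / 2) * env beta (rho x)).
Proof.
have [K K0 HK] := cblock_rad_le.
exists (K * 2); first by rewrite mulr_ge0.
move=> par x x0 s1; have s0 := sqn_gt0 x0.
set B := _ `^ _ * _.
have B0 : 0 <= B by apply: mulr_ge0; [exact: powR_ge0|exact: env_ge0].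
have rhs0 : 0 <= K * 2 * B by apply: mulr_ge0 => //; exact: mulr_ge0.
have [xin|sr] := ltP (4 * rho x) (sqn x).
  rewrite !cpartial_cblock0; [|by left..].
  rewrite mulr0 addr0 nrmc0; split=> // l _ _.
  by rewrite cpartial_cblock0 ?nrmc0//; left.
have r0 : 0 < rho x by lra.
have s1' : sqn x <= 1 by lra.
have Kl l := HK par l x x0 sr s1'.
split=> [|l lp lq].
  rewrite !cpartial_cblock//.
  rewrite (_ : _ + _ = cblock_rad par p x + Complex 0 (sgn par) * cblock_rad par q x).
    rewrite (le_trans (nrmcD _ _))// mulrAC mulr_natr mulr2n lerD//.
    rewrite nrmcM nrmcE/= expr0n add0r sqrtr_sqr sgn_norm mul1r; exact: Kl.
  rewrite /dzeta !eqxx (negbTE pq) eq_sym (negbTE pq) mulr0 mulr1.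
  have E : Complex 0 (sgn par) * Complex 0 (sgn par) = -1 :> R[i].
    apply/eqP; rewrite eq_complex ReM ImM /= !mul0r !mulr0 sub0r addr0 -expr2.
    by rewrite sgn_sq oppr0 !eqxx.
  have -> : Complex false%:R (sgn par * true%:R) = Complex 0 (sgn par) :> R[i].
    by rewrite mulr1.
  rewrite mulrDr [X in _ + (_ + X)]mulrCA E mulrN1 -addrA; congr (_ + _).
  by rewrite addrCA subrr addr0.
rewrite cpartial_cblock// /dzeta [p == l]eq_sym [q == l]eq_sym (negbTE lp) (negbTE lq).
rewrite mulr0 (_ : Complex 0%:R 0 = 0 :> R[i])// mulr0 addr0.
apply: le_trans (Kl l) _; rewrite -mulrA ler_wpM2l// ler_peMl//.
by rewrite (ler_nat _ 1 2).
Qed.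

Lemma cblock_tame par : (n <= 3)%N -> tame (fun x => complex.Re (cblock psi par x)) /\
  tame (fun x => complex.Im (cblock psi par x)).
Proof.
move=> n3; have [s1 s2] := csmooth_cblock par.
have [_ _ _ psi_out _] := hpsi.
have [K K0 HK] := cblock_grad_le.
(* [L] turns the envelope into one power of |x| ^ 2 for the function. [M] absorbs in addition the
   singular power of the gradient bound. The factor 16 below bounds (1 + |x|) ^ m for |x| <= 1 and m
   <= 4. *)
have [L L0 HL] := @absorb R beta beta0 1.
have [M M0 HM] := @absorb R beta beta0 (2 * beta + 1 / 2 + 1).
have fin (a b s v : R) : 0 <= a -> 0 <= b -> 0 <= s -> s <= n%:R * v ->
    a * s * 16 <= 16 * n%:R * (a + b) * v.
  move=> a0 b0 s0 sv; rewrite (_ : 16 * _ * _ * v = (a + b) * (n%:R * v) * 16).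
    by rewrite ler_wpM2r// ler_pM// lerDl.
  by ring.
pose C := 16 * n%:R * (kamp beta j0 * L + K * M).
have k0 := kamp_ge0 beta j0.
have kL0 : 0 <= kamp beta j0 * L by rewrite mulr_ge0.
have KM0 : 0 <= K * M by rewrite mulr_ge0.
have C0 : 0 <= C by rewrite !mulr_ge0// addr_ge0.
have xn1 x : sqn x <= 1 / 2 -> `|x| <= 1.
  move=> s; rewrite -(@expr_le1 _ 2)//; have := norm_sq_le_sqn x; lra.
have pow_le x m : sqn x <= 1 / 2 -> (m <= 4)%N -> (1 + `|x|) ^+ m <= 16.
  move=> s m4; have := xn1 x s => x1.
  apply: (@le_trans _ _ (2 ^+ m)).
    by rewrite lerXn2r ?nnegrE ?addr_ge0//; lra.
  apply: (@le_trans _ _ (2 ^+ 4)); last by lra.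
  by apply: ler_weXn2l => //; lra.
have f_le x : nrmc (cblock psi par x) <= C * `|x| ^+ 2 / (1 + `|x|) ^+ 4.
  have p4 : 0 < (1 + `|x|) ^+ 4 by rewrite exprn_gt0// ltr_pwDl.
  have rhs0 : 0 <= C * `|x| ^+ 2 / (1 + `|x|) ^+ 4.
    by rewrite divr_ge0 ?(ltW p4)// mulr_ge0// sqr_ge0.
  have [s|s] := leP (1 / 2) (sqn x); first by rewrite cblock_eq0 ?nrmc0// psi_out.
  have [->|x0] := eqVneq x 0.
    have z0 : zeta p q par (0 : 'rV[R]_n) = 0 by rewrite /zeta !mxE mulr0.
    rewrite /cblock (block0 _ j02 z0) mulr0 nrmc0.
    by rewrite normr0 expr0n/= mulr0 mul0r.
  have s0 := sqn_gt0 x0; have s1' : sqn x <= 1 by lra.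
  rewrite ler_pdivlMr//.
  apply: (@le_trans _ _ (kamp beta j0 * L * sqn x * 16)).
    apply: ler_pM; [exact: nrmc_ge0|exact: ltW| |by apply: pow_le => //; exact: ltW].
    apply: le_trans (nrmc_cblock par x) _; rewrite -mulrA ler_wpM2l//.
    by rewrite -ler_pdivrMr// mulrC -powR_inv1 ?(ltW s0)//; exact: HL.
  by apply: fin => //; [exact: ltW|exact: sqn_le_norm_sq].
have df_le l x : x != 0 ->
    nrmc (cpartial l (cblock psi par) x) <= C * `|x| / (1 + `|x|) ^+ 3.
  move=> x0; have p3 : 0 < (1 + `|x|) ^+ 3 by rewrite exprn_gt0// ltr_pwDl.
  have rhs0 : 0 <= C * `|x| / (1 + `|x|) ^+ 3.
    by rewrite divr_ge0 ?(ltW p3)// mulr_ge0.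
  have [s|s] := ltP (1 / 2) (sqn x).
    by rewrite cpartial_cblock0 ?nrmc0//; right.
  have s0 := sqn_gt0 x0; have s1' : sqn x <= 1 by lra.
  rewrite ler_pdivlMr//.
  apply: (@le_trans _ _ (K * M * sqn x * 16)).
    apply: ler_pM; [exact: nrmc_ge0|exact: ltW| |exact: pow_le].
    apply: le_trans (HK par l x x0) _; rewrite -mulrA ler_wpM2l//.
    have E : sqn x `^ (- (2 * beta + 1 / 2 + 1)) = sqn x `^ (- (2 * beta) - 1 / 2) / sqn x.
      rewrite -[(sqn x)^-1]powR_inv1 ?(ltW s0)// -powRD; last by rewrite (gt_eqF s0) implybT.
      by congr (_ `^ _); ring.
    by rewrite -ler_pdivrMr// mulrAC -E; exact: HM.
  rewrite /C [kamp _ _ * _ + _]addrC; apply: fin => //; first exact: ltW.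
  apply: le_trans (sqn_le_norm_sq x) _.
  by rewrite ler_wpM2l// expr2 ler_piMr//; exact: xn1.
split; (split; [by []|exists C; split=> //]).
- by move=> x; apply: le_trans (Re_le_nrmc _) (f_le x).
- by move=> l x x0; apply: le_trans (Re_le_nrmc (cpartial l _ x)) (df_le l x x0).
- by move=> x; apply: le_trans (Im_le_nrmc _) (f_le x).
- by move=> l x x0; apply: le_trans (Im_le_nrmc (cpartial l _ x)) (df_le l x x0).
Qed.

End cut_block.

(** * Clifford matrices *)

Section clifford.
Context {R : realType}.
Local Notation C := R[i].
Local Notation I := (Complex 0 1 : C).

Lemma sqrI : I * I = -1.
Proof. by apply/eqP; rewrite eq_complex ReM ImM /= !mul0r mulr0 mulr1 sub0r addr0 oppr0 !eqxx. Qed.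

(** The sign patterns are the four characters of (Z/2)^2, so the system is invertible. It separates
    vectors belonging to the four pairs of eigenvalues of two commuting involutions. *)
Lemma signs4_eq0 (V : lmodType C) (x1 x2 x3 x4 : V) :
  x1 + (x2 + (x3 + x4)) = 0 -> x1 + (- x2 + (- x3 + x4)) = 0 ->
  x1 + (- x2 + (x3 - x4)) = 0 -> x1 + (x2 + (- x3 - x4)) = 0 ->
  [/\ x1 = 0, x2 = 0, x3 = 0 & x4 = 0].
Proof.
have dbl (x : V) : x + x = 0 -> x = 0.
  by move=> /eqP; rewrite -mulr2n -scaler_nat scaler_eq0 pnatr_eq0 => /eqP.
have pm (x y : V) : x + y = 0 -> x - y = 0 -> x = 0 /\ y = 0.
  move=> h1 h2; have : (x + y) + (x - y) = 0 by rewrite h1 h2 addr0.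
  rewrite addrACA subrr addr0 => /dbl x0; split=> //.
  by move: h1; rewrite x0 add0r.
rewrite !addrA => h1 h2 h3 h4.
have [s12 s34] : x1 + x2 = 0 /\ x3 + x4 = 0.
  by apply: pm; [rewrite addrA|rewrite opprD addrA].
have [d12 d34] : x1 - x2 = 0 /\ x3 - x4 = 0.
  by apply: pm; [rewrite addrA|rewrite opprD opprK addrA].
by have [] := pm _ _ s12 d12; have [] := pm _ _ s34 d34; split.
Qed.

Context (a1 a2 a3 a4 : 'M[C]_4).
Hypothesis h11 : a1 * a1 = 1.
Hypothesis h22 : a2 * a2 = 1.
Hypothesis h33 : a3 * a3 = 1.
Hypothesis h44 : a4 * a4 = 1.
Hypothesis h12 : a2 * a1 = - (a1 * a2).
Hypothesis h13 : a3 * a1 = - (a1 * a3).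
Hypothesis h14 : a4 * a1 = - (a1 * a4).
Hypothesis h23 : a3 * a2 = - (a2 * a3).
Hypothesis h24 : a4 * a2 = - (a2 * a4).
Hypothesis h34 : a4 * a3 = - (a3 * a4).

(** [S] plays the part of the spin along the third axis: an involution that commutes with [a3] and
    [a4] and anticommutes with [a1]. *)
Let S : 'M[C]_4 := - I *: (a1 * a2).

Let S12 : S * a1 = - (a1 * S).
Proof. by rewrite /S -scalerAl -scalerAr -mulrA h12 mulrN scalerN. Qed.

Let S3 : S * a3 = a3 * S.
Proof.
rewrite /S -scalerAl -scalerAr; congr (_ *: _).
by rewrite -mulrA -[a2 * a3]opprK -h23 mulrN mulrA -[a1 * a3]opprK -h13 mulNr opprK mulrA.
Qed.

Let S4 : S * a4 = a4 * S.
Proof.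
rewrite /S -scalerAl -scalerAr; congr (_ *: _).
by rewrite -mulrA -[a2 * a4]opprK -h24 mulrN mulrA -[a1 * a4]opprK -h14 mulNr opprK mulrA.
Qed.

Let SS : S * S = 1.
Proof.
rewrite /S -scalerAl -scalerAr scalerA mulrNN sqrI.
by rewrite -mulrA (mulrA a2) h12 mulNr mulrN mulrA mulrA h11 mul1r h22 scaleN1r opprK.
Qed.

Let opp_eq0 m k (X : 'M[C]_(m, k)) : X = - X -> X = 0.
Proof.
move/eqP; rewrite -subr_eq0 opprK -mulr2n -scaler_nat scaler_eq0 pnatr_eq0.
by move/eqP.
Qed.

(** Four times the projection onto the common eigenspace of [S] and [a3] for the eigenvalue 1. *)
Let proj : 'M[C]_4 := (1 + S) * (1 + a3).

(* Conjugation by a1 flips the signs of S and a3, conjugation by a4 that of a3 only. *)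
Let proj_neq0 : proj != 0.
Proof.
apply/eqP => H0.
have H : 1 + S * a3 = - (S + a3).
  apply/eqP; rewrite -subr_eq0 opprK -H0 /proj mulrDl mul1r mulrDr mulr1 addrACA.
  by rewrite [S * a3 + a3]addrC addrACA.
have c1 (X : 'M[C]_4) : X * a1 = - (a1 * X) -> a1 * X * a1 = - X.
  by move=> Xa; rewrite -mulrA Xa mulrN mulrA h11 mul1r.
have H1 : 1 + S * a3 = S + a3.
  have := congr1 (fun X => a1 * X * a1) H.
  rewrite mulrDr mulr1 mulrDl h11 mulrN mulNr mulrDr mulrDl (c1 _ S12) (c1 _ h13).
  rewrite -opprD opprK => <-; congr (_ + _).
  rewrite -mulrA -(mulrA S) h13 mulrN (mulrA S) S12 mulNr opprK -(mulrA a1) mulrA.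
  by rewrite h11 mul1r.
have H2 : 1 + S * a3 = 0.
  by rewrite H1; apply: opp_eq0; rewrite -[RHS]H H1.
have H3 : 1 - S * a3 = 0.
  have := congr1 (fun X => a4 * X * a4) H2.
  rewrite mulr0 mul0r mulrDr mulr1 mulrDl h44 => <-; congr (_ + _).
  have -> : a4 * (S * a3) * a4 = S * (a4 * a3 * a4) by rewrite mulrA -S4 !mulrA.
  by rewrite h34 mulNr -mulrA h44 mulr1 mulrN.
have H4 : (1 : 'M[C]_4) = 0.
  apply: opp_eq0; apply/eqP; rewrite -subr_eq0 opprK; apply/eqP.
  by rewrite -[RHS]H2; congr (_ + _); exact: subr0_eq.
by have := oner_neq0 'M[C]_4; rewrite H4 eqxx.
Qed.

Let S_proj : S * proj = proj.
Proof.
have E : S * (1 + S) = 1 + S by rewrite mulrDr mulr1 SS addrC.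
by rewrite /proj mulrA E.
Qed.

Let a3_proj : a3 * proj = proj.
Proof.
have E : a3 * (1 + S) = (1 + S) * a3 by rewrite mulrDr mulrDl mulr1 mul1r S3.
have E' : a3 * (1 + a3) = 1 + a3 by rewrite mulrDr mulr1 h33 addrC.
by rewrite /proj mulrA E -mulrA E'.
Qed.

Definition mx_rows (rows : seq (seq C)) : 'M[C]_4 :=
  \matrix_(i, k) nth 0 (nth [::] rows i) k.

(* The matrices diag(sigma_j, - sigma_j). *)
Definition weyl1 : 'M[C]_4 :=
  mx_rows [:: [:: 0; 1; 0; 0]; [:: 1; 0; 0; 0]; [:: 0; 0; 0; -1]; [:: 0; 0; -1; 0]].
Definition weyl2 : 'M[C]_4 :=
  mx_rows [:: [:: 0; - I; 0; 0]; [:: I; 0; 0; 0]; [:: 0; 0; 0; I]; [:: 0; 0; - I; 0]].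
Definition weyl3 : 'M[C]_4 :=
  mx_rows [:: [:: 1; 0; 0; 0]; [:: 0; -1; 0; 0]; [:: 0; 0; -1; 0]; [:: 0; 0; 0; 1]].

Definition mx_cols (es : seq 'cV[C]_4) : 'M[C]_4 :=
  \matrix_(i, k) (nth 0 es k) i ord0.

Lemma mx_cols_mulv es (v : 'cV[C]_4) :
  mx_cols es *m v = \sum_(k < 4) v k ord0 *: nth 0 es k.
Proof.
apply/matrixP => i j; rewrite ord1 !mxE summxE.
by apply: eq_bigr => k _; rewrite !mxE mulrC.
Qed.

Lemma mul_mx_cols (a : 'M[C]_4) es (A : 'M[C]_4) :
  (forall k : 'I_4, a *m nth 0 es k = \sum_(l < 4) A l k *: nth 0 es l) ->
  a *m mx_cols es = mx_cols es *m A.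
Proof.
move=> H; apply/matrixP => i k; have := congr1 (fun X : 'cV[C]_4 => X i ord0) (H k).
rewrite !mxE summxE => E.
transitivity (\sum_j a i j * (nth 0 es k) j ord0).
  by apply: eq_bigr => j _; rewrite !mxE.
by rewrite E; apply: eq_bigr => l _; rewrite !mxE mulrC.
Qed.

(** A common eigenvector e1 of [S] and [a3] is sent by 1, a1, a4 and a4 a1 to four vectors whose
    pairs of signs under [S] and [a3] are all different, so they are independent. In this basis the
    Clifford relations dictate the three matrices; [a4] links the two halves of the basis. *)
Lemma weyl_basis : exists P : 'M[C]_4, [/\ P \in unitmx, a1 *m P = P *m weyl1,
  a2 *m P = P *m weyl2 & a3 *m P = P *m weyl3].
Proof.
have [j pj] : exists j, col j proj != 0.
  apply/existsP; apply: contraT => /existsPn H; case/negP: proj_neq0; apply/eqP.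
  apply/matrixP => i j; have /negPn/eqP/matrixP/(_ i ord0) := H j.
  by rewrite !mxE.
pose e1 : 'cV[C]_4 := col j proj.
have mulE (X Y : 'M[C]_4) (v : 'cV[C]_4) : X *m (Y *m v) = (X * Y) *m v by rewrite mulmxA.
have Se1 : S *m e1 = e1 by rewrite /e1 colE mulE S_proj.
have a3e1 : a3 *m e1 = e1 by rewrite /e1 colE mulE a3_proj.
pose e2 := a1 *m e1; pose e3 := a4 *m e1; pose e4 := a4 *m e2.
pose es := [:: e1; e2; e3; e4].
have a1e2 : a1 *m e2 = e1 by rewrite /e2 mulE h11 mul1mx.
have a1e3 : a1 *m e3 = - e4.
  by rewrite /e4 /e3 /e2 !mulE h14 mulNmx opprK.
have a1e4 : a1 *m e4 = - e3.
  by rewrite /e4 mulE -[a1 * a4]opprK -h14 mulNmx -mulE a1e2.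
have a2e1 : a2 *m e1 = I *: e2.
  rewrite -[in LHS]Se1 /S /e2 -scalemxAl -scalemxAr mulE.
  rewrite mulrA h12 mulNr -mulrA h22 mulr1 mulNmx scalerN scaleNr opprK //.
have a2e2 : a2 *m e2 = - I *: e1.
  by rewrite /e2 mulE h12 mulNmx -mulE a2e1 -scalemxAr a1e2 scaleNr.
have a2a4 (v : 'cV[C]_4) : a2 *m (a4 *m v) = - (a4 *m (a2 *m v)).
  by rewrite !mulE h24 mulNmx opprK.
have a3a4 (v : 'cV[C]_4) : a3 *m (a4 *m v) = - (a4 *m (a3 *m v)).
  by rewrite !mulE h34 mulNmx opprK.
have a2e3 : a2 *m e3 = - I *: e4 by rewrite /e3 a2a4 a2e1 -scalemxAr scaleNr.
have a2e4 : a2 *m e4 = I *: e3 by rewrite /e4 a2a4 a2e2 -scalemxAr scaleNr opprK.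
have a3e2 : a3 *m e2 = - e2 by rewrite /e2 mulE h13 mulNmx -mulE a3e1.
have a3e3 : a3 *m e3 = - e3 by rewrite /e3 a3a4 a3e1.
have a3e4 : a3 *m e4 = e4 by rewrite /e4 a3a4 a3e2 mulmxN opprK.
have Se2 : S *m e2 = - e2 by rewrite /e2 mulE S12 mulNmx -mulE Se1.
have Se3 : S *m e3 = e3 by rewrite /e3 mulE S4 -mulE Se1.
have Se4 : S *m e4 = - e4 by rewrite /e4 mulE S4 -mulE Se2 mulmxN.
have e1n : e1 != 0 by [].
have inv_neq0 (a : 'M[C]_4) (v : 'cV[C]_4) : a * a = 1 -> v != 0 -> a *m v != 0.
  move=> aa; apply: contraNneq => av0.
  by rewrite -[v]mul1mx -[1%:M]/(1 : 'M[C]_4) -aa -mulE av0 mulmx0.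
have e2n : e2 != 0 by exact: inv_neq0.
have e3n : e3 != 0 by exact: inv_neq0.
have e4n : e4 != 0 by exact: inv_neq0.
exists (mx_cols es); split.
- rewrite unitmxE unitfE -det_tr; apply/det0P => -[w w0 wP].
  case/negP: w0; pose v := w^T.
  have {wP} : mx_cols es *m v = 0 by rewrite -[RHS]trmx0 -wP trmx_mul trmxK.
  rewrite mx_cols_mulv !big_ord_recl big_ord0 addr0 /=.
  set f1 := v _ _; set f2 := v _ _; set f3 := v _ _; set f4 := v _ _ => H.
  have H3 := congr1 (mulmx a3) H; rewrite !mulmxDr -!scalemxAr mulmx0 a3e1 a3e2 a3e3 a3e4 in H3.
  have HS := congr1 (mulmx S) H; rewrite !mulmxDr -!scalemxAr mulmx0 Se1 Se2 Se3 Se4 in HS.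
  have HS3 := congr1 (mulmx S) H3.
  rewrite !mulmxDr -!scalemxAr mulmx0 !mulmxN Se1 Se2 Se3 Se4 in HS3.
  rewrite !scalerN in H3 HS; rewrite !scalerN !opprK in HS3.
  have [] := signs4_eq0 H H3 HS HS3 => /eqP E1 /eqP E2 /eqP E3 /eqP E4.
  move: E1 E2 E3 E4; rewrite !scaler_eq0.
  rewrite (negbTE e1n) (negbTE e2n) (negbTE e3n) (negbTE e4n) !orbF.
  move=> /eqP E1 /eqP E2 /eqP E3 /eqP E4; apply/eqP/rowP => k; rewrite mxE.
  rewrite -[w]trmxK -/v mxE; case: k => [[|[|[|[|//]]]] kk].
  - by rewrite -E1 /f1; congr (v _ _); exact: val_inj.
  - by rewrite -E2 /f2; congr (v _ _); exact: val_inj.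
  - by rewrite -E3 /f3; congr (v _ _); exact: val_inj.
  - by rewrite -E4 /f4; congr (v _ _); exact: val_inj.
- apply: mul_mx_cols => k; rewrite !big_ord_recl big_ord0 addr0 !mxE.
  by case: k => [[|[|[|[|//]]]] ?] /=; rewrite ?scale0r ?scale1r ?scaleN1r ?addr0 ?add0r.
- apply: mul_mx_cols => k; rewrite !big_ord_recl big_ord0 addr0 !mxE.
  by case: k => [[|[|[|[|//]]]] ?] /=; rewrite ?scale0r ?scale1r ?scaleN1r ?addr0 ?add0r.
- apply: mul_mx_cols => k; rewrite !big_ord_recl big_ord0 addr0 !mxE.
  by case: k => [[|[|[|[|//]]]] ?] /=; rewrite ?scale0r ?scale1r ?scaleN1r ?addr0 ?add0r.
Qed.

End clifford.

(** * Norms of spinors and change of basis *)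

Section spinor_norms.
Context {R : realType} {n N : nat}.
Implicit Types (v : 'cV[R[i]]_N) (M : 'M[R[i]]_N).

Lemma cnormE v : cnorm v = Num.sqrt (\sum_(k < N) nrmc (v k ord0) ^+ 2).
Proof.
rewrite /cnorm; congr Num.sqrt; apply: eq_bigr => k _.
by rewrite nrmcE sqr_sqrtr// addr_ge0 ?sqr_ge0.
Qed.

Lemma cnorm_ge0 v : 0 <= cnorm v. Proof. exact: sqrtr_ge0. Qed.

Lemma nrmc_le_cnorm v k : nrmc (v k ord0) <= cnorm v.
Proof.
rewrite cnormE -(@ler_pXn2r _ 2)// ?nnegrE ?sqrtr_ge0 ?nrmc_ge0//.
rewrite sqr_sqrtr; last by apply: sumr_ge0 => i _; rewrite exprn_ge0 ?nrmc_ge0.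
by rewrite (bigD1 k)//= lerDl; apply: sumr_ge0 => i _; rewrite exprn_ge0 ?nrmc_ge0.
Qed.

Lemma cnorm_le_sum v : cnorm v <= \sum_(k < N) nrmc (v k ord0).
Proof.
have s0 : 0 <= \sum_(k < N) nrmc (v k ord0).
  by apply: sumr_ge0 => i _; exact: nrmc_ge0.
rewrite cnormE -(@ler_pXn2r _ 2)// ?nnegrE ?sqrtr_ge0//.
rewrite sqr_sqrtr; last by apply: sumr_ge0 => i _; rewrite exprn_ge0 ?nrmc_ge0.
rewrite expr2 mulr_suml; apply: ler_sum => k _; rewrite expr2 ler_wpM2l ?nrmc_ge0//.
by rewrite (bigD1 k)//= lerDl; apply: sumr_ge0 => i _; exact: nrmc_ge0.
Qed.

Lemma nrmc_sum (I : Type) (r : seq I) (F : I -> R[i]) :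
  nrmc (\sum_(i <- r) F i) <= \sum_(i <- r) nrmc (F i).
Proof.
elim: r => [|i r IH]; first by rewrite !big_nil nrmc0.
by rewrite !big_cons (le_trans (nrmcD _ _))// lerD2l.
Qed.

Lemma mulmx_bound M : exists2 K, 0 <= K & forall v B, (forall k, nrmc (v k ord0) <= B) ->
  cnorm (M *m v) <= K * B.
Proof.
exists (\sum_(k < N) \sum_(l < N) nrmc (M k l)).
  by apply: sumr_ge0 => i _; apply: sumr_ge0 => j _; exact: nrmc_ge0.
move=> v B vB; apply: le_trans (cnorm_le_sum _) _.
rewrite mulr_suml; apply: ler_sum => k _; rewrite mxE mulr_suml.
apply: le_trans (nrmc_sum _ _) _; apply: ler_sum => l _.
by rewrite nrmcM ler_wpM2l ?nrmc_ge0.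
Qed.

Lemma dirac_change_basis (alpha : 'I_n.+1 -> 'M[R[i]]_N) (A : 'I_n -> 'M[R[i]]_N) M
    (F : 'rV[R]_n -> 'cV[R[i]]_N) x (D : 'I_n -> 'cV[R[i]]_N) :
  (forall j, alpha (widen_ord (leqnSn n) j) *m M = M *m A j) ->
  (forall j k, is_cderive j (fun y => F y k ord0) x (D j k ord0)) ->
  dirac_op alpha (fun y => M *m F y) x =
  M *m (- Complex 0 1 *: \sum_(j < n) A j *m D j).
Proof.
move=> aM dF; rewrite /dirac_op -scalemxAr mulmx_sumr; congr (_ *: _).
apply: eq_bigr => j _; rewrite mulmxA -aM -mulmxA; congr (_ *m _).
apply/matrixP => k i; rewrite ord1 mxE.
have : is_cderive j (fun y => (M *m F y) k ord0) x ((M *m D j) k ord0).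
  rewrite mxE (_ : (fun y => _) = (fun y => \sum_l M k l * F y l ord0)).
    apply: is_cderive_sum => l.
    apply: is_cderive_eq (is_cderiveM (is_cderive_cst j (M k l) x) (dF j l)) _.
    by rewrite mul0r add0r.
  by apply/funext => y; rewrite mxE.
by move=> /cpartialE <-.
Qed.

End spinor_norms.

(** * Reduction of the theorem to bounds on components *)

Section assemble.
Context {R : realType}.

Lemma enormE n (x : 'rV[R]_n) : enorm x = Num.sqrt (sqn x).
Proof. by []. Qed.

Lemma tame_mulmx n N (M : 'M[R[i]]_N) (F : 'rV[R]_n -> 'cV[R[i]]_N) k :
  (forall l, tame (fun x => complex.Re (F x l ord0)) /\
             tame (fun x => complex.Im (F x l ord0))) ->
  tame (re_part (fun x => M *m F x) k) /\ tame (im_part (fun x => M *m F x) k).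
Proof.
move=> tF.
have tame0 : tame (fun _ : 'rV[R]_n => (0 : R)).
  split; first exact: (smooth_on_cst 0 (@open_punctured R n)).
  exists 0; split=> // [x|j x x0]; first by rewrite normr0 !mul0r.
  by rewrite (partialE (is_derive_cst (0 : R) x (delta_mx ord0 j))) normr0 !mul0r.
have tsum (r : seq 'I_N) (f : 'I_N -> 'rV[R]_n -> R) : (forall l, tame (f l)) ->
    tame (fun x => \sum_(l <- r) f l x).
  move=> tf; elim: r => [|l r IH].
    by rewrite (_ : (fun x => _) = fun=> 0)//; apply/funext => x; rewrite big_nil.
  rewrite (_ : (fun x => _) = fun x => f l x + \sum_(l <- r) f l x).
    exact: (tameD (tf l) IH).
  by apply/funext => x; rewrite big_cons.
split.
  rewrite (_ : re_part _ _ = fun x => \sum_l (complex.Re (M k l) * complex.Re (F x l ord0) +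
     - complex.Im (M k l) * complex.Im (F x l ord0))).
    by apply: tsum => l; have [t1 t2] := tF l; exact: (tameD (tameZ _ t1) (tameZ _ t2)).
  apply/funext => x; rewrite /re_part mxE raddf_sum; apply: eq_bigr => l _.
  by rewrite [LHS]ReM mulNr.
rewrite (_ : im_part _ _ = fun x => \sum_l (complex.Re (M k l) * complex.Im (F x l ord0) +
   complex.Im (M k l) * complex.Re (F x l ord0))).
  by apply: tsum => l; have [t1 t2] := tF l; exact: (tameD (tameZ _ t2) (tameZ _ t1)).
by apply/funext => x; rewrite /im_part mxE raddf_sum; apply: eq_bigr => l _; exact: ImM.
Qed.

Definition ctame n (f : 'rV[R]_n -> R[i]) : Prop :=
  tame (fun x => complex.Re (f x)) /\ tame (fun x => complex.Im (f x)).

Lemma ctameD n (f g : 'rV[R]_n -> R[i]) : ctame f -> ctame g -> ctame (fun x => f x + g x).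
Proof.
move=> [f1 f2] [g1 g2]; split.
  rewrite (_ : (fun x => _) = fun x => complex.Re (f x) + complex.Re (g x)).
    exact: tameD f1 g1.
  by apply/funext => x; rewrite raddfD.
rewrite (_ : (fun x => _) = fun x => complex.Im (f x) + complex.Im (g x)).
  exact: tameD f2 g2.
by apply/funext => x; rewrite raddfD.
Qed.

Lemma ctameN n (f : 'rV[R]_n -> R[i]) : ctame f -> ctame (fun x => - f x).
Proof.
move=> [f1 f2]; split.
  rewrite (_ : (fun x => _) = fun x => -1 * complex.Re (f x)); first exact: tameZ f1.
  by apply/funext => x; rewrite raddfN mulN1r.
rewrite (_ : (fun x => _) = fun x => -1 * complex.Im (f x)); first exact: tameZ f2.
by apply/funext => x; rewrite raddfN mulN1r.
Qed.

(** The conclusion of the theorem with the number [N] of components left free, so that 2 and 4 can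
    stand in for [spinor_dim n]. *)
Definition vanishing_solution n N (alpha : 'I_n.+1 -> 'M[R[i]]_N) (gamma : R) : Prop :=
  exists (u : 'rV[R]_n -> 'cV[R[i]]_N) (C1 C2 C3 : R),
    [/\ spinor_H1 u,
        spinor_smooth_on [set x | x != 0] u,
        (exists2 x, x != 0 & u x != 0),
        [/\ 0 < C1, 0 < C2 & 0 < C3] &
        forall x : 'rV[R]_n, x != 0 ->
          cnorm (u x) <= C1 * expR (- (C2 / enorm x `^ (2 * gamma - 2))) /\
          cnorm (dirac_op alpha u x) <=
            if n == 2%N then C3 * enorm x `^ (- gamma) * cnorm (u x)
            else C3 * enorm x `^ (- gamma) * `|ln (enorm x)| ^+ 3 * cnorm (u x)].

(** What has to be shown in a convenient basis. [E] is a common yardstick: the Dirac errors are at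
    most |x| ^ (- gamma) times [E] up to a constant, and some component is at least a constant times
    [E]. Since [M] is invertible, passing to the basis and back costs constants only. *)
Lemma vanishing_solution_of_comp (n N : nat) (alpha : 'I_n.+1 -> 'M[R[i]]_N) (gamma : R)
    (M : 'M[R[i]]_N) (A : 'I_n -> 'M[R[i]]_N) (f : 'I_N -> 'rV[R]_n -> R[i])
    (E : 'rV[R]_n -> R) (C K kappa B : R) :
  (0 < n <= 3)%N -> 1 < gamma -> M \in unitmx ->
  (forall j, alpha (widen_ord (leqnSn n) j) *m M = M *m A j) ->
  (forall l, ctame (f l)) ->
  0 < C -> 0 < kappa -> 0 <= K -> (forall x, 0 < E x) ->
  let D k x := \sum_(j < n) \sum_(l < N) A j k l * cpartial j (f l) x in
  (forall x, x != 0 -> sqn x <= 1 / 2 -> forall k,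
    nrmc (D k x) <= K * (sqn x `^ (- (gamma / 2)) * E x)) ->
  (forall x, x != 0 -> sqn x <= 1 / 2 -> exists k, kappa * E x <= nrmc (f k x)) ->
  (forall x, x != 0 -> 1 / 2 < sqn x -> forall k, D k x = 0) ->
  (forall x, x != 0 -> forall k,
    nrmc (f k x) <= B * expR (- (C / sqn x `^ (gamma - 1)))) ->
  vanishing_solution alpha gamma.
Proof.
case: n alpha A f E => // n alpha A f E /andP[_ n3] g1 uM aM tf C0 kappa0 K0 E0 D DK' FE' D0' FB'.
pose F x : 'cV[R[i]]_N := \col_k f k x.
pose DF x := - Complex 0 1 *: \sum_(j < n.+1) A j *m spinor_partial j F x.
have Ff k : (fun x => F x k ord0) = f k by apply/funext => x; rewrite mxE.
have DE x k : DF x k ord0 = - Complex 0 1 * D k x.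
  rewrite mxE summxE; congr (_ * _); apply: eq_bigr => j _; rewrite mxE.
  apply: eq_bigr => l _; rewrite mxE; congr (_ * _).
  by rewrite -[LHS]/(cpartial j (fun y => F y l ord0) x) Ff.
have tF l : tame (fun x => complex.Re (F x l ord0)) /\
    tame (fun x => complex.Im (F x l ord0)).
  by have := tf l; rewrite -Ff.
have DK x : x != 0 -> sqn x <= 1 / 2 -> forall k,
    nrmc (DF x k ord0) <= K * (sqn x `^ (- (gamma / 2)) * E x).
  move=> x0 s1 k; rewrite DE (nrmcM _ (D k x)) nrmcN nrmcE /= expr0n expr1n add0r sqrtr1 mul1r.
  exact: DK'.
have FE x : x != 0 -> sqn x <= 1 / 2 -> exists k, kappa * E x <= nrmc (F x k ord0).
  by move=> x0 s1; have [k Hk] := FE' x x0 s1; exists k; rewrite mxE.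
have D0 x : x != 0 -> 1 / 2 < sqn x -> DF x = 0.
  by move=> x0 s1; apply/matrixP => k i; rewrite ord1 DE D0'// mulr0 mxE.
have FB x : x != 0 -> forall k, nrmc (F x k ord0) <= B * expR (- (C / sqn x `^ (gamma - 1))).
  by move=> x0 k; rewrite mxE; exact: FB'.
(* A point of the ball sqn <= 1 / 2, where the lower bound shows that the solution is not zero. *)
pose x1 : 'rV[R]_n.+1 := 2^-1 *: delta_mx ord0 ord0.
have sx1 : sqn x1 = 4^-1.
  rewrite /sqn (bigD1 ord0)//= big1 => [|i /negbTE i0].
    by rewrite !mxE/= mulr1 addr0; field.
  by rewrite !mxE/= i0 mulr0 expr0n.
have x10 : x1 != 0.
  by apply: contra_eqN sx1 => /eqP ->; rewrite /sqn big1 => [|i _]; rewrite ?mxE ?expr0n//; lra.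
have Fx1 : F x1 != 0.
  have [|k] := FE x1 x10; first by rewrite sx1; lra.
  apply: contraTneq => ->; rewrite mxE nrmc0 -ltNge; exact: mulr_gt0.
have [L L0 HL] := mulmx_bound M.
have [L' L'0 HL'] := mulmx_bound (invmx M).
pose u x := M *m F x.
have tu k := @tame_mulmx n.+1 N M F k tF.
have Fu x k : nrmc (F x k ord0) <= L' * cnorm (u x).
  have -> : F x = invmx M *m u x by rewrite /u mulmxA mulVmx// mul1mx.
  apply: le_trans (nrmc_le_cnorm _ k) _; apply: HL' => l; exact: nrmc_le_cnorm.
have Du x : x != 0 -> dirac_op alpha u x = M *m DF x.
  move=> x0; apply: dirac_change_basis aM _ => j k.
  have [[s1 _] [s2 _]] := tF k.
  rewrite mxE; exact: (csmooth_is_cderive j (conj s1 s2) x0).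
have Lk0 : 0 <= L' / kappa by rewrite divr_ge0// ltW.
pose K' := L * K * (L' / kappa).
have K'0 : 0 <= K' by apply: mulr_ge0 Lk0; exact: mulr_ge0.
have epow (x : 'rV[R]_n.+1) (p : R) : x != 0 -> enorm x `^ p = sqn x `^ (p / 2).
  move=> x0; rewrite enormE -powR12_sqrt ?sqn_ge0// -powRrM; congr (_ `^ _).
  by rewrite mulrC.
have main (x : 'rV[R]_n.+1) : x != 0 -> sqn x <= 1 / 2 ->
    cnorm (dirac_op alpha u x) <= K' * enorm x `^ (- gamma) * cnorm (u x).
  move=> x0 s1; rewrite Du//; have [k Ek] := FE x x0 s1.
  have Eu : E x <= L' / kappa * cnorm (u x).
    by rewrite mulrAC ler_pdivlMr// mulrC (le_trans Ek).
  apply: le_trans (HL _ _ (fun k => DK x x0 s1 k)) _.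
  rewrite epow// mulNr /K' -!mulrA ler_wpM2l// ler_wpM2l//.
  have P0 : 0 <= sqn x `^ (- (gamma / 2)) by exact: powR_ge0.
  apply: le_trans (ler_wpM2l P0 Eu) _.
  by rewrite le_eqVlt; apply/orP; left; apply/eqP; ring.
(* For sqn x <= 1 / 2 the absolute value of ln |x| is at least [l2], so the logarithmic factor can
   be inserted at the price of a constant. *)
pose l2 := ln 2 / 2 : R.
have l20 : 0 < l2 by rewrite divr_gt0// ln_gt0// ltr1n.
have logl (x : 'rV[R]_n.+1) : x != 0 -> sqn x <= 1 / 2 -> 1 <= (`|ln (enorm x)| / l2) ^+ 3.
  move=> x0 s1; rewrite exprn_ege1// ler_pdivlMr// mul1r.
  have -> : ln (enorm x) = ln (sqn x) / 2.
    by rewrite enormE -powR12_sqrt ?sqn_ge0// ln_powR mulrC.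
  have ls : ln (sqn x) <= - ln 2.
    rewrite -lnV ?posrE// ler_ln ?posrE ?invr_gt0 ?sqn_gt0//; lra.
  by rewrite ler_normr; apply/orP; right; rewrite /l2; lra.
exists u, (L * `|B| + 1), C, (K' + K' / l2 ^+ 3 + 1); split.
- by move=> k; have [t1 t2] := tu k; split; exact: tame_sobolev.
- by move=> k; have [[s1 _] [s2 _]] := tu k; split.
- exists x1 => //; apply: contraNneq Fx1 => ux0; apply/eqP.
  by rewrite -[LHS]mul1mx -(mulVmx uM) -mulmxA -/(u x1) ux0 mulmx0.
- split=> //; first by rewrite ltr_wpDl// mulr_ge0.
  by rewrite ltr_wpDl// addr_ge0// divr_ge0// exprn_ge0// ltW.
move=> x x0; split.
  have -> : enorm x `^ (2 * gamma - 2) = sqn x `^ (gamma - 1).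
    by rewrite epow//; congr (_ `^ _); lra.
  apply: le_trans (HL _ _ (FB x x0)) _; rewrite mulrA ler_wpM2r ?expR_ge0//.
  by rewrite ler_wpDr// ler_wpM2l// ler_norm.
have p0 : 0 <= enorm x `^ (- gamma) by exact: powR_ge0.
have Kl0 : 0 <= K' / l2 ^+ 3 by rewrite divr_ge0// exprn_ge0// ltW.
have [s1|s1] := leP (sqn x) (1 / 2); last first.
  rewrite Du// D0// mulmx0.
  have -> : cnorm (0 : 'cV[R[i]]_N) = 0.
    rewrite cnormE big1 ?sqrtr0// => k _.
    by rewrite mxE nrmc0 expr0n.
  by case: ifP => _; rewrite !mulr_ge0 ?cnorm_ge0 ?exprn_ge0// !addr_ge0.
apply: le_trans (main x x0 s1) _; case: ifP => _.
  rewrite ler_wpM2r ?cnorm_ge0// ler_wpM2r//; lra.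
rewrite ler_wpM2r ?cnorm_ge0// [leRHS]mulrAC ler_wpM2r//.
apply: (@le_trans _ _ (K' * (`|ln (enorm x)| / l2) ^+ 3)).
  by rewrite ler_peMr// logl.
rewrite expr_div_n mulrCA mulrC ler_wpM2r ?exprn_ge0//.
by lra.
Qed.

End assemble.

(** * Radial pieces *)

Section radial.
Context {R : realType} {n : nat}.
Implicit Types (x : 'rV[R]_n) (l p q k : 'I_n) (m : R) (a f : 'rV[R]_n -> R) (A : set 'rV[R]_n).

Local Notation e l := (delta_mx ord0 l : 'rV[R]_n).

Lemma smooth_on_flat A f : open A -> smooth_on A f -> smooth_on A (fun x => flat (f x)).
Proof. by move=> oA; exact: (smooth_on_comp oA smooth1_flat (fun _ _ => Logic.I)). Qed.

Lemma smooth_on_step A f : open A -> smooth_on A f -> smooth_on A (fun x => step (f x)).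
Proof.
move=> oA sf; apply: (smooth_on_flat oA).
exact: (smooth_onB oA (smooth_on_cst (flat 1) oA) (smooth_on_flat oA sf)).
Qed.

Lemma smooth_on_sqn_powR (r : R) : smooth_on [set x : 'rV[R]_n | x != 0] (fun x => sqn x `^ r).
Proof.
have oP := @open_punctured R n.
by apply: (smooth_on_comp oP (smooth1_powR r) _ (smooth_on_sqn oP)) => x; exact: sqn_gt0.
Qed.

Lemma sqn_half_sq x : sqn x `^ (1 / 2) ^+ 2 = sqn x.
Proof.
rewrite -(powR_mulrn 2 (powR_ge0 _ _)) -powRrM (_ : 1 / 2 * 2%:R = 1) ?powRr1 ?sqn_ge0//.
by field.
Qed.

Lemma norm_coord_le x l : `|x ord0 l| <= sqn x `^ (1 / 2).
Proof.
rewrite -(@ler_pXn2r _ 2)// ?nnegrE ?powR_ge0// real_normK ?num_real//.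
by rewrite sqn_half_sq; exact: sqn_coord.
Qed.

Lemma sqn_powRD x (r s : R) : x != 0 -> sqn x `^ (r + s) = sqn x `^ r * sqn x `^ s.
Proof. by move=> /sqn_gt0 s0; rewrite powRD// (gt_eqF s0) implybT. Qed.

(** Arranged with [outer_cutoff] so that at every radius one of the two equals [step0]: this one for
    sqn <= 1 / 4, the other from there on. The transition zones, 1 / 4 to 1 / 2 here and 1 / 8 to 1
    / 4 there, do not overlap. *)
Definition inner_cutoff x : R := step (4 * sqn x - 1).

Definition outer_cutoff x : R := step (2 - 8 * sqn x).

Lemma is_derive_inner_cutoff l x :
  is_derive x (e l) inner_cutoff (dstep (4 * sqn x - 1) * (8 * x ord0 l)).
Proof.
have d1 := is_deriveB (is_deriveZ 4 (is_derive_sqn l x)) (is_derive_cst (1 : R) x (e l)).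
have d2 := is_derive_comp1 d1 (is_derive_step (4 * sqn x - 1)).
by apply: is_derive_eq d2 _; rewrite /GRing.scale/=; ring.
Qed.

Lemma radial_cutoffM p q a (K : R) : 0 <= K ->
  smooth_on [set x | x != 0] a -> (forall x, 0 <= a x <= 1) ->
  (forall x, 4 * rho p q x < sqn x -> a x = 0) ->
  (forall l x, x != 0 -> `|partial l a x| <= K * sqn x `^ (- (1 / 2))) ->
  radial_cutoff p q (fun x => inner_cutoff x * a x).
Proof.
move=> K0 sa a01 a0 da; have oP := @open_punctured R n.
have st : smooth_on [set x | x != 0] inner_cutoff.
  apply: (smooth_on_step oP); apply: (smooth_onB oP _ (smooth_on_cst 1 oP)).
  exact: (smooth_onM oP (smooth_on_cst 4 oP) (smooth_on_sqn oP)).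
split.
- exact: (smooth_onM oP st sa).
- move=> x; have /andP[a1 a2] := a01 x.
  by rewrite mulr_ge0 ?mulr_ile1 ?step_ge0 ?step_le1.
- by move=> x /a0 ->; rewrite mulr0.
- by move=> x s1; rewrite /inner_cutoff step_ge1 ?mul0r//; lra.
exists (32 + K); first by rewrite addr_ge0.
move=> l x x0; have s0 := sqn_gt0 x0.
have dd : is_derive x (e l) (fun y => inner_cutoff y * a y) (inner_cutoff x * partial l a x +
    a x * (dstep (4 * sqn x - 1) * (8 * x ord0 l))).
  exact: (is_deriveM (is_derive_inner_cutoff l x) (smooth_on_is_derive l sa x0)).
rewrite (partialE dd) (le_trans (ler_normD _ _))// [leRHS]mulrDl addrC.
have /andP[a1 a2] := a01 x.
apply: lerD.
  rewrite mulrC normrM mulrC (ger0_norm a1) -[leRHS]mul1r.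
  apply: ler_pM => //; rewrite normrM.
  have [s|s] := leP (1 / 2) (sqn x).
    by rewrite dstep_ge1 ?normr0 ?mul0r ?mulr_ge0 ?powR_ge0//; lra.
  rewrite (_ : 32 = 4 * 8); last by ring.
  rewrite -mulrA; apply: ler_pM => //; first exact: norm_dstep.
  rewrite normrM ger0_norm// ler_wpM2l//.
  apply: le_trans (norm_coord_le x l) _; apply: ger_powR; first by rewrite s0; lra.
  by lra.
rewrite normrM (ger0_norm (x := inner_cutoff x) (step_ge0 _)) -[leRHS]mul1r.
by apply: ler_pM => //; [exact: step_ge0|exact: step_le1|exact: da].
Qed.

(** Homogeneous of degree 0, hence with a gradient of order 1 / |x|. It is at least flat (1 / 2)
    where |x_p| >= |x_k|. When x_k is the coordinate left out of rho, it vanishes for 4 rho < |x| ^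
    2. *)
Definition sector p k x : R := flat (1 / 2 + (x ord0 p ^+ 2 - x ord0 k ^+ 2) / sqn x).

Lemma smooth_on_sector p k : smooth_on [set x | x != 0] (sector p k).
Proof.
have oP := @open_punctured R n.
apply: (smooth_on_flat oP); apply: (smooth_onD oP (smooth_on_cst (1 / 2) oP)).
apply: (eq_smooth_on oP (f := fun x => (x ord0 p ^+ 2 - x ord0 k ^+ 2) * sqn x `^ (-1))).
  by move=> x x0; rewrite powR_inv1// sqn_ge0.
apply: (smooth_onM oP _ (smooth_on_sqn_powR (-1))).
exact: (smooth_onB oP (smooth_onX 2 oP (smooth_on_coord p oP))
  (smooth_onX 2 oP (smooth_on_coord k oP))).
Qed.

Lemma partial_sector_le p k l x : x != 0 ->
  `|partial l (sector p k) x| <= 12 * sqn x `^ (- (1 / 2)).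
Proof.
move=> x0; have s0 := sqn_gt0 x0.
pose g (y : 'rV[R]_n) : R := (y ord0 p ^+ 2 - y ord0 k ^+ 2) * sqn y `^ (-1).
pose dg : R := (2 * (x ord0 p * (p == l)%:R) - 2 * (x ord0 k * (k == l)%:R)) * sqn x `^ (-1)
  - (x ord0 p ^+ 2 - x ord0 k ^+ 2) * (sqn x `^ (-2) * (2 * x ord0 l)).
have dgx : is_derive x (e l) g dg.
  have d1 := is_deriveB (is_derive_sq_coord p l x) (is_derive_sq_coord k l x).
  have d2 := is_derive_comp1 (is_derive_sqn l x) (is_derive1_powR (-1) s0).
  have dd := is_deriveM d1 d2; apply: is_derive_eq dd _.
  rewrite /dg /GRing.scale/= (_ : - 1 - 1 = -2 :> R); last by ring.
  rewrite -[(_ - _) x]/(x ord0 p ^+ 2 - x ord0 k ^+ 2).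
  by ring.
have dh := is_deriveD (is_derive_cst (1 / 2 : R) x (e l)) dgx.
have df := is_derive_comp1 dh (is_derive_flat (1 / 2 + g x)).
have E : sector p k = flat \o (cst (1 / 2) + g).
  by apply/funext => y; rewrite /sector -[RHS]/(flat (1 / 2 + g y)) /g powR_inv1 ?sqn_ge0.
rewrite E (partialE df) add0r normrM (_ : 12 = 2 * 6); last by ring.
rewrite -mulrA; apply: ler_pM => //; first exact: norm_dflat.
set S := sqn x `^ (1 / 2).
have S0 : 0 <= S by exact: powR_ge0.
have c i : `|x ord0 i| <= S by exact: norm_coord_le.
have b01 (b : bool) : `|b%:R : R| <= 1 by case: b; rewrite ?normr1 ?normr0.
have cb i (b : bool) : `|x ord0 i * b%:R| <= S.
  by rewrite normrM -[leRHS]mulr1 ler_pM.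
have V1 : sqn x `^ (-1) = (sqn x)^-1 by rewrite powR_inv1 ?sqn_ge0.
have V2 : sqn x `^ (-2) = (sqn x)^-1 * (sqn x)^-1.
  by rewrite (_ : -2 = -1 + -1) ?sqn_powRD// ?V1//; ring.
have H : sqn x `^ (- (1 / 2)) = S * (sqn x)^-1.
  by rewrite (_ : - (1 / 2) = 1 / 2 + -1) ?sqn_powRD// ?V1//; field.
have sq : `|x ord0 p ^+ 2 - x ord0 k ^+ 2| <= sqn x.
  have := sqn_coord x p; have := sqn_coord x k.
  have := sqr_ge0 (x ord0 p); have := sqr_ge0 (x ord0 k).
  by move=> h1 h2 h3 h4; rewrite ler_norml; apply/andP; split; lra.
rewrite H /dg V1 V2 (le_trans (ler_normB _ _))//.
rewrite (_ : 6 * _ = (2 * S + 2 * S) * (sqn x)^-1 + sqn x * ((sqn x)^-1 * (sqn x)^-1 * (2 * S))).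
  apply: lerD.
    rewrite normrM (ger0_norm (x := _^-1)) ?invr_ge0 ?(ltW s0)//.
    rewrite ler_wpM2r ?invr_ge0 ?(ltW s0)// (le_trans (ler_normB _ _))//.
    by rewrite !(normrM 2) !(ger0_norm (x := 2))// lerD// ler_wpM2l.
  rewrite normrM; apply: ler_pM => //; rewrite normrM ger0_norm; last first.
    by rewrite mulr_ge0 ?invr_ge0 ?(ltW s0).
  rewrite ler_wpM2l ?mulr_ge0 ?invr_ge0 ?(ltW s0)//.
  by rewrite normrM ger0_norm// ler_wpM2l.
by field; rewrite gt_eqF.
Qed.

Lemma radial_cutoff_sector p q k : (forall x, sqn x = rho p q x + x ord0 k ^+ 2) ->
  radial_cutoff p q (fun x => inner_cutoff x * sector p k x).
Proof.
move=> sE; apply: (@radial_cutoffM p q _ 12) => //.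
- exact: smooth_on_sector.
- by move=> x; rewrite flat_ge0 flat_le1.
- move=> x rs; have r0 := rho_ge0 p q x; have s0 : 0 < sqn x by lra.
  rewrite /sector flat0// -(ler_pM2r s0) mul0r mulrDl divfK ?gt_eqF//.
  have : x ord0 p ^+ 2 <= rho p q x by rewrite lerDl sqr_ge0.
  by have := sE x; lra.
- by move=> l x; exact: partial_sector_le.
Qed.

Definition rad (m : R) x : R := outer_cutoff x * sqn x `^ (- m).

Definition drad (m : R) x : R :=
  - 8 * dstep (2 - 8 * sqn x) * sqn x `^ (- m) - m * sqn x `^ (- m - 1) * outer_cutoff x.

(* The left side is what the Dirac operator makes of [rad m] times a homogeneous
   solution; only the derivative of the cutoff survives. *)
Lemma rad_euler (m : R) x : x != 0 ->
  2 * drad m x * sqn x + 2 * m * rad m x =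
  - 16 * dstep (2 - 8 * sqn x) * sqn x `^ (1 - m).
Proof.
move=> x0; have s0 := sqn_gt0 x0.
have V : sqn x `^ (- m) = sqn x `^ (- m - 1) * sqn x.
  by rewrite -[X in _ * X]powRr1 ?sqn_ge0// -sqn_powRD//; congr (_ `^ _); ring.
have W : sqn x `^ (1 - m) = sqn x `^ (- m) * sqn x.
  by rewrite -[X in _ * X]powRr1 ?sqn_ge0// -sqn_powRD//; congr (_ `^ _); ring.
by rewrite W /drad /rad V; ring.
Qed.

Lemma is_derive_rad m l x : x != 0 -> is_derive x (e l) (rad m) (drad m x * (2 * x ord0 l)).
Proof.
move=> x0; have s0 := sqn_gt0 x0.
have d1 := is_deriveB (is_derive_cst (2 : R) x (e l)) (is_deriveZ 8 (is_derive_sqn l x)).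
have d2 := is_derive_comp1 d1 (is_derive_step (2 - 8 * sqn x)).
have d3 := is_derive_comp1 (is_derive_sqn l x) (is_derive1_powR (- m) s0).
have dd := is_deriveM d2 d3; apply: is_derive_eq dd _.
by rewrite /drad /outer_cutoff /GRing.scale/=; ring.
Qed.

Lemma smooth_on_rad m : smooth_on [set x | x != 0] (rad m).
Proof.
have oP := @open_punctured R n.
apply: (smooth_onM oP _ (smooth_on_sqn_powR (- m))).
apply: (smooth_on_step oP); apply: (smooth_onB oP (smooth_on_cst 2 oP)).
exact: (smooth_onM oP (smooth_on_cst 8 oP) (smooth_on_sqn oP)).
Qed.

Lemma rad0 m x : sqn x <= 1 / 8 -> rad m x = 0.
Proof. by move=> s; rewrite /rad /outer_cutoff step_ge1 ?mul0r//; lra. Qed.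

Lemma drad0 m x : sqn x <= 1 / 8 -> drad m x = 0.
Proof.
move=> s; rewrite /drad /outer_cutoff step_ge1 ?dstep_ge1; [|lra..].
by rewrite !mulr0 mul0r subr0.
Qed.

Lemma rad_outer m x : 1 / 4 <= sqn x -> rad m x = step0 * sqn x `^ (- m).
Proof. by move=> s; rewrite /rad /outer_cutoff step_le0//; lra. Qed.

Lemma inner_cutoff_inner x : sqn x <= 1 / 4 -> inner_cutoff x = step0.
Proof. by move=> s; rewrite /inner_cutoff step_le0//; lra. Qed.

Lemma norm_rad m x : `|rad m x| <= sqn x `^ (- m).
Proof.
rewrite normrM (ger0_norm (powR_ge0 _ _)) ger0_norm ?step_ge0// ler_piMl ?powR_ge0//.
exact: step_le1.
Qed.

Lemma norm_drad m x : 0 <= m -> x != 0 -> `|drad m x| <= (8 + m) * sqn x `^ (- m - 1).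
Proof.
move=> m0 x0; have s0 := sqn_gt0 x0.
rewrite /drad (le_trans (ler_normB _ _))// [leRHS]mulrDl; apply: lerD.
  have V : sqn x `^ (- m) = sqn x `^ (- m - 1) * sqn x.
    by rewrite -[X in _ * X]powRr1 ?sqn_ge0// -sqn_powRD//; congr (_ `^ _); ring.
  rewrite V mulrCA mulrC normrM (ger0_norm (powR_ge0 _ _)) ler_wpM2r ?powR_ge0//.
  rewrite !normrM normrN (ger0_norm (x := 8))// (gtr0_norm s0).
  have [s|s] := leP (1 / 4) (sqn x); first by rewrite dstep_le0 ?normr0 ?mulr0 ?mul0r//; lra.
  have := norm_dstep (2 - 8 * sqn x); set d := `|_| => d4.
  apply: (@le_trans _ _ (8 * 4 * (1 / 4))); last by lra.
  by apply: ler_pM; [rewrite mulr_ge0// normr_ge0|exact: ltW|rewrite ler_wpM2l|exact: ltW].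
rewrite !normrM (ger0_norm m0) (ger0_norm (powR_ge0 _ _)) ger0_norm ?step_ge0//.
by rewrite ler_piMr ?mulr_ge0 ?powR_ge0// step_le1.
Qed.

Lemma rad_defect_le m x : 1 <= m -> x != 0 ->
  `|- 16 * dstep (2 - 8 * sqn x) * sqn x `^ (1 - m)| <= 64 * (1 / 8) `^ (1 - m).
Proof.
move=> m1 x0; have s0 := sqn_gt0 x0.
have rhs : 0 <= 64 * (1 / 8 : R) `^ (1 - m) by rewrite mulr_ge0 ?powR_ge0.
have [s|s] := leP (sqn x) (1 / 8).
  by rewrite dstep_ge1 ?mulr0 ?mul0r ?normr0//; lra.
rewrite normrM (ger0_norm (powR_ge0 _ _)); apply: ler_pM => //.
- exact: powR_ge0.
- rewrite normrM normrN (ger0_norm (x := 16))// (_ : 64 = 16 * 4); last by ring.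
  by rewrite ler_wpM2l// norm_dstep.
rewrite (_ : 1 - m = - (m - 1)); last by ring.
by apply: le_powRN; [lra|lra|exact: ltW].
Qed.

Lemma norm_gt_outer x : (n <= 3)%N -> 1 / 8 < sqn x -> 1 / 5 < `|x|.
Proof.
move=> n3 s8; have : sqn x <= 3 * `|x| ^+ 2.
  apply: le_trans (sqn_le_norm_sq x) _; rewrite ler_wpM2r ?sqr_ge0//.
  by rewrite ler_nat.
by rewrite -(@ltr_pXn2r _ 2)// ?nnegrE//; lra.
Qed.

(** The base 6 comes from 1 + t <= 6 t, valid for t >= 1 / 5, which [norm_gt_outer] provides. *)
Lemma sqn_powRN_le x (k : nat) : (n <= 3)%N -> 1 / 8 < sqn x ->
  (1 + `|x|) ^+ k * sqn x `^ (- (k%:R / 2)) <= 6 ^+ k.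
Proof.
move=> n3 s8; have s0 : 0 < sqn x by lra.
have t5 := norm_gt_outer n3 s8; set t := `|x| in t5 *.
have t0 : 0 <= t by exact: normr_ge0.
have tS : t <= sqn x `^ (1 / 2).
  rewrite -(@ler_pXn2r _ 2)// ?nnegrE ?powR_ge0//.
  by rewrite sqn_half_sq; exact: norm_sq_le_sqn.
have -> : sqn x `^ (- (k%:R / 2)) = (sqn x `^ (1 / 2) ^+ k)^-1.
  by rewrite powRN -powR_mulrn ?powR_ge0// -powRrM mul1r mulrC.
have S0 : 0 < sqn x `^ (1 / 2) by exact: powR_gt0.
rewrite ler_pdivrMr ?exprn_gt0// -exprMn; apply: lerXn2r; rewrite ?nnegrE.
- by rewrite addr_ge0.
- by rewrite mulr_ge0// ltW.
by lra.
Qed.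

Context (m c : R) (Z : 'rV[R]_n -> R[i]) (dZ : 'I_n -> 'rV[R]_n -> R[i]).
Hypothesis m0 : 0 <= m.
Hypothesis c0 : 0 <= c.
Hypothesis sZ : csmooth [set x | x != 0] Z.
Hypothesis Zd : forall l x, is_cderive l Z x (dZ l x).
Hypothesis Z_le : forall x, nrmc (Z x) <= c * sqn x `^ (m - 1).
Hypothesis dZ_le : forall l x, nrmc (dZ l x) <= c * sqn x `^ (m - 3 / 2).

(** As [Z] is at most of order |x| ^ (2 m - 2), the product decays like |x| ^ -2 whatever [m] is,
    and its gradient like |x| ^ -3: enough for H^1 in dimension at most 3. *)
Definition piece x : R[i] := (rad m x)%:C%C * Z x.

Lemma csmooth_piece : csmooth [set x | x != 0] piece.
Proof.
have oP := @open_punctured R n.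
exact: (csmoothM oP (csmooth_real oP (smooth_on_rad m)) sZ).
Qed.

Lemma cpartial_piece l x : x != 0 -> cpartial l piece x =
  (drad m x * (2 * x ord0 l))%:C%C * Z x + (rad m x)%:C%C * dZ l x.
Proof.
move=> x0; apply: cpartialE.
exact: (is_cderiveM (is_cderive_real (is_derive_rad m l x0)) (Zd l x)).
Qed.

Lemma piece0 x : sqn x <= 1 / 8 -> piece x = 0.
Proof. by move=> s; rewrite /piece rad0// mul0r. Qed.

Lemma nrmc_piece x : x != 0 -> nrmc (piece x) <= c * sqn x `^ (-1).
Proof.
move=> x0; rewrite nrmcM nrmc_real.
rewrite (_ : -1 = - m + (m - 1)); last by ring.
rewrite sqn_powRD// mulrCA; apply: ler_pM => //; first exact: nrmc_ge0.
exact: norm_rad.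
Qed.

Lemma nrmc_dpiece l x : x != 0 ->
  nrmc (cpartial l piece x) <= c * (2 * (8 + m) + 1) * sqn x `^ (- (3 / 2)).
Proof.
move=> x0; rewrite cpartial_piece// (le_trans (nrmcD _ _))//.
rewrite mulrDr mulr1 mulrDl; apply: lerD.
  rewrite nrmcM nrmc_real.
  rewrite (_ : _ * _ * _ = ((8 + m) * sqn x `^ (- m - 1) * (2 * sqn x `^ (1 / 2))) *
     (c * sqn x `^ (m - 1))).
    apply: ler_pM => //; first exact: nrmc_ge0.
    rewrite normrM; apply: ler_pM => //; first exact: norm_drad.
    by rewrite normrM ger0_norm// ler_wpM2l// norm_coord_le.
  rewrite (_ : - (3 / 2) = (- m - 1) + (1 / 2 + (m - 1))); last by field.
  by rewrite !sqn_powRD//; ring.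
rewrite nrmcM nrmc_real.
rewrite (_ : - (3 / 2) = - m + (m - 3 / 2)); last by ring.
rewrite (sqn_powRD (- m))// mulrCA; apply: ler_pM => //; first exact: nrmc_ge0.
exact: norm_rad.
Qed.

Lemma piece_tame : (n <= 3)%N -> tame (fun x => complex.Re (piece x)) /\
  tame (fun x => complex.Im (piece x)).
Proof.
move=> n3; have [s1 s2] := csmooth_piece.
pose c' := c * (2 * (8 + m) + 1).
have c'0 : 0 <= c' by rewrite mulr_ge0// addr_ge0// mulr_ge0// addr_ge0.
pose K := c * 6 ^+ 4 * 3 + c' * 6 ^+ 3 * 5.
have K1 : 0 <= c * 6 ^+ 4 * 3 by rewrite !mulr_ge0.
have K3 : 0 <= c' * 6 ^+ 3 by apply: mulr_ge0 => //; exact: exprn_ge0.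
have K2 : 0 <= c' * 6 ^+ 3 * 5 by exact: mulr_ge0.
have K0 : 0 <= K by rewrite addr_ge0.
have sne x : 1 / 8 < sqn x -> x != 0.
  move=> s8; apply: contraTneq s8 => ->.
  by rewrite /sqn big1 => [|i _]; rewrite ?mxE ?expr0n// -leNgt divr_ge0.
have f_le x : nrmc (piece x) <= K * `|x| ^+ 2 / (1 + `|x|) ^+ 4.
  have p4 : 0 < (1 + `|x|) ^+ 4 by rewrite exprn_gt0// ltr_pwDl.
  have [s|s] := leP (sqn x) (1 / 8).
    by rewrite piece0// nrmc0 divr_ge0 ?(ltW p4)// mulr_ge0// sqr_ge0.
  have x0 := sne x s; rewrite ler_pdivlMr//.
  have s3 : sqn x <= 3 * `|x| ^+ 2.
    apply: le_trans (sqn_le_norm_sq x) _; rewrite ler_wpM2r ?sqr_ge0//.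
    by rewrite ler_nat.
  apply: (@le_trans _ _ (c * (6 ^+ 4 * (3 * `|x| ^+ 2)))); last first.
    rewrite (_ : c * _ = c * 6 ^+ 4 * 3 * `|x| ^+ 2); last by ring.
    by apply: ler_wpM2r; [exact: sqr_ge0|rewrite lerDl].
  apply: le_trans (ler_wpM2r (ltW p4) (nrmc_piece x0)) _.
  rewrite -mulrA ler_wpM2l// (_ : -1 = - (4%:R / 2) + 1 :> R); last by field.
  rewrite sqn_powRD// powRr1 ?sqn_ge0// mulrAC [_ `^ _ * _]mulrC.
  apply: ler_pM => //; last exact: sqn_powRN_le.
  - by rewrite mulr_ge0 ?powR_ge0// ltW.
  - exact: sqn_ge0.
have df_le l x : x != 0 -> nrmc (cpartial l piece x) <= K * `|x| / (1 + `|x|) ^+ 3.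
  move=> x0; have p3 : 0 < (1 + `|x|) ^+ 3 by rewrite exprn_gt0// ltr_pwDl.
  have [s|s] := leP (sqn x) (1 / 8).
    rewrite cpartial_piece// rad0// drad0// !mul0r addr0 nrmc0.
    by rewrite divr_ge0 ?(ltW p3)// mulr_ge0.
  rewrite ler_pdivlMr//; have t5 := norm_gt_outer n3 s.
  apply: (@le_trans _ _ (c' * 6 ^+ 3)).
    apply: le_trans (ler_wpM2r (ltW p3) (nrmc_dpiece l x0)) _.
    rewrite -/c' -[leLHS]mulrA; apply: (ler_wpM2l c'0).
    by rewrite mulrC; exact: (sqn_powRN_le 3).
  apply: (@le_trans _ _ (c' * 6 ^+ 3 * (5 * `|x|))).
    by rewrite ler_peMr//; lra.
  rewrite (_ : c' * _ * _ = c' * 6 ^+ 3 * 5 * `|x|); last by ring.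
  by apply: ler_wpM2r => //; rewrite lerDr.
split; (split; [by []|exists K; split=> //]).
- by move=> x; apply: le_trans (Re_le_nrmc _) (f_le x).
- by move=> l x x0; apply: le_trans (Re_le_nrmc (cpartial l _ x)) (df_le l x x0).
- by move=> x; apply: le_trans (Im_le_nrmc _) (f_le x).
- by move=> l x x0; apply: le_trans (Im_le_nrmc (cpartial l _ x)) (df_le l x x0).
Qed.

End radial.

(** * The planar case *)

Section cpartial_rules.
Context {R : realType} {n : nat}.
Implicit Types (f g : 'rV[R]_n -> R[i]).

Lemma cpartialD f g l x : csmooth [set x | x != 0] f -> csmooth [set x | x != 0] g ->
  x != 0 -> cpartial l (fun y => f y + g y) x = cpartial l f x + cpartial l g x.
Proof.
move=> sf sg x0; apply: cpartialE.
exact: is_cderiveD (csmooth_is_cderive l sf x0) (csmooth_is_cderive l sg x0).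
Qed.

Lemma cpartialN f l x : csmooth [set x | x != 0] f ->
  x != 0 -> cpartial l (fun y => - f y) x = - cpartial l f x.
Proof.
move=> sf x0; apply: cpartialE; have [d1 d2] := csmooth_is_cderive l sf x0.
split; rewrite raddfN.
  rewrite (_ : (fun y => _) = - (fun y => complex.Re (f y))); first exact: is_deriveN.
  by apply/funext => y; rewrite raddfN.
rewrite (_ : (fun y => _) = - (fun y => complex.Im (f y))); first exact: is_deriveN.
by apply/funext => y; rewrite raddfN.
Qed.

End cpartial_rules.

(** * Estimates shared by both dimensions *)

Section common_bounds.
Context {R : realType} {n : nat} (beta : R) (j0 : nat).
Implicit Types (x : 'rV[R]_n) (l p q : 'I_n) (psi : 'rV[R]_n -> R).
Hypothesis beta0 : 0 < beta.
Hypothesis j02 : (2 <= j0)%N.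
Hypothesis j0_large : (1 / 16) `^ (- beta) <= j0%:R.

Lemma env_sqnE (gamma : R) x : beta = (gamma - 1) / 2 ->
  expR (- (1 / (4 * beta) / sqn x `^ (gamma - 1))) = env beta (sqn x).
Proof.
move=> bE; rewrite /env (_ : gamma - 1 = 2 * beta); last by rewrite bE; field.
by rewrite powRN mul1r mulrC.
Qed.

Lemma nrmc_piece8 (m c : R) (Z : 'rV[R]_n -> R[i]) x : 0 <= c ->
  (forall x, nrmc (Z x) <= c * sqn x `^ (m - 1)) -> x != 0 -> 1 / 8 < sqn x ->
  nrmc (piece m Z x) <= c * 8.
Proof.
move=> c0 Z_le x0 s8; apply: le_trans (nrmc_piece Z_le x0) _.
rewrite ler_wpM2l// powR_inv1 ?sqn_ge0// -[leRHS]invrK lef_pV2 ?posrE ?invr_gt0//; first by lra.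
exact: sqn_gt0.
Qed.

Definition defect (m : R) x : R := - 16 * dstep (2 - 8 * sqn x) * sqn x `^ (1 - m).

(** The defect lives in the shell 1 / 8 <= sqn <= 1 / 4, where the power of sqn and [E] are bounded
    below by positive constants. [E] is left free because the two dimensions evaluate the envelope
    at different arguments; 1 / 16 is half of 1 / 8, the loss incurred in dimension 3. *)
Lemma defect_le (m : R) : 1 <= m -> exists2 K, 0 <= K & forall x (E : R), x != 0 ->
  sqn x <= 1 / 2 -> 0 <= E -> (1 / 8 < sqn x -> env beta (1 / 16) <= E) ->
  `|defect m x| <= K * (sqn x `^ (- beta - 1 / 2) * E).
Proof.
move=> m1; pose K := 64 * (1 / 8 : R) `^ (1 - m).
have K0 : 0 <= K by rewrite mulr_ge0 ?powR_ge0.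
have e0 : 0 < env beta (1 / 16) by exact: env_gt0.
exists (K / env beta (1 / 16)); first by rewrite divr_ge0// ltW.
move=> x E x0 s1 E0 HE; have s0 := sqn_gt0 x0.
have [s|s] := leP (sqn x) (1 / 8).
  rewrite /defect dstep_ge1 ?mulr0 ?mul0r ?normr0; last by lra.
  by rewrite mulr_ge0 ?divr_ge0 ?mulr_ge0 ?powR_ge0// ltW.
apply: le_trans (rad_defect_le m1 x0) _; rewrite -/K -mulrA ler_peMr//.
rewrite mulrCA -[leLHS]mulr1; apply: ler_pM => //.
  have := @le_powRN R (beta + 1 / 2) (sqn x) 1; rewrite powR1.
  by rewrite opprD; apply=> //; have := beta0; lra.
by rewrite mulrC ler_pdivlMr// [leLHS]mul1r; exact: HE.
Qed.

Context (p q : 'I_n) (psi : 'rV[R]_n -> R).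
Hypothesis pq : p != q.
Hypothesis hpsi : radial_cutoff p q psi.

Let G := cblock beta j0 p q psi.

(* The bound by [env (rho x)] is void where [rho x] vanishes, since [env 0 = 1]. *)
Lemma cblock_dbar_env : exists2 K, 0 <= K & forall par x (r : R), x != 0 ->
  sqn x <= 1 / 2 -> rho p q x <= r ->
  nrmc (cpartial p (G par) x + Complex 0 (sgn par) * cpartial q (G par) x) <=
    K * (sqn x `^ (- beta - 1 / 2) * env beta r) /\
  forall l, l != p -> l != q ->
  nrmc (cpartial l (G par) x) <= K * (sqn x `^ (- beta - 1 / 2) * env beta r).
Proof.
have [K K0 HK] := cblock_dbar_le pq beta0 j02 hpsi; exists K => //.
move=> par x r x0 s1 rr; have s0 := sqn_gt0 x0.
have rhs0 : 0 <= K * (sqn x `^ (- beta - 1 / 2) * env beta r).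
  by apply: mulr_ge0 => //; apply: mulr_ge0; [exact: powR_ge0|exact: env_ge0].
have [xin|sr] := ltP (4 * rho p q x) (sqn x).
  have G0 l : cpartial l (G par) x = 0.
    by apply: (cpartial_cblock0 _ _ hpsi); left.
  by rewrite !G0 mulr0 addr0 nrmc0; split=> // l _ _; rewrite G0 nrmc0.
have H : K * (sqn x `^ (- beta - 1 / 2) * env beta (rho p q x)) <=
    K * (sqn x `^ (- beta - 1 / 2) * env beta r).
  apply: ler_wpM2l => //; apply: ler_wpM2l; first exact: powR_ge0.
  by apply: le_env => //; lra.
have [H1 H2] := HK par x x0 s1; split; first exact: le_trans H1 H.
by move=> l lp lq; exact: le_trans (H2 l lp lq) H.
Qed.

Lemma cblock_outer0 par l x : 1 / 2 < sqn x -> cpartial l (G par) x = 0.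
Proof. by move=> s; apply: (cpartial_cblock0 _ _ hpsi); right. Qed.

(* Where the radial piece is switched on only one parity is left, so that the
   component carrying the other one is free for it. *)
Lemma cblock_true0 x : 1 / 16 <= rho p q x -> G true x = 0.
Proof.
move=> r1; rewrite /G /cblock block_true0 ?mulr0//; apply: le_trans j0_large.
by apply: le_powRN; [exact: ltW|lra|].
Qed.

(** One factor flat (1 / 2) is the lower bound of [sector], the other two come from [cut_lower], and
    [step0] is the plateau of [inner_cutoff]. *)
Definition kappa : R := step0 * flat (1 / 2) ^+ 3.

Lemma kappa_gt0 : 0 < kappa.
Proof. by rewrite mulr_gt0 ?step0_gt0// exprn_gt0// flat_gt0//; lra. Qed.

Lemma kappa_le : kappa <= step0.
Proof.
rewrite /kappa ler_piMr ?(ltW step0_gt0)// exprn_ile1 ?flat_ge0 ?flat_le1//.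
Qed.

Lemma cblock_lower x : 0 < rho p q x -> rho p q x <= 1 ->
  step0 * flat (1 / 2) <= psi x ->
  exists par, kappa * env beta (rho p q x) <= nrmc (G par x).
Proof.
move=> r0 r1 px; have [par H] := block_lower beta0 j02 r0 r1; exists par.
have f0 : 0 <= step0 * flat (1 / 2) :> R by rewrite mulr_ge0 ?flat_ge0.
rewrite /G /cblock (nrmcM _ (block _ _ _ _ _ _)) nrmc_real ger0_norm; last exact: le_trans px.
rewrite (_ : kappa * _ = step0 * flat (1 / 2) * (flat (1 / 2) ^+ 2 * env beta (rho p q x))).
  apply: ler_pM => //; apply: mulr_ge0; [exact: sqr_ge0|exact: env_ge0].
by rewrite /kappa; ring.
Qed.

End common_bounds.

Section plane.
Context {R : realType} (beta : R) (j0 : nat).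
Implicit Types (x : 'rV[R]_2).
Hypothesis beta0 : 0 < beta.
Hypothesis j02 : (2 <= j0)%N.
Hypothesis j0_large : (1 / 16) `^ (- beta) <= j0%:R.

Local Notation x1 := (ord0 : 'I_2).
Local Notation x2 := (lift ord0 ord0 : 'I_2).
Local Notation Im := (Complex 0 1 : R[i]).

Lemma pauli_row (d : 'I_2 -> 'I_2 -> R[i]) (k : 'I_2) :
  \sum_(j < 2) \sum_(l < 2) pauli R (widen_ord (leqnSn 2) j) k l * d j l =
  if k == ord0 then d x1 x2 - Im * d x2 x2 else d x1 x1 + Im * d x2 x1.
Proof.
rewrite !big_ord_recl !big_ord0.
move: (d x1 x1) (d x1 x2) (d x2 x1) (d x2 x2) => d11 d12 d21 d22.
by case: k => [[|[|//]] ?]; rewrite /pauli/= !mxE/= !mul0r !mul1r !add0r !addr0 ?mulNr.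
Qed.

Lemma sqn2 x : sqn x = rho x1 x2 x.
Proof. by rewrite /sqn !big_ord_recl big_ord0 addr0. Qed.

(** The angular factor is 1: in the plane rho is |x| ^ 2 and there is no axis to avoid. *)
Definition disc_cutoff x : R := inner_cutoff x * 1.

Lemma disc_cutoffP : radial_cutoff x1 x2 disc_cutoff.
Proof.
apply: (@radial_cutoffM R 2 x1 x2 (fun=> 1) 0) => //.
- exact: (smooth_on_cst 1 (@open_punctured R 2)).
- by move=> x; rewrite ler01 lexx.
- by move=> x; have := rho_ge0 x1 x2 x; have := sqn2 x; lra.
- by move=> l x x0; rewrite (partialE (is_derive_cst (1 : R) x (delta_mx ord0 l))) normr0 mul0r.
Qed.

Let G := cblock beta j0 x1 x2 disc_cutoff.

Let Z x : R[i] := zeta x1 x2 false x ^+ 2.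
Let dZ l x : R[i] := 2%:R * zeta x1 x2 false x ^+ 1 * dzeta x1 x2 false l.

Let sZ : csmooth [set x | x != 0] Z.
Proof.
exact: (csmoothX 2 (@open_punctured R 2) (csmooth_zeta x1 x2 false (@open_punctured R 2))).
Qed.

Let Zd l x : is_cderive l Z x (dZ l x).
Proof. exact: (is_cderiveX 2 (is_cderive_zeta x1 x2 false l x)). Qed.

Let Z_eq x : nrmc (Z x) = sqn x.
Proof. by rewrite nrmcX nrmc_zeta sqr_sqrtr ?rho_ge0// sqn2. Qed.

Let Z_le x : nrmc (Z x) <= 4 * sqn x `^ (2 - 1).
Proof.
rewrite Z_eq (_ : 2 - 1 = 1); last by ring.
by rewrite powRr1 ?sqn_ge0//; have := sqn_ge0 x; lra.
Qed.

Let dZ_le l x : nrmc (dZ l x) <= 4 * sqn x `^ (2 - 3 / 2).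
Proof.
rewrite /dZ expr1 (nrmcM _ (dzeta _ _ _ _)) nrmcM nrmc_nat nrmc_zeta -sqn2.
rewrite (_ : 2 - 3 / 2 = 2^-1); last by field.
rewrite powR12_sqrt ?sqn_ge0// (_ : 4 * _ = 2 * Num.sqrt (sqn x) * 2); last by ring.
by apply: ler_pM; [rewrite mulr_ge0// sqrtr_ge0|exact: nrmc_ge0|exact: lexx|exact: nrmc_dzeta].
Qed.

Let W := piece 2 Z.

(** Where the cutoff is constant, [W] is a multiple of zeta ^ 2 / |zeta| ^ 4, the inverse square of
    the conjugate of zeta, which d_1 - i d_2 annihilates. In general (x_1 - i x_2) zeta ^ 2 = |x| ^
    2 zeta and (d_1 - i d_2) zeta ^ 2 = 4 zeta reduce the claim to [rad_euler]. *)
Let radial2 x : x != 0 -> cpartial x1 W x + - Im * cpartial x2 W x =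
  (defect 2 x)%:C%C * zeta x1 x2 false x.
Proof.
move=> x0; rewrite /W !(cpartial_piece 2 Zd)// /defect -(rad_euler 2 x0) sqn2.
rewrite /dZ /Z expr1; set z := zeta _ _ _ _.
have d1 : dzeta x1 x2 false x1 = 1 :> R[i].
  by rewrite /dzeta eqxx mulr0.
have d2 : dzeta x1 x2 false x2 = Im.
  by rewrite /dzeta /sgn expr0 eqxx mulr1.
have II : Im * Im = -1 by exact: sqrI.
have zE : z = (x ord0 x1)%:C%C + Im * (x ord0 x2)%:C%C.
  apply/eqP; rewrite eq_complex /= /sgn expr0 !mul0r !mul1r ?mulr0 subr0 !add0r addr0 !eqxx //.
rewrite d1 d2 /rho zE; move: (drad 2 x) (rad 2 x) (x ord0 x1) (x ord0 x2) => a b u v.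
have cD (s t : R) : (s + t)%:C%C = s%:C%C + t%:C%C by exact: rmorphD.
have cM (s t : R) : (s * t)%:C%C = s%:C%C * t%:C%C by exact: rmorphM.
have c2 : 2%:C%C = 2 :> R[i] by exact: rmorph_nat.
rewrite ![in RHS]expr2 !(cD, cM, c2).
move: (a%:C%C) (b%:C%C) (u%:C%C) (v%:C%C) => {}a {}b {}u {}v.
transitivity (a * 2 * (u - Im * v) * (u + Im * v) ^+ 2 + b * 2 * (u + Im * v) * (1 - Im * Im)).
  by ring.
have -> : a * 2 * (u - Im * v) * (u + Im * v) ^+ 2 =
    a * 2 * (u ^+ 2 - (Im * Im) * v ^+ 2) * (u + Im * v).
  by ring.
by rewrite II; ring.
Qed.

Let sG par : csmooth [set x | x != 0] (G par).
Proof. exact: csmooth_cblock beta0 j02 disc_cutoffP par. Qed.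

Let sW : csmooth [set x | x != 0] W. Proof. exact: csmooth_piece. Qed.

(** [W] shares its component with the parity that vanishes for rho >= 1 / 16, so the two are never
    on together and cannot cancel. *)
Definition planar_comp (k : 'I_2) : 'rV[R]_2 -> R[i] :=
  if k == ord0 then G false else fun x => G true x + W x.

Let planar_row (k : 'I_2) x : x != 0 ->
  \sum_(j < 2) \sum_(l < 2)
    pauli R (widen_ord (leqnSn 2) j) k l * cpartial j (planar_comp l) x =
  if k == ord0 then cpartial x1 (G true) x + Complex 0 (sgn true) * cpartial x2 (G true) x +
    (defect 2 x)%:C%C * zeta x1 x2 false x
  else cpartial x1 (G false) x + Complex 0 (sgn false) * cpartial x2 (G false) x.
Proof.
move=> x0; rewrite (pauli_row (fun j l => cpartial j (planar_comp l) x)).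
have E j : cpartial j (planar_comp x2) x = cpartial j (G true) x + cpartial j W x.
  exact: (cpartialD j (sG true) sW x0).
have -> : planar_comp x1 = G false by [].
rewrite !E -(radial2 x0).
have -> : Complex 0 (sgn true) = - Im by apply/eqP; rewrite eq_complex /= oppr0 !eqxx.
have -> : Complex 0 (sgn false) = Im :> R[i] by [].
case: (k == ord0) => //.
move: (cpartial x1 _ x) (cpartial x2 _ x) (cpartial x1 _ x) (cpartial x2 _ x) => t1 t2 t3 t4.
by ring.
Qed.

Let planar_dirac_le : exists2 K, 0 <= K & forall k x, x != 0 -> sqn x <= 1 / 2 ->
  nrmc (\sum_(j < 2) \sum_(l < 2)
    pauli R (widen_ord (leqnSn 2) j) k l * cpartial j (planar_comp l) x) <=
  K * (sqn x `^ (- beta - 1 / 2) * env beta (sqn x)).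
Proof.
have [K1 K10 HK1] := cblock_dbar_env beta0 j02 (isT : x1 != x2) disc_cutoffP.
have m2 : 1 <= 2 :> R by lra.
have [K2 K20 HK2] := @defect_le R 2 beta beta0 2 m2.
exists (K1 + K2); first exact: addr_ge0.
move=> k x x0 s1; have s0 := sqn_gt0 x0; rewrite (planar_row k x0).
have rs : rho x1 x2 x <= sqn x by rewrite sqn2.
have e0 : 0 <= env beta (sqn x) by exact: env_ge0.
set B := _ * env beta (sqn x).
have B0 : 0 <= B by apply: mulr_ge0 e0; exact: powR_ge0.
have [H1 _] := HK1 true x _ x0 s1 rs; have [H2 _] := HK1 false x _ x0 s1 rs.
rewrite mulrDl; case: (k == ord0); last by apply: le_trans H2 _; rewrite lerDl; exact: mulr_ge0.
apply: le_trans (nrmcD _ _) _; apply: lerD H1 _.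
rewrite (nrmcM _ (zeta _ _ _ _)) nrmc_real -[leRHS]mulr1.
apply: ler_pM; [exact: normr_ge0|exact: nrmc_ge0| |].
  apply: (HK2 x _ x0 s1 e0) => s8; apply: (le_env beta0); [by rewrite divr_gt0|lra].
by rewrite nrmc_zeta -sqn2 -sqrtr1; apply: ler_wsqrtr; lra.
Qed.

(** Three zones. From sqn = 1 / 4 on, [W] has reached its plateau and suffices alone. Up to 1 / 8 it
    is absent and either parity will do. In between, the large mode must be of parity [false], the
    other one being zero. *)
Let planar_lower x : x != 0 -> sqn x <= 1 / 2 ->
  exists k, kappa * env beta (sqn x) <= nrmc (planar_comp k x).
Proof.
move=> x0 s1; have s0 := sqn_gt0 x0; have kp := @kappa_gt0 R; have ks := @kappa_le R.
have e1 : env beta (sqn x) <= 1 by exact: env_le1.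
have e0 : 0 <= env beta (sqn x) by exact: env_ge0.
have [s|s] := leP (1 / 4) (sqn x).
  have G0 : G true x = 0 by apply: (cblock_true0 beta0 j0_large); rewrite -sqn2; lra.
  exists x2; rewrite -[planar_comp x2 x]/(G true x + W x) G0 add0r.
  rewrite /W /piece (nrmcM _ (Z x)) nrmc_real Z_eq rad_outer// ger0_norm; last first.
    by apply: mulr_ge0; [exact: ltW step0_gt0|exact: powR_ge0].
  have E : sqn x `^ (- 2) * sqn x = sqn x `^ (-1).
    rewrite -[X in _ * X]powRr1 ?sqn_ge0// -sqn_powRD//.
    by congr (_ `^ _); ring.
  have -> : step0 * sqn x `^ (- 2) * sqn x = step0 * sqn x `^ (-1) by rewrite -E mulrA.
  apply: ler_pM; [exact: ltW|exact: e0|exact: ks|].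
  apply: le_trans e1 _.
  by have := @le_powRN R 1 (sqn x) 1; rewrite powR1; apply; lra.
have px : step0 * flat (1 / 2) <= disc_cutoff x.
  rewrite /disc_cutoff mulr1 inner_cutoff_inner ?(ltW s)//.
  by rewrite ler_piMr ?flat_le1// ltW// step0_gt0.
have r0 : 0 < rho x1 x2 x by rewrite -sqn2.
have r1 : rho x1 x2 x <= 1 by rewrite -sqn2; lra.
have [[] H] := cblock_lower beta0 j02 r0 r1 px; rewrite -sqn2 in H.
  have [s8|s8] := leP (sqn x) (1 / 8).
    by exists x2; rewrite -[planar_comp x2 x]/(G true x + W x) /W piece0// addr0.
  exists x1; apply: le_trans H _.
  rewrite (cblock_true0 beta0 j0_large) ?nrmc0; first exact: nrmc_ge0.
  by rewrite -sqn2; lra.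
by exists x1.
Qed.

Let planar_outer x : x != 0 -> 1 / 2 < sqn x -> forall k,
  \sum_(j < 2) \sum_(l < 2)
    pauli R (widen_ord (leqnSn 2) j) k l * cpartial j (planar_comp l) x = 0.
Proof.
move=> x0 s1 k; rewrite (planar_row k x0) /defect dstep_le0; last by lra.
have G0 par l : cpartial l (G par) x = 0 by exact: cblock_outer0 disc_cutoffP par l x s1.
by rewrite !G0 !mulr0 mul0r mul0r !addr0; case: ifP.
Qed.

Let planar_upper x k : x != 0 -> nrmc (planar_comp k x) <=
  (kamp beta j0 + 4 * 8 / env beta (1 / 8)) * env beta (sqn x).
Proof.
move=> x0; rewrite mulrDl.
have k0 := kamp_ge0 beta j0.
have e8 : 0 < env beta (1 / 8) by exact: env_gt0.
have b4 : 0 <= 4 * 8 / env beta (1 / 8) by rewrite divr_ge0 ?(ltW e8)// mulr_ge0.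
have HG par : nrmc (G par x) <= kamp beta j0 * env beta (sqn x).
  exact: (nrmc_cblock (isT : x1 != x2) beta0 j02 disc_cutoffP par x).
have HW : nrmc (W x) <= 4 * 8 / env beta (1 / 8) * env beta (sqn x).
  have [s8|s8] := leP (sqn x) (1 / 8).
    by rewrite /W piece0// nrmc0; apply: mulr_ge0 => //; exact: env_ge0.
  apply: (@le_trans _ _ (4 * 8)); first exact: (nrmc_piece8 (ler0n _ 4) Z_le x0 s8).
  rewrite mulrAC ler_pdivlMr//; apply: ler_wpM2l; first by rewrite mulr_ge0.
  by apply: (le_env beta0); [rewrite divr_gt0|exact: ltW].
rewrite /planar_comp; case: (k == ord0).
  by apply: le_trans (HG false) _; rewrite lerDl; apply: mulr_ge0 => //; exact: env_ge0.
by apply: le_trans (nrmcD _ _) _; apply: lerD.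
Qed.

Lemma planar_case (gamma : R) (alpha : 'I_3 -> 'M[R[i]]_2) : 1 < gamma ->
  beta = (gamma - 1) / 2 -> alpha =1 pauli R ->
  vanishing_solution alpha gamma.
Proof.
move=> g1 bE aE.
have gE : - (gamma / 2) = - beta - 1 / 2 by rewrite bE; field.
have [K K0 HK] := planar_dirac_le.
apply: (@vanishing_solution_of_comp R 2 2 alpha gamma 1%:M (fun j => pauli R (widen_ord (leqnSn 2) j))
  planar_comp (fun x => env beta (sqn x)) (1 / (4 * beta)) K kappa
  (kamp beta j0 + 4 * 8 / env beta (1 / 8)) isT g1 (unitmx1 _ _)).
- by move=> j; rewrite mulmx1 mul1mx aE.
- have tG par : ctame (G par).
    exact: (cblock_tame (isT : x1 != x2) beta0 j02 disc_cutoffP par isT).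
  have tW : ctame W by apply: (piece_tame _ _ sZ Zd Z_le dZ_le isT); lra.
  by move=> k; rewrite /planar_comp; case: (k == ord0); [exact: tG|exact: ctameD].
- by rewrite divr_gt0// mulr_gt0.
- exact: kappa_gt0.
- exact: K0.
- by move=> x; exact: env_gt0.
- by move=> x x0 s1 k; rewrite gE; exact: HK.
- exact: planar_lower.
- exact: planar_outer.
- by move=> x x0 k; rewrite (env_sqnE x bE); exact: planar_upper.
Qed.

End plane.

(** * The spatial case *)

Opaque cblock cpartial.

Section space.
Context {R : realType} (beta : R) (j0 : nat).
Implicit Types (x : 'rV[R]_3).
Hypothesis beta0 : 0 < beta.
Hypothesis j02 : (2 <= j0)%N.
Hypothesis j0_large : (1 / 16) `^ (- beta) <= j0%:R.

Local Notation x1 := (ord0 : 'I_3).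
Local Notation x2 := (lift ord0 ord0 : 'I_3).
Local Notation x3 := (lift ord0 (lift ord0 ord0) : 'I_3).
Local Notation k1 := (ord0 : 'I_4).
Local Notation k2 := (lift ord0 ord0 : 'I_4).
Local Notation k3 := (lift ord0 (lift ord0 ord0) : 'I_4).
Local Notation k4 := (lift ord0 (lift ord0 (lift ord0 ord0)) : 'I_4).
Local Notation Im := (Complex 0 1 : R[i]).

Definition weyl (j : 'I_3) : 'M[R[i]]_4 := nth 0 [:: weyl1; weyl2; weyl3] j.

Lemma weyl_row (d : 'I_3 -> 'I_4 -> R[i]) (k : 'I_4) :
  \sum_(j < 3) \sum_(l < 4) weyl j k l * d j l =
  nth 0 [:: d x1 k2 - Im * d x2 k2 + d x3 k1;
            d x1 k1 + Im * d x2 k1 - d x3 k2;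
            - d x1 k4 + Im * d x2 k4 - d x3 k3;
            - d x1 k3 - Im * d x2 k3 + d x3 k4] k.
Proof.
rewrite !big_ord_recl !big_ord0.
move: (d x1 k1) (d x1 k2) (d x1 k3) (d x1 k4) (d x2 k1) (d x2 k2) (d x2 k3) (d x2 k4)
  (d x3 k1) (d x3 k2) (d x3 k3) (d x3 k4) => d11 d12 d13 d14 d21 d22 d23 d24 d31 d32 d33 d34.
rewrite /weyl/=.
by case: k => [[|[|[|[|//]]]] ?]; rewrite !mxE/= ?(mul0r, mul1r, mulN1r, add0r, addr0, mulNr) ?addrA.
Qed.

Lemma sqn3 x : sqn x = x ord0 x1 ^+ 2 + x ord0 x2 ^+ 2 + x ord0 x3 ^+ 2.
Proof. by rewrite /sqn !big_ord_recl big_ord0 addr0 addrA. Qed.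

(* Each of the two cutoffs is bounded below on its half of the directions, so one of
   the two pairs of components always dominates the envelope. *)
Definition belt_cutoff x : R := inner_cutoff x * sector x1 x3 x.

Definition cap_cutoff x : R := inner_cutoff x * sector x3 x1 x.

Lemma belt_cutoffP : radial_cutoff x1 x2 belt_cutoff.
Proof. by apply: radial_cutoff_sector => x; rewrite sqn3. Qed.

Lemma cap_cutoffP : radial_cutoff x3 x2 cap_cutoff.
Proof.
by apply: radial_cutoff_sector => x; rewrite sqn3 /rho; ring.
Qed.

Let G := cblock beta j0 x1 x2 belt_cutoff.
Let H := cblock beta j0 x3 x2 cap_cutoff.

Let Z1 x : R[i] := (x ord0 x3)%:C%C.
Let dZ1 (l : 'I_3) x : R[i] := ((x3 == l)%:R)%:C%C.
Let Z2 x : R[i] := zeta x1 x2 false x.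
Let dZ2 (l : 'I_3) x : R[i] := dzeta x1 x2 false l.
Let W1 := piece (3 / 2) Z1.
Let W2 := piece (3 / 2) Z2.

Let sZ1 : csmooth [set x | x != 0] Z1.
Proof.
exact: (csmooth_real (@open_punctured R 3) (smooth_on_coord x3 (@open_punctured R 3))).
Qed.

Let sZ2 : csmooth [set x | x != 0] Z2.
Proof. exact: (csmooth_zeta x1 x2 false (@open_punctured R 3)). Qed.

Let Z1d l x : is_cderive l Z1 x (dZ1 l x).
Proof. exact: (is_cderive_real (is_derive_coord x l x3)). Qed.

Let Z2d l x : is_cderive l Z2 x (dZ2 l x).
Proof. exact: is_cderive_zeta. Qed.

Let half : 3 / 2 - 1 = 1 / 2 :> R. Proof. by field. Qed.

Let rho_le x : rho x1 x2 x <= sqn x.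
Proof. exact: (rho_le_sqn (isT : x1 != x2) x). Qed.

Let Z1_le x : nrmc (Z1 x) <= 2 * sqn x `^ (3 / 2 - 1).
Proof.
rewrite half nrmc_real (le_trans (norm_coord_le x x3))// ler_peMl ?powR_ge0//.
by rewrite ler1n.
Qed.

Let Z2_le x : nrmc (Z2 x) <= 2 * sqn x `^ (3 / 2 - 1).
Proof.
rewrite half nrmc_zeta mul1r powR12_sqrt ?sqn_ge0//.
rewrite (le_trans (ler_wsqrtr (rho_le x)))// ler_peMl ?sqrtr_ge0//.
by rewrite ler1n.
Qed.

Let dZ1_le l x : nrmc (dZ1 l x) <= 2 * sqn x `^ (3 / 2 - 3 / 2).
Proof.
rewrite subrr powRr0 mulr1 nrmc_real; case: (_ == _); rewrite ?normr1 ?normr0//.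
by rewrite ler1n.
Qed.

Let dZ2_le l x : nrmc (dZ2 l x) <= 2 * sqn x `^ (3 / 2 - 3 / 2).
Proof. by rewrite subrr powRr0 mulr1; exact: nrmc_dzeta. Qed.

Let cD (s t : R) : (s + t)%:C%C = s%:C%C + t%:C%C :> R[i]. Proof. exact: rmorphD. Qed.
Let cM (s t : R) : (s * t)%:C%C = s%:C%C * t%:C%C :> R[i]. Proof. exact: rmorphM. Qed.
Let cn (m : nat) : (m%:R)%:C%C = m%:R :> R[i]. Proof. exact: rmorph_nat. Qed.

Let II : Im * Im = -1. Proof. exact: sqrI. Qed.

Let ZE x : Z2 x = (x ord0 x1)%:C%C + Im * (x ord0 x2)%:C%C.
Proof.
apply/eqP; rewrite /Z2 eq_complex /= /sgn expr0 !mul0r !mul1r ?mulr0 subr0 !add0r addr0 !eqxx //.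
Qed.

Let dZ2E : [/\ dzeta x1 x2 false x1 = 1 :> R[i], dzeta x1 x2 false x2 = Im
  & dzeta x1 x2 false x3 = 0 :> R[i]].
Proof. by rewrite /dzeta /sgn expr0 !eqxx !mulr0 mulr1. Qed.

(** The Weyl operator squares to the Laplacian, and (x_3, x_1 + i x_2) / |x| ^ 3 is up to sign its
    value on 1 / |x| times the first basis vector; harmonicity of 1 / |x| gives the equation where
    the cutoff is constant. Its variation leaves a defect in the first row only. *)
Let radial3 x : x != 0 ->
  cpartial x1 W2 x - Im * cpartial x2 W2 x + cpartial x3 W1 x = (defect (3 / 2) x)%:C%C /\
  cpartial x1 W1 x + Im * cpartial x2 W1 x - cpartial x3 W2 x = 0.
Proof.
move=> x0; rewrite /W1 /W2 !(cpartial_piece _ Z1d)// !(cpartial_piece _ Z2d)//.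
have [e1 e2 e3] := dZ2E.
rewrite /defect -(rad_euler (3 / 2) x0) sqn3 /dZ1 /dZ2 e1 e2 e3 ZE /Z1 /=.
move: (drad _ x) (rad _ x) (x ord0 x1) (x ord0 x2) (x ord0 x3) => a b u v w.
have -> : 2 * (3 / 2) * b = 3 * b by field.
rewrite !expr2 !(cD, cM) !cn.
move: (a%:C%C) (b%:C%C) (u%:C%C) (v%:C%C) (w%:C%C) => {}a {}b {}u {}v {}w; split; last by ring.
transitivity (2 * a * (u * u - (Im * Im) * (v * v) + w * w) + b * (2 - Im * Im)); first by ring.
by rewrite II; ring.
Qed.

(** In the last two rows the derivative in x_3 is diagonal. The sum and the difference of the two
    parities turn these rows into combinations of the Cauchy-Riemann operators in (x_3, x_2), each
    acting on the parity it annihilates. *)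
Definition spatial_comp (k : 'I_4) : 'rV[R]_3 -> R[i] :=
  nth (fun=> 0) [:: fun x => G false x + W1 x; fun x => G true x + W2 x;
    fun x => H false x + H true x; fun x => H true x + - H false x] k.

Let sG par : csmooth [set x | x != 0] (G par).
Proof. exact: csmooth_cblock beta0 j02 belt_cutoffP par. Qed.

Let sH par : csmooth [set x | x != 0] (H par).
Proof. exact: csmooth_cblock beta0 j02 cap_cutoffP par. Qed.

Let sNH par : csmooth [set x | x != 0] (fun x => - H par x).
Proof.
have oP := @open_punctured R 3.
by apply: (eq_csmooth oP _ (csmoothM oP (csmooth_cst (-1) oP) (sH par))) => x _; rewrite mulN1r.
Qed.

Let sW1 : csmooth [set x | x != 0] W1. Proof. exact: csmooth_piece. Qed.
Let sW2 : csmooth [set x | x != 0] W2. Proof. exact: csmooth_piece. Qed.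

Let spatial_row (k : 'I_4) x : x != 0 ->
  \sum_(j < 3) \sum_(l < 4) weyl j k l * cpartial j (spatial_comp l) x =
  nth 0 [:: (cpartial x1 (G true) x + Complex 0 (sgn true) * cpartial x2 (G true) x) +
              cpartial x3 (G false) x + (defect (3 / 2) x)%:C%C;
            (cpartial x1 (G false) x + Complex 0 (sgn false) * cpartial x2 (G false) x) -
              cpartial x3 (G true) x;
            - (cpartial x3 (H false) x + Complex 0 (sgn false) * cpartial x2 (H false) x) -
              (cpartial x3 (H true) x + Complex 0 (sgn true) * cpartial x2 (H true) x) +
              cpartial x1 (H false) x - cpartial x1 (H true) x;
            - (cpartial x3 (H false) x + Complex 0 (sgn false) * cpartial x2 (H false) x) +
              (cpartial x3 (H true) x + Complex 0 (sgn true) * cpartial x2 (H true) x) -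
              cpartial x1 (H false) x - cpartial x1 (H true) x] k.
Proof.
move=> x0; rewrite (weyl_row (fun j l => cpartial j (spatial_comp l) x)).
have E1 j : cpartial j (spatial_comp k1) x = cpartial j (G false) x + cpartial j W1 x.
  exact: (cpartialD j (sG false) sW1 x0).
have E2 j : cpartial j (spatial_comp k2) x = cpartial j (G true) x + cpartial j W2 x.
  exact: (cpartialD j (sG true) sW2 x0).
have E3 j : cpartial j (spatial_comp k3) x = cpartial j (H false) x + cpartial j (H true) x.
  exact: (cpartialD j (sH false) (sH true) x0).
have E4 j : cpartial j (spatial_comp k4) x = cpartial j (H true) x - cpartial j (H false) x.
  by rewrite -(cpartialN j (sH false) x0); exact: (cpartialD j (sH true) (sNH false) x0).
rewrite !E1 !E2 !E3 !E4; have [<- R2] := radial3 x0.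
have -> : Complex 0 (sgn true) = - Im by apply/eqP; rewrite eq_complex /= oppr0 !eqxx.
have -> : Complex 0 (sgn false) = Im :> R[i] by [].
move: R2.
generalize (cpartial x1 (G true) x) (cpartial x2 (G true) x) (cpartial x3 (G true) x)
  (cpartial x1 (G false) x) (cpartial x2 (G false) x) (cpartial x3 (G false) x)
  (cpartial x1 (H true) x) (cpartial x2 (H true) x) (cpartial x3 (H true) x)
  (cpartial x1 (H false) x) (cpartial x2 (H false) x) (cpartial x3 (H false) x)
  (cpartial x1 W1 x) (cpartial x2 W1 x) (cpartial x3 W1 x)
  (cpartial x1 W2 x) (cpartial x2 W2 x) (cpartial x3 W2 x).
move=> g1 g2 g3 g4 g5 g6 h1 h2 h3 h4 h5 h6 w1 w2 w3 v1 v2 v3 R2.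
case: k => [[|[|[|[|//]]]] ?] /=; [by ring| |by ring|by ring].
by rewrite -[RHS]addr0 -R2; ring.
Qed.

(** [env] is increasing, so the errors of both pairs are bounded by its value at the larger rho.
    That value belongs to the pair of full size: x_1 ^ 2 >= x_3 ^ 2 decides which rho is larger and
    also bounds the angular factor of [belt_cutoff] below. *)
Definition envelope x : R := env beta (Num.max (rho x1 x2 x) (rho x3 x2 x)).

Let half_sqn_le x : sqn x / 2 <= Num.max (rho x1 x2 x) (rho x3 x2 x).
Proof.
rewrite ler_pdivrMr// mulr_natr mulr2n.
apply: (@le_trans _ _ (rho x1 x2 x + rho x3 x2 x)).
  by rewrite sqn3 /rho; have := sqr_ge0 (x ord0 x2); lra.
by apply: lerD; rewrite le_max lexx ?orbT.
Qed.

Let max_rho_ge x : 1 / 8 < sqn x -> 1 / 16 <= Num.max (rho x1 x2 x) (rho x3 x2 x).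
Proof. by have := half_sqn_le x; lra. Qed.

Let spatial_dirac_le : exists2 K, 0 <= K & forall k x, x != 0 -> sqn x <= 1 / 2 ->
  nrmc (\sum_(j < 3) \sum_(l < 4) weyl j k l * cpartial j (spatial_comp l) x) <=
  K * (sqn x `^ (- beta - 1 / 2) * envelope x).
Proof.
have [K1 K10 HK1] := cblock_dbar_env beta0 j02 (isT : x1 != x2) belt_cutoffP.
have [K2 K20 HK2] := cblock_dbar_env beta0 j02 (isT : x3 != x2) cap_cutoffP.
have m1 : 1 <= 3 / 2 :> R by lra.
have [K3 K30 HK3] := @defect_le R 3 beta beta0 (3 / 2) m1.
exists (K1 + K1 + K3 + (K2 + K2 + K2 + K2)); first by rewrite !addr_ge0.
move=> k x x0 s1; have s0 := sqn_gt0 x0; rewrite (spatial_row k x0).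
have e0 : 0 <= envelope x by exact: env_ge0.
set r := Num.max (rho x1 x2 x) (rho x3 x2 x).
have r1 : rho x1 x2 x <= r by rewrite le_max lexx.
have r2 : rho x3 x2 x <= r by rewrite le_max lexx orbT.
set B := _ * envelope x.
have B0 : 0 <= B by apply: mulr_ge0 e0; exact: powR_ge0.
have GB par := HK1 par x r x0 s1 r1.
have HB par := HK2 par x r x0 s1 r2.
have [Gt1 /(_ x3 isT isT) Gt2] := GB true; have [Gf1 /(_ x3 isT isT) Gf2] := GB false.
have [Ht1 /(_ x1 isT isT) Ht2] := HB true; have [Hf1 /(_ x1 isT isT) Hf2] := HB false.
have DB : nrmc (defect (3 / 2) x)%:C%C <= K3 * B.
  rewrite nrmc_real; apply: (HK3 x _ x0 s1 e0) => s8; apply: (le_env beta0); first by rewrite divr_gt0.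
  exact: max_rho_ge.
have K1B : 0 <= K1 * B by exact: mulr_ge0.
have K2B : 0 <= K2 * B by exact: mulr_ge0.
have K3B : 0 <= K3 * B by exact: mulr_ge0.
rewrite -/B in Gt1 Gt2 Gf1 Gf2 Ht1 Ht2 Hf1 Hf2.
have -> : (K1 + K1 + K3 + (K2 + K2 + K2 + K2)) * B =
  K1 * B + K1 * B + K3 * B + (K2 * B + K2 * B + K2 * B + K2 * B) by ring.
have Dle (z w : R[i]) (s t : R) : nrmc z <= s -> nrmc w <= t -> nrmc (z + w) <= s + t.
  by move=> zs wt; exact: le_trans (nrmcD _ _) (lerD zs wt).
have Nle (z : R[i]) (s : R) : nrmc z <= s -> nrmc (- z) <= s by rewrite nrmcN.
have K4B : 0 <= K2 * B + K2 * B + K2 * B + K2 * B by rewrite !addr_ge0.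
have K5B : 0 <= K1 * B + K1 * B + K3 * B by rewrite !addr_ge0.
case: k => [[|[|[|[|//]]]] ?]; rewrite [nth _ _ _]/=.
- apply: (@le_trans _ _ (K1 * B + K1 * B + K3 * B)); last by rewrite lerDl.
  exact: Dle (Dle _ _ _ _ Gt1 Gf2) DB.
- apply: (@le_trans _ _ (K1 * B + K1 * B)); last by rewrite -addrA lerDl addr_ge0.
  exact: Dle Gf1 (Nle _ _ Gt2).
- apply: (@le_trans _ _ (K2 * B + K2 * B + K2 * B + K2 * B)); last by rewrite lerDr.
  exact: Dle (Dle _ _ _ _ (Dle _ _ _ _ (Nle _ _ Hf1) (Nle _ _ Ht1)) Hf2) (Nle _ _ Ht2).
- apply: (@le_trans _ _ (K2 * B + K2 * B + K2 * B + K2 * B)); last by rewrite lerDr.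
  exact: Dle (Dle _ _ _ _ (Dle _ _ _ _ (Nle _ _ Hf1) Ht1) (Nle _ _ Hf2)) (Nle _ _ Ht2).
Qed.

Let spatial_outer x : x != 0 -> 1 / 2 < sqn x -> forall k,
  \sum_(j < 3) \sum_(l < 4) weyl j k l * cpartial j (spatial_comp l) x = 0.
Proof.
move=> x0 s1 k; rewrite (spatial_row k x0).
have -> : defect (3 / 2) x = 0 by rewrite /defect dstep_le0 ?mulr0 ?mul0r//; lra.
have G0 par l : cpartial l (G par) x = 0 by exact: cblock_outer0 belt_cutoffP par l x s1.
have H0 par l : cpartial l (H par) x = 0 by exact: cblock_outer0 cap_cutoffP par l x s1.
move: (G0 true x1) (G0 true x2) (G0 true x3) (G0 false x1) (G0 false x2) (G0 false x3)
  (H0 true x1) (H0 true x2) (H0 true x3) (H0 false x1) (H0 false x2) (H0 false x3).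
generalize (cpartial x1 (G true) x) (cpartial x2 (G true) x) (cpartial x3 (G true) x)
  (cpartial x1 (G false) x) (cpartial x2 (G false) x) (cpartial x3 (G false) x)
  (cpartial x1 (H true) x) (cpartial x2 (H true) x) (cpartial x3 (H true) x)
  (cpartial x1 (H false) x) (cpartial x2 (H false) x) (cpartial x3 (H false) x).
move=> ? ? ? ? ? ? ? ? ? ? ? ? -> -> -> -> -> -> -> -> -> -> -> ->.
case: k => [[|[|[|[|//]]]] ?]; rewrite [nth _ _ _]/= !mulr0 !(addr0, oppr0)//.
Qed.

Let spatial_upper x k : x != 0 -> nrmc (spatial_comp k x) <=
  (2 * kamp beta j0 + 2 * 8 / env beta (1 / 8)) * env beta (sqn x).
Proof.
move=> x0.
have k0 := kamp_ge0 beta j0.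
have e8 : 0 < env beta (1 / 8) by exact: env_gt0.
have e0 : 0 <= env beta (sqn x) by exact: env_ge0.
set A := kamp beta j0 * env beta (sqn x).
set B := 2 * 8 / env beta (1 / 8) * env beta (sqn x).
have A0 : 0 <= A by exact: mulr_ge0.
have B0 : 0 <= B by rewrite !mulr_ge0// invr_ge0 ltW.
have -> : (2 * kamp beta j0 + 2 * 8 / env beta (1 / 8)) * env beta (sqn x) = A + A + B.
  by rewrite /A /B; ring.
have HG par : nrmc (G par x) <= A.
  exact: (nrmc_cblock (isT : x1 != x2) beta0 j02 belt_cutoffP par x).
have HH par : nrmc (H par x) <= A.
  exact: (nrmc_cblock (isT : x3 != x2) beta0 j02 cap_cutoffP par x).
have HW (Z : 'rV[R]_3 -> R[i]) : (forall y, nrmc (Z y) <= 2 * sqn y `^ (3 / 2 - 1)) ->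
    nrmc (piece (3 / 2) Z x) <= B.
  move=> Z_le; have [s8|s8] := leP (sqn x) (1 / 8).
    by rewrite (piece0 _ _ s8) nrmc0.
  apply: le_trans (nrmc_piece8 (ler0n _ 2) Z_le x0 s8) _.
  rewrite /B mulrAC ler_pdivlMr//; apply: ler_wpM2l; first by rewrite mulr_ge0.
  by apply: (le_env beta0); [rewrite divr_gt0|exact: ltW].
have GW par (w : R[i]) : nrmc w <= B -> nrmc (G par x + w) <= A + A + B.
  move=> wB; apply: le_trans (nrmcD _ _) _; apply: lerD wB.
  by apply: le_trans (HG par) _; rewrite lerDl.
have HAB : A + A <= A + A + B by rewrite lerDl.
case: k => [[|[|[|[|//]]]] ?].
- exact: GW false _ (HW _ Z1_le).
- exact: GW true _ (HW _ Z2_le).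
- by apply: le_trans HAB; apply: le_trans (nrmcD _ _) _; exact: lerD.
- apply: le_trans HAB; apply: le_trans (nrmcD _ _) _; apply: lerD; first exact: HH.
  by rewrite nrmcN.
Qed.

Let cut_ge (a : R) x : 0 <= a -> sqn x <= 1 / 4 ->
  step0 * flat (1 / 2) <= inner_cutoff x * flat (1 / 2 + a / sqn x).
Proof.
move=> a0 s; rewrite inner_cutoff_inner// ler_wpM2l ?(ltW step0_gt0)//.
by apply: le_flat; rewrite lerDl divr_ge0 ?sqn_ge0.
Qed.

Let split_sum (z w : R[i]) (c : R) : 2 * c <= nrmc z + nrmc w -> c <= nrmc z \/ c <= nrmc w.
Proof.
by move=> h; have [|zc] := leP c (nrmc z); [left|right; lra].
Qed.

(** The radial pieces carry this zone. If rho >= |x| ^ 2 / 4, then [W2] is large and alone in its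
    component, as the parity [true] is off. Otherwise [belt_cutoff] vanishes and [W1] is alone, with
    x_3 ^ 2 at least 3 / 4 of |x| ^ 2. In both cases the numerator is at least 1 / 4, whence the
    denominator of the constant. *)
Let lower_far x : x != 0 -> sqn x <= 1 / 2 -> 1 / 4 <= sqn x ->
  exists k, kappa / 4 <= nrmc (spatial_comp k x).
Proof.
move=> x0 s1 s4; have s0 := sqn_gt0 x0; have ks := @kappa_le R; have st := @step0_gt0 R.
have p1 : 1 <= sqn x `^ (- (3 / 2)).
  by have := @le_powRN R (3 / 2) (sqn x) 1; rewrite powR1; apply; lra.
have W_ge (Z : 'rV[R]_3 -> R[i]) : 1 / 4 <= nrmc (Z x) ->
    kappa / 4 <= nrmc (piece (3 / 2) Z x).
  move=> Zx; rewrite /piece (nrmcM _ (Z x)) nrmc_real rad_outer//.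
  rewrite ger0_norm; last by apply: mulr_ge0; [exact: ltW|exact: powR_ge0].
  rewrite -[kappa / 4]/(kappa * 4^-1) -div1r; apply: ler_pM => //; [exact: ltW (@kappa_gt0 R)|].
  by apply: le_trans ks _; rewrite ler_peMr// ltW.
have [r|r] := leP (sqn x / 4) (rho x1 x2 x).
  exists k2; have G0 : G true x = 0.
    by apply: (cblock_true0 beta0 j0_large); lra.
  rewrite -[spatial_comp k2 x]/(G true x + W2 x) G0 add0r; apply: W_ge.
  rewrite nrmc_zeta -(@ler_pXn2r _ 2)// ?nnegrE ?sqrtr_ge0//.
  by rewrite sqr_sqrtr ?rho_ge0//; lra.
exists k1; have G0 : G false x = 0.
  have [_ _ psi_in _ _] := belt_cutoffP.
  by apply: cblock_eq0; apply: psi_in; lra.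
rewrite -[spatial_comp k1 x]/(G false x + W1 x) G0 add0r; apply: W_ge.
rewrite nrmc_real -(@ler_pXn2r _ 2)// ?nnegrE//.
rewrite real_normK ?num_real//.
have := sqn3 x; rewrite -/(rho x1 x2 x); lra.
Qed.

(** For 1 / 8 < sqn < 1 / 4 the piece [W1] may cancel the mode in the first component. But |x_3| <=
    |x_1| gives |W1| <= |W2|, and [W2] is alone in the second component, so the two components
    cannot both be small. *)
Let lower_belt x : x != 0 -> sqn x < 1 / 4 -> x ord0 x3 ^+ 2 <= x ord0 x1 ^+ 2 ->
  exists k, kappa / 4 * env beta (rho x1 x2 x) <= nrmc (spatial_comp k x).
Proof.
move=> x0 s4 x31; have s0 := sqn_gt0 x0; have kp := @kappa_gt0 R.
have sr : sqn x <= 2 * rho x1 x2 x.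
  by rewrite sqn3 /rho; have := sqr_ge0 (x ord0 x2); lra.
have r0 : 0 < rho x1 x2 x by lra.
have r1 : rho x1 x2 x <= 1 by have := rho_le x; lra.
have px : step0 * flat (1 / 2) <= belt_cutoff x.
  by apply: cut_ge; [rewrite subr_ge0|exact: ltW].
have e0 : 0 <= env beta (rho x1 x2 x) by exact: env_ge0.
have [par Hp] := cblock_lower beta0 j02 r0 r1 px.
set E := env beta (rho x1 x2 x) in e0 Hp *.
have kE0 : 0 <= kappa * E by apply: mulr_ge0 e0; exact: ltW.
have kE : kappa / 4 * E <= kappa * E.
  by rewrite mulrAC ler_piMr// invf_le1// ler1n.
have [s8|s8] := leP (sqn x) (1 / 8).
  case: par Hp => Hp.
    exists k2; rewrite -[spatial_comp k2 x]/(G true x + W2 x) /W2 (piece0 _ _ s8) addr0.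
    exact: le_trans kE Hp.
  exists k1; rewrite -[spatial_comp k1 x]/(G false x + W1 x) /W1 (piece0 _ _ s8) addr0.
  exact: le_trans kE Hp.
have G0 : G true x = 0 by apply: (cblock_true0 beta0 j0_large); lra.
have f1E : spatial_comp k1 x = G false x + W1 x by [].
have f2E : spatial_comp k2 x = W2 x by rewrite -[LHS]/(G true x + W2 x) G0 add0r.
have GE : kappa * E <= nrmc (G false x).
  by case: par Hp => // Hp; apply: le_trans Hp _; rewrite -/(G true x) G0 nrmc0 nrmc_ge0.
have WW : nrmc (W1 x) <= nrmc (W2 x).
  rewrite /W1 /W2 /piece (nrmcM _ (Z1 x)) (nrmcM _ (Z2 x)); apply: ler_wpM2l; first exact: nrmc_ge0.
  rewrite nrmc_zeta nrmc_real -(@ler_pXn2r _ 2) ?nnegrE ?sqrtr_ge0//.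
  rewrite real_normK ?num_real// sqr_sqrtr ?rho_ge0// (le_trans x31)//.
  by rewrite lerDl sqr_ge0.
have : 2 * (kappa / 4 * E) <= nrmc (spatial_comp k1 x) + nrmc (spatial_comp k2 x).
  apply: (@le_trans _ _ (kappa * E)).
    rewrite mulrA; apply: ler_wpM2r => //; move: kp; lra.
  apply: le_trans GE _; rewrite f2E.
  have -> : G false x = spatial_comp k1 x - W1 x by rewrite f1E addrK.
  apply: le_trans (nrmcD _ _) _; rewrite nrmcN; exact: lerD (lexx _) WW.
by case/split_sum => h; [exists k1|exists k2].
Qed.

Let double_le (z w : R[i]) :
  2 * nrmc z <= nrmc (z + w) + nrmc (w - z) /\ 2 * nrmc w <= nrmc (z + w) + nrmc (w - z).
Proof.
rewrite -(nrmc_nat 2) -!nrmcM; split.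
  have -> : 2%:R * z = (z + w) - (w - z) by ring.
  by apply: le_trans (nrmcD _ _) _; rewrite nrmcN.
have -> : 2%:R * w = (z + w) + (w - z) by ring.
exact: nrmcD.
Qed.

(** No radial piece interferes in these components; by [double_le] a large mode of either parity
    makes the sum or the difference large. *)
Let lower_cap x : x != 0 -> sqn x < 1 / 4 -> x ord0 x1 ^+ 2 <= x ord0 x3 ^+ 2 ->
  exists k, kappa / 4 * env beta (rho x3 x2 x) <= nrmc (spatial_comp k x).
Proof.
move=> x0 s4 x13; have s0 := sqn_gt0 x0; have kp := @kappa_gt0 R.
have sr : sqn x <= 2 * rho x3 x2 x.
  by rewrite sqn3 /rho; have := sqr_ge0 (x ord0 x2); lra.
have r0 : 0 < rho x3 x2 x by lra.
have r1 : rho x3 x2 x <= 1 by have := rho_le_sqn (isT : x3 != x2) x; lra.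
have px : step0 * flat (1 / 2) <= cap_cutoff x.
  by apply: cut_ge; [rewrite subr_ge0|exact: ltW].
have e0 : 0 <= env beta (rho x3 x2 x) by exact: env_ge0.
have [par Hp] := cblock_lower beta0 j02 r0 r1 px.
set E := env beta (rho x3 x2 x) in e0 Hp *.
have kE0 : 0 <= kappa * E by apply: mulr_ge0 e0; exact: ltW.
have f3E : spatial_comp k3 x = H false x + H true x by [].
have f4E : spatial_comp k4 x = H true x - H false x by [].
have : 2 * (kappa / 4 * E) <= nrmc (spatial_comp k3 x) + nrmc (spatial_comp k4 x).
  apply: (@le_trans _ _ (2 * (kappa * E))).
    by rewrite ler_wpM2l// mulrAC ler_piMr// invf_le1// ler1n.
  apply: (@le_trans _ _ (2 * nrmc (H par x))); first by rewrite ler_wpM2l.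
  rewrite f3E f4E; have [h1 h2] := double_le (H false x) (H true x).
  by case: (par); [exact: h2|exact: h1].
by case/split_sum => h; [exists k3|exists k4].
Qed.

Let spatial_lower x : x != 0 -> sqn x <= 1 / 2 ->
  exists k, kappa / 4 * envelope x <= nrmc (spatial_comp k x).
Proof.
move=> x0 s1; have k4 : 0 <= kappa / 4 :> R by rewrite divr_ge0// ltW// kappa_gt0.
have [s|s] := leP (1 / 4) (sqn x).
  have [k Hk] := lower_far x0 s1 s; exists k; apply: le_trans Hk.
  by rewrite ler_piMr//; exact: env_le1.
have [x13|x31] := leP (x ord0 x3 ^+ 2) (x ord0 x1 ^+ 2).
  have [k Hk] := lower_belt x0 s x13; exists k.
  by rewrite /envelope max_l// lerD2r.
have [k Hk] := lower_cap x0 s (ltW x31); exists k.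
by rewrite /envelope max_r// lerD2r ltW.
Qed.

Lemma spatial_case (gamma : R) (alpha : 'I_4 -> 'M[R[i]]_4) : 1 < gamma ->
  beta = (gamma - 1) / 2 ->
  (forall j k, alpha j *m alpha k + alpha k *m alpha j = (2 * (j == k)%:R)%:M) ->
  vanishing_solution alpha gamma.
Proof.
move=> g1 bE acl.
have sq j : alpha j * alpha j = 1.
  have n2 : 2 != 0 :> R[i] by rewrite pnatr_eq0.
  have := acl j j; rewrite eqxx mulr1 => E; apply: (scalerI n2).
  rewrite -[RHS]/(2 *: 1%:M) scalemx1 -E [LHS]scaler_nat; exact: mulr2n.
have ac j k : j != k -> alpha k * alpha j = - (alpha j * alpha k).
  move=> /negbTE jk; have := acl j k; rewrite jk mulr0 raddf0 => /eqP.
  by rewrite addrC addr_eq0 => /eqP.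
have [P [Pu P1 P2 P3]] := weyl_basis (sq k1) (sq k2) (sq k3) (sq k4)
  (ac k1 k2 isT) (ac k1 k3 isT) (ac k1 k4 isT) (ac k2 k3 isT) (ac k2 k4 isT) (ac k3 k4 isT).
have gE : - (gamma / 2) = - beta - 1 / 2 by rewrite bE; field.
have [K K0 HK] := spatial_dirac_le.
apply: (@vanishing_solution_of_comp R 3 4 alpha gamma P weyl spatial_comp envelope (1 / (4 * beta)) K (kappa / 4)
  (2 * kamp beta j0 + 2 * 8 / env beta (1 / 8)) isT g1 Pu).
- have E (j : 'I_3) (k : 'I_4) (A : 'M[R[i]]_4) : val j = val k -> alpha k *m P = P *m A ->
      alpha (widen_ord (leqnSn 3) j) *m P = P *m A.
    by move=> jk <-; congr (alpha _ *m P); exact: val_inj.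
  by case=> [[|[|[|//]]] ?]; [exact: E P1|exact: E P2|exact: E P3].
- have tG par : ctame (G par).
    exact: (cblock_tame (isT : x1 != x2) beta0 j02 belt_cutoffP par isT).
  have tH par : ctame (H par).
    exact: (cblock_tame (isT : x3 != x2) beta0 j02 cap_cutoffP par isT).
  have m0 : 0 <= 3 / 2 :> R by lra.
  have tW1 : ctame W1 by exact: (piece_tame m0 (ler0n _ 2) sZ1 Z1d Z1_le dZ1_le isT).
  have tW2 : ctame W2 by exact: (piece_tame m0 (ler0n _ 2) sZ2 Z2d Z2_le dZ2_le isT).
  case=> [[|[|[|[|//]]]] ?].
  + exact: ctameD (tG false) tW1.
  + exact: ctameD (tG true) tW2.
  + exact: ctameD (tH false) (tH true).
  + exact: ctameD (tH true) (ctameN (tH false)).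
- by rewrite divr_gt0// mulr_gt0.
- by rewrite divr_gt0// kappa_gt0.
- exact: K0.
- by move=> x; exact: env_gt0.
- by move=> x x0 s1 k; rewrite gE; exact: HK.
- exact: spatial_lower.
- exact: spatial_outer.
- by move=> x x0 k; rewrite (env_sqnE x bE); exact: spatial_upper.
Qed.

End space.

Theorem theorem1p6 (R : realType) (n : nat) (hn : n = 2%N \/ n = 3%N)
  (alpha : 'I_n.+1 -> 'M[R[i]]_(spinor_dim n)) (halpha : dirac_matrices alpha)
  (gamma : R) (hgamma : 1 < gamma) :
  exists (u : 'rV[R]_n -> 'cV[R[i]]_(spinor_dim n)) (C1 C2 C3 : R),
    [/\ spinor_H1 u,
        spinor_smooth_on [set x | x != 0] u,
        (exists2 x, x != 0 & u x != 0),
        [/\ 0 < C1, 0 < C2 & 0 < C3] &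
        forall x : 'rV[R]_n, x != 0 ->
          cnorm (u x) <= C1 * expR (- (C2 / enorm x `^ (2 * gamma - 2))) /\
          cnorm (dirac_op alpha u x) <=
            if n == 2%N then C3 * enorm x `^ (- gamma) * cnorm (u x)
            else C3 * enorm x `^ (- gamma) * `|ln (enorm x)| ^+ 3 * cnorm (u x)].
Proof.
pose beta := (gamma - 1) / 2.
have beta0 : 0 < beta by rewrite divr_gt0// subr_gt0.
(* [v] is the value of [tau] at rho = 1 / 16. With [j0] at least [v] the parity [true], whose first
   mode is on only for t > j0, is off for rho >= 1 / 16; the double successor also gives 2 <= j0. *)
pose v : R := (1 / 16) `^ (- beta); pose j0 := (Num.truncn v).+2.
have j02 : (2 <= j0)%N by [].
have j0_large : (1 / 16) `^ (- beta) <= j0%:R :> R.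
  by rewrite -/v (le_trans (ltW (truncnS_gt v)))// ler_nat.
case: hn alpha halpha => -> alpha [_ anticomm planar].
  exact: (planar_case beta0 j02 j0_large hgamma erefl planar).
exact: (spatial_case beta0 j02 j0_large hgamma erefl anticomm).
Qed.
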